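(* Let $t\in\mathbb{C}$ be generic and let $\mathrm{o}\mathcal{B}\mathrm{r}_t$ be the oriented Brauer category with parameter $t$ and generating objects $\uparrow$ and $\downarrow$. For an object $X$ let $b_n^{X}$ be the number of indecomposable direct summands of $X^{\otimes n}$, counted with multiplicities. Let $cd(k)$ denote the sum of the dimensions of the simple complex representations of the symmetric group on $k$ letters (up to isomorphism). (1) For $X=\uparrow$: $\sqrt[n]{b_n^{X}}\sim\frac{1}{\sqrt e}\cdot\sqrt n$ as $n\to\infty$. (2) For $X=\uparrow\otimes\downarrow$: $$b_n^{X}=\sum_{k=0}^{n}cd(k)^2\binom nk^2(n-k)!=cd(2n)\quad\text{for all } n\geq0,$$ and as $n\to\infty$ $$b_n^{X}\sim n^n2^{n-1/2}\exp\big(-n+\sqrt{2n}-1/4\big)\Big(1+\frac{7}{24\sqrt{2n}}\Big),\qquad \sqrt[n]{b_n^{X}}\sim\frac2e\cdot n.$$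
   Context: $f(n)\sim g(n)$ means $f(n)/g(n)\to1$ as $n\to\infty$. The oriented Brauer category $\mathrm{o}\mathcal{B}\mathrm{r}_t$ is the $\mathbb{C}$-linear strict symmetric monoidal category whose objects are finite words in $\uparrow,\downarrow$, and where $\mathrm{Hom}(v,w)$ has as basis the oriented Brauer diagrams: perfect matchings of the disjoint union of the letters of $v$ (bottom points) and of $w$ (top points) such that every strand can be oriented consistently with the arrows at its two endpoints (so a strand from bottom to top joins equal letters, and a strand joining two bottom points or two top points joins $\uparrow$ with $\downarrow$). Composition is vertical stacking, with each closed loop removed and replaced by the factor $t$; the tensor product is concatenation/horizontal juxtaposition. Generic $t$ means that the category is semisimple, i.e. all endomorphism algebras of objects are semisimple. Direct summands are taken in the additive Karoubi envelope. *)

(* Defs.v *)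
From HB Require Import structures.
From mathcomp Require Import all_boot all_order all_algebra all_fingroup.
From mathcomp Require Import all_character.
From mathcomp Require Import complex.
From mathcomp Require Import all_classical all_reals all_analysis.

Set Implicit Arguments.
Unset Strict Implicit.
Unset Printing Implicit Defensive.

Import Order.TTheory GRing.Theory Num.Theory.
Import numFieldNormedType.Exports.

Local Open Scope ring_scope.

(** * Oriented Brauer diagrams *)

Inductive arrow : Set := Up | Down.

Definition same_arrow (a b : arrow) : bool :=
  match a, b with Up, Up | Down, Down => true | _, _ => false end.

Definition word := seq arrow.

Definition wup : word := [:: Up].
Definition wdown : word := [:: Down].

(* The tensor product of objects is concatenation of words, with unit [::]. *)
Definition tens_pow (X : word) (n : nat) : word := flatten (nseq n X).

Definition letter (w : word) (i : 'I_(size w)) : arrow := tnth (in_tuple w) i.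

(* The boundary of a diagram v -> w: bottom points (inl), top points (inr). *)
Definition points (v w : word) : finType := ('I_(size v) + 'I_(size w))%type.

Definition orientable (v w : word) (x y : points v w) : bool :=
  match x, y with
  | inl i, inl j => ~~ same_arrow (letter i) (letter j)
  | inr i, inr j => ~~ same_arrow (letter i) (letter j)
  | inl i, inr j => same_arrow (letter i) (letter j)
  | inr i, inl j => same_arrow (letter i) (letter j)
  end.

(* A perfect matching is encoded by the fixed-point free involution sending
   each point to its partner. *)
Definition is_diagram (v w : word) (d : {ffun points v w -> points v w}) :=
  [forall x, [&& d x != x, d (d x) == x & orientable x (d x)]].

Record diagram (v w : word) := Diagram {
  partner :> {ffun points v w -> points v w};
  partnerP : is_diagram partner }.

HB.instance Definition _ (v w : word) := [isSub for @partner v w].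
HB.instance Definition _ (v w : word) := [Finite of diagram v w by <:].

(** * Stacking *)

Section Stacking.
Variables (u v w : word).

(* The vertices of the picture obtained by putting a diagram v -> w on top of a
   diagram u -> v: bottom, middle and top points. *)
Definition stack_points : finType :=
  ('I_(size u) + 'I_(size v) + 'I_(size w))%type.

Definition in_lower (p : points u v) : stack_points := inl p.

Definition in_upper (p : points v w) : stack_points :=
  match p with inl j => inl (inr j) | inr k => inr k end.

Definition in_outer (p : points u w) : stack_points :=
  match p with inl i => inl (inl i) | inr k => inr k end.

Definition stack_edge (d1 : diagram u v) (d2 : diagram v w) : rel stack_points :=
  fun x y =>
    [exists p, (x == in_lower p) && (y == in_lower (d1 p))] ||
    [exists p, (x == in_upper p) && (y == in_upper (d2 p))].

(* d is the diagram left after removing the closed loops.  In the stacked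
   picture, every outer point has degree 1 and every middle point degree 2, so
   that exactly one d has this property. *)
Definition stacks_to (d1 : diagram u v) (d2 : diagram v w) (d : diagram u w) :=
  [forall p, connect (stack_edge d1 d2) (in_outer p) (in_outer (d p))].

(* The closed loops are the connected components without outer point. *)
Definition loops (d1 : diagram u v) (d2 : diagram v w) : nat :=
  n_comp (stack_edge d1 d2)
    [pred x | ~~ [exists p, connect (stack_edge d1 d2) x (in_outer p)]].

End Stacking.

(** * The oriented Brauer category *)

(* The free module on the diagrams v -> w: a morphism is given by its
   coefficients in the diagram basis. *)
Definition hom (K : fieldType) (v w : word) : vectType K :=
  {ffun diagram v w -> K^o}.

Definition idm (K : fieldType) (w : word) : hom K w w :=
  [ffun d : diagram w w => ([forall i, d (inl i) == inr i])%:R].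

(* compm t g f = g \o f, bilinear, with d2 \o d1 = t ^+ loops d1 d2 *: d when
   d1 and d2 stack to d. *)
Definition compm (K : fieldType) (t : K) (u v w : word)
    (g : hom K v w) (f : hom K u v) : hom K u w :=
  [ffun d : diagram u w =>
    \sum_(d1 : diagram u v) \sum_(d2 : diagram v w | stacks_to d1 d2 d)
      t ^+ loops d1 d2 * (g d2 : K) * (f d1 : K)].

Section Identity.
Variables (K : fieldType) (t : K).

Lemma same_arrowxx a : same_arrow a a. Proof. by case: a. Qed.

Definition id_fun (w : word) : {ffun points w w -> points w w} :=
  [ffun x => match x with inl i => inr i | inr i => inl i end].

Lemma id_fun_diagram w : is_diagram (id_fun w).
Proof. by apply/forallP => -[i|i]; rewrite !ffunE /= eqxx same_arrowxx. Qed.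

Definition id_diagram w := Diagram (id_fun_diagram w).

Lemma diagramK v w (d : diagram v w) x : d (d x) = x.
Proof. by case/and3P: (forallP (partnerP d) x) => _ /eqP. Qed.

Lemma diagram_neq v w (d : diagram v w) x : d x != x.
Proof. by case/and3P: (forallP (partnerP d) x). Qed.

Lemma is_id_diagramE w (d : diagram w w) :
  [forall i, d (inl i) == inr i] = (d == id_diagram w).
Proof.
apply/forallP/eqP => [dE | -> i]; last by rewrite ffunE.
apply/val_inj/ffunP => -[i|i]; rewrite ffunE; first exact/eqP.
by rewrite -(eqP (dE i)) diagramK.
Qed.

Section Collapse.
Variables (v w : word) (d2 : diagram v w).
Let e := stack_edge (id_diagram v) d2.

Let collapse (x : stack_points v v w) : points v w :=
  match x with inl (inl i) => inl i | inl (inr i) => inl i | inr k => inr k end.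

Let collapse_outer p : collapse (in_outer v p) = p. Proof. by case: p. Qed.

Let collapse_upper p : collapse (in_upper v p) = p. Proof. by case: p. Qed.

Let connect_collapse x y : connect e x y ->
  (collapse y == collapse x) || (collapse y == d2 (collapse x)).
Proof.
case/connectP => p; elim: p x => [|z p IHp] x /=; first by move=> _ ->; rewrite eqxx.
case/andP => exz pz /(IHp _ pz).
case/orP: exz => /existsP[q /andP[/eqP -> /eqP ->]].
  suff -> : collapse (in_lower w (id_diagram v q)) = collapse (in_lower w q) by [].
  by case: q => i; rewrite ffunE.
by rewrite !collapse_upper diagramK orbC.
Qed.

Let to_outer x : connect e x (in_outer v (collapse x)).
Proof.
case: x => [[i|i]|k] /=; try exact: connect0.
apply/connect1/orP; left; apply/existsP; exists (inr i).
by rewrite ffunE !eqxx.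
Qed.

Let from_outer x : connect e (in_outer v (collapse x)) x.
Proof.
case: x => [[i|i]|k] /=; try exact: connect0.
apply/connect1/orP; left; apply/existsP; exists (inl i).
by rewrite ffunE !eqxx.
Qed.

Lemma stacks_to_id d : stacks_to (id_diagram v) d2 d = (d2 == d).
Proof.
apply/forallP/eqP => [st | <- p].
  apply/val_inj/ffunP => p /=; apply/esym.
  move: (connect_collapse (st p)); rewrite !collapse_outer.
  by rewrite (negPf (diagram_neq d p)) => /eqP.
have := from_outer (in_upper v p); rewrite collapse_upper => c1.
have := to_outer (in_upper v (d2 p)); rewrite collapse_upper => c3.
apply: connect_trans c1 (connect_trans _ c3).
by apply/connect1/orP; right; apply/existsP; exists p; rewrite !eqxx.
Qed.

Lemma loops_id : loops (id_diagram v) d2 = 0%N.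
Proof.
rewrite /loops /n_comp_mem; apply/eqP/pred0P => x /=; rewrite !inE.
apply/negbTE; rewrite negb_and negbK; apply/orP; right.
by apply/existsP; exists (collapse x); exact: to_outer.
Qed.

End Collapse.

Lemma compm_idr v w (f : hom K v w) : compm t f (idm K v) = f.
Proof.
apply/ffunP => d; rewrite ffunE (bigD1 (id_diagram v)) //= [X in _ + X]big1.
  rewrite addr0 (big_pred1 d) => [|d2]; last exact: stacks_to_id.
  by rewrite loops_id expr0 mul1r ffunE is_id_diagramE eqxx mulr1.
move=> d1 d1N; rewrite big1 // => d2 _.
by rewrite ffunE is_id_diagramE (negPf d1N) mulr0.
Qed.

End Identity.

(** * Genericity *)

Section Generic.
Variables (K : fieldType) (t : K).

Definition left_ideal (w : word) (I : {vspace hom K w w}) : Prop :=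
  forall a x : hom K w w, x \in I -> compm t a x \in I.

(* The left regular module of End(w) is semisimple: every submodule is a direct
   summand. *)
Definition semisimple_end (w : word) : Prop :=
  forall I : {vspace hom K w w}, left_ideal I ->
  exists J : {vspace hom K w w},
    [/\ left_ideal J, (I + J = fullv)%VS & (I :&: J = 0)%VS].

Definition generic : Prop := forall w : word, semisimple_end w.

End Generic.

(** * The additive Karoubi envelope *)

Section Karoubi.
Variables (K : fieldType) (t : K).

(* Objects of the additive envelope are finite families of words, thought of as
   formal direct sums; morphisms are matrices of morphisms. *)
Definition amor (I J : finType) (V : I -> word) (W : J -> word) : Type :=
  forall (j : J) (i : I), hom K (V i) (W j).

Definition acomp (I J L : finType) (U : I -> word) (V : J -> word)
    (W : L -> word) (g : amor V W) (f : amor U V) : amor U W :=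
  fun l i => \sum_(j : J) compm t (g l j) (f j i).

Record kar_ob := KarOb {
  kidx : finType;
  kwords : kidx -> word;
  kidem : amor kwords kwords;
  kidemK : acomp kidem kidem = kidem }.

(* Morphisms (V, e) -> (W, e') are the f : V -> W with e' f e = f; the identity
   of (V, e) is e, and composition is acomp. *)
Definition is_kar_mor (P Q : kar_ob) (f : amor (@kwords P) (@kwords Q)) :=
  acomp (@kidem Q) (acomp f (@kidem P)) = f.

Definition kar_zero (P : kar_ob) : Prop := @kidem P = (fun _ _ => 0).

(* P is a direct sum (biproduct) of the objects Y 0, ..., Y (m - 1). *)
Definition is_direct_sum (P : kar_ob) (m : nat) (Y : 'I_m -> kar_ob) : Prop :=
  exists (inc : forall k, amor (@kwords (Y k)) (@kwords P))
         (prj : forall k, amor (@kwords P) (@kwords (Y k))),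
    [/\ forall k, is_kar_mor (inc k),
        forall k, is_kar_mor (prj k),
        forall k, acomp (prj k) (inc k) = @kidem (Y k),
        forall k l, k != l -> acomp (prj k) (inc l) = (fun _ _ => 0)
      & (fun j i => \sum_(k < m) acomp (inc k) (prj k) j i) = @kidem P].

Definition indecomposable (P : kar_ob) : Prop :=
  ~ kar_zero P /\
  forall Y : 'I_2 -> kar_ob, is_direct_sum P Y -> exists k, kar_zero (Y k).

Lemma kar_word_subproof (w : word) :
  let V := fun _ : unit => w in
  acomp (V := V) (fun _ _ => idm K w) (fun _ _ => idm K w)
    = (fun _ _ => idm K w) :> amor V V.
Proof.
apply: functional_extensionality_dep => -[].
apply: functional_extensionality_dep => -[].
by rewrite /acomp (big_pred1 tt) => [|[]//]; rewrite compm_idr.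
Qed.

(* The embedding of the oriented Brauer category into its envelope. *)
Definition kar_word (w : word) : kar_ob := KarOb (kar_word_subproof w).

Definition has_indec_summands (P : kar_ob) (m : nat) : Prop :=
  exists Y : 'I_m -> kar_ob, is_direct_sum P Y /\ forall k, indecomposable (Y k).

(* The number of indecomposable direct summands of X^n with multiplicities: the
   length m of a decomposition into indecomposables (unique by Krull-Schmidt;
   morphism spaces are finite-dimensional).  As [xget] selects an unspecified
   element of the set, a value of b can be derived only by proving that a
   decomposition exists and that all of them have the same length. *)
Definition b (X : word) (n : nat) : nat :=
  xget 0%N [set m | has_indec_summands (kar_word (tens_pow X n)) m]%classic.

End Karoubi.

(** * Representations of symmetric groups *)

(* The simple modules up to isomorphism are indexed by the isotypic components
   of the regular module. *)
Definition cd (K : decFieldType) (k : nat) : nat :=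
  let sG := DecSocleType (regular_repr K [set: 'S_k]) in
  (\sum_(i : sG) irr_degree i)%N.

(** * Asymptotic equivalence *)

Definition asymp (R : realType) (f g : nat -> R) : Prop :=
  ((fun n => f n / g n) @ \oo --> (1 : R))%classic.

(* Main.v *)
Require Import Defs.
From HB Require Import structures.
From mathcomp Require Import all_boot all_order all_algebra all_fingroup.
From mathcomp Require Import all_solvable all_field all_character zify ring.
From mathcomp Require boolp classical_sets.

Set Implicit Arguments.
Unset Strict Implicit.
Unset Printing Implicit Defensive.

Import Order.TTheory GRing.Theory Num.Theory.

(** Let [I n] be the number of involutions of n points.  For every word [w] of
    length n, the object [w] has exactly [I n] indecomposable summands, and also
    [cd n = I n]; the theorem becomes a statement about [I].

    Turning diagrams upside down is an anti-involution * of A = End(w).  Suppose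
    that 1 is a sum of m orthogonal primitive idempotents e_i = e_i*.  Then *
    maps e_i A e_j to e_j A e_i and is the identity on e_i A e_i = C e_i, so its
    trace is m.  As * permutes the diagrams, the trace is also the number of
    diagrams fixed by *; these correspond to the involutions of the letters of
    [w].  The length of a decomposition of 1 does not depend on the choice.

    Such a decomposition is found by induction on n.  The diagrams with a cap
    between points i and j factor through a shorter word, from which idempotents
    are transported.  Modulo the ideal of diagrams with a cap, A is a quotient of
    the group algebra of the permutations preserving the letters, and there a
    decomposition is built along a chain of subgroups: in S_(k+1) each g is
    conjugate to its inverse by an element of S_k, so * fixes the centralizer of
    C[S_k] in C[S_(k+1)] pointwise.  Taking ranks in the irreducible
    representations, the same decomposition of 1 in C[S_n] gives [cd n = I n].

    With s = sqrt(2n),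
    I(2n) = (2n)!/(2^n n!) * \sum_k s^(2k)/(2k)! * n(n-1)...(n-k+1)/n^k.
    The weights s^(2k)/(2k)! concentrate at k = s/2, where the last factor is
    close to exp(-1/4), and sum to cosh s.  The constant in Stirling's formula
    cancels in (2n)!/n!.  For the roots, sqrt(n!) <= I n <= sqrt(n!) exp(2 sqrt n)
    is enough. *)

(** * Involutions *)

(** Composition of diagrams is defined by connectivity, where associativity and loop counts are
    awkward. So a diagram is replaced by the 0/1 matrix of the two-colourings of its boundary that
    agree along strands: products count colourings of the middle points, a closed loop contributes a
    factor 2, the matrix determines the diagram, and identities between composites, loops included,
    become equalities of counts. Genericity enters as von Neumann regularity x = x a x of End(w). It
    yields e A e = K e for primitive e and, through traces of the maps sending x to e x f, the
    invariance of the length. It also forces t to be nonzero; then, with c a cap, sending x to t^-1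
    c' x c (c' the reflected cap) is multiplicative and transports idempotents from the shorter
    word. The delicate point is to get idempotents fixed by the anti-involution. In the ideal they
    are built as v v' / l from some v in f A e with v' v = l e and l nonzero (v' the image of v);
    such a v exists because a nonzero symmetric form in characteristic 0 is not alternating. Modulo
    the ideal, the corners along the chain of subgroups are fixed pointwise, so any refinement into
    primitive idempotents will do. *)

Section InvolutionSets.
Variable T : finType.
Local Open Scope group_scope.
Implicit Types (A : {set T}) (s : {perm T}).

(** Involutions of a subset stay permutations of the whole type, so that removing points in an
    induction does not change the type. *)
Definition involutions_on A : {set {perm T}} := [set s | perm_on A s & s^-1 == s].

Lemma involutionK A s x : s \in involutions_on A -> s (s x) = x.
Proof. by rewrite inE => /andP[_ /eqP ss]; rewrite -{1}ss permK. Qed.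

Lemma involutions_onP A s : reflect ((forall x, s (s x) = x) /\ (forall x, x \notin A -> s x = x))
  (s \in involutions_on A).
Proof.
apply: (iffP idP) => [sA|[sK sA]].
  split=> [x|x xA]; first exact: involutionK sA.
  by move: sA; rewrite inE => /andP[sA _]; apply: out_perm sA xA.
rewrite inE; apply/andP; split.
  by apply/subsetP => x; rewrite inE; apply: contraR => /sA ->.
by rewrite eq_invg_mul; apply/eqP/permP => x; rewrite permM sK perm1.
Qed.

Lemma involutions_on_fix A x : x \in A ->
  [set s in involutions_on A | s x == x] = involutions_on (A :\ x).
Proof.
move=> xA; apply/setP => s; rewrite inE; apply/andP/involutions_onP => [[/involutions_onP[sK sA] /eqP sx]|[sK sA]].
  split=> // y; rewrite !inE negb_and negbK => /orP[/eqP -> //|]; exact: sA.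
split; last by rewrite sA // !inE eqxx.
apply/involutions_onP; split=> // y yA; apply: sA.
by rewrite !inE negb_and yA orbT.
Qed.

(** Left multiplication by [tperm x y] is a bijection between the involutions that fix x and y and
    those that swap them. *)
Lemma card_involutions_on_swap A x y : x \in A -> y \in A -> x != y ->
  #|[set s in involutions_on A | s x == y]| = #|involutions_on (A :\ x :\ y)|.
Proof.
move=> xA yA xy; rewrite -[RHS](card_imset _ (mulgI (tperm x y))).
congr #|pred_of_set _|; apply/setP => s; rewrite inE; apply/andP/imsetP.
  case=> /involutions_onP[sK sA] /eqP sx; have sy : s y = x by rewrite -sx sK.
  exists (tperm x y * s); last by rewrite mulgA tperm2 mul1g.
  apply/involutions_onP; split=> z; last first.
    rewrite !inE !negb_and !negbK permM => /or3P[/eqP ->|/eqP ->|zA].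
    - by rewrite tpermR.
    - by rewrite tpermL.
    rewrite tpermD ?sA //; first by apply: contraNneq zA => <-.
    by apply: contraNneq zA => <-.
  rewrite !permM; case: (tpermP x y z) => [->|->|/eqP zx /eqP zy].
  - by rewrite sy tpermL sy.
  - by rewrite sx tpermR sx.
  rewrite tpermD ?sK // eq_sym.
    by apply: contraNneq zy => E; rewrite -[z]sK E sx.
  by apply: contraNneq zx => E; rewrite -[z]sK E sy.
case=> s' /involutions_onP[sK sA] ->.
have s'x : s' x = x by rewrite sA // !inE eqxx andbF.
have s'y : s' y = y by rewrite sA // !inE eqxx.
split; last by rewrite permM tpermL s'y.
apply/involutions_onP; split=> z; last first.
  move=> zA; rewrite permM tpermD; first by rewrite sA // !inE !negb_and zA !orbT.
    by apply: contraNneq zA => <-.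
  by apply: contraNneq zA => <-.
rewrite !permM; case: (tpermP x y z) => [->|->|/eqP zx /eqP zy].
- by rewrite s'y tpermR s'x.
- by rewrite s'x tpermL s'y.
rewrite tpermD ?sK // eq_sym.
  by apply: contraNneq zx => E; rewrite -[z]sK E s'x.
by apply: contraNneq zy => E; rewrite -[z]sK E s'y.
Qed.

End InvolutionSets.

(** The pair is (I n, I (n + 1)); carrying both makes the two-step recursion structural. *)
Fixpoint involution_pair (n : nat) : nat * nat :=
  if n is m.+1 then let: (a, b) := involution_pair m in (b, b + m.+1 * a) else (1, 1).
Definition involution_number (n : nat) : nat := (involution_pair n).1.

Lemma involution_numberS n :
  involution_number n.+2 = involution_number n.+1 + n.+1 * involution_number n.
Proof. by rewrite /involution_number /=; case: (involution_pair n). Qed.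

Lemma card_involutions_on (T : finType) (A : {set T}) : #|involutions_on A| = involution_number #|A|.
Proof.
have [n] := ubnP #|A|; elim: n A => // n IH A; rewrite ltnS => An.
have [->|/set0Pn[x xA]] := eqVneq A set0.
  rewrite cards0 (_ : involutions_on set0 = [set 1%g]) ?cards1 //.
  apply/setP => s; rewrite [RHS]inE; apply/involutions_onP/eqP => [[_ s0]|->].
    by apply/permP => x; rewrite perm1 s0 ?inE.
  by split=> x; rewrite ?perm1.
have -> : #|involutions_on A| = \sum_(y in A) #|[set s in involutions_on A | s x == y]|.
  rewrite -sum1_card (partition_big (fun s : {perm T} => s x) (mem A)) /=.
    apply: eq_bigr => y _; rewrite -sum1_card; apply: eq_bigl => s.
    by rewrite !inE.
  move=> s /involutions_onP[sK sA]; apply: contraT => sx.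
  by move: (sx); rewrite -(sA _ sx) sK xA.
have cA : #|A| = #|A :\ x|.+1 by rewrite (cardsD1 x) xA.
have ltA : #|A :\ x| < n by rewrite -cA.
rewrite (bigD1 x) //= involutions_on_fix // IH //.
rewrite (eq_bigr (fun=> involution_number #|A|.-2)) => [|y /andP[yA yx]].
  have -> : \sum_(i in A | i != x) involution_number #|A|.-2 = #|A :\ x| * involution_number #|A|.-2.
    rewrite sum_nat_const; congr (_ * _); apply: eq_card => y.
    by rewrite !inE andbC.
  rewrite cA /=; case: #|A :\ x| => [|m] //=.
  by rewrite involution_numberS.
rewrite card_involutions_on_swap // 1?eq_sym // IH.
  by congr involution_number; rewrite cA (cardsD1 y (A :\ x)) !inE yx yA.
by apply: leq_ltn_trans ltA; apply/subset_leq_card/subD1set.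
Qed.

Lemma card_involutions n : #|[set s : 'S_n | (s^-1 == s)%g]| = involution_number n.
Proof.
rewrite -[in RHS](card_ord n) -cardsT -card_involutions_on.
apply: eq_card => s; rewrite !inE (_ : perm_on _ s) //.
by apply/subsetP => x; rewrite inE.
Qed.

Local Notation inv := involution_number.

(* Pairings of r + s points, sorted by the number j of pairs joining the first r to the last s. *)
Definition matched_term (r s j : nat) : nat := 'C(r, j) * 'C(s, j) * j`! * inv (r - j) * inv (s - j).

Lemma matched_termS0 r s : matched_term r.+1 s 0 = matched_term r s 0 + r * matched_term r.-1 s 0.
Proof.
rewrite /matched_term !bin0 fact0 !mul1n !subn0.
case: r => [|r]; last by rewrite involution_numberS mulnDl mulnA.
by rewrite mul0n addn0.
Qed.

(** A point is added to the first group: it is alone, paired with one of the r others, or paired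
    with one of the s. Only the last case uses up one of the crossing pairs. *)
Lemma matched_termS r s j : matched_term r.+1 s j.+1 =
  matched_term r s j.+1 + r * matched_term r.-1 s j.+1 + s * matched_term r s.-1 j.
Proof.
rewrite /matched_term binS !mulnDl subSS; congr (_ + _).
  have E : 'C(r, j.+1) * inv (r - j) = 'C(r, j.+1) * inv (r - j.+1) + r * 'C(r.-1, j.+1) * inv (r.-1 - j.+1).
    have [jr|rj] := ltnP j r; last by rewrite !bin_small ?muln0 ?mul0n //; lia.
    rewrite mul_bin_down [X in _ = _ + X * _]mulnC -mulnA -mulnDr; congr (_ * _).
    have -> : r.-1 - j.+1 = (r - j.+1).-1 by lia.
    have -> : r - j = (r - j.+1).+1 by lia.
    by case: (r - j.+1) => [|m] /=; rewrite ?involution_numberS // mul0n addn0.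
  transitivity ('C(r, j.+1) * inv (r - j) * ('C(s, j.+1) * (j.+1)`! * inv (s - j.+1))); first by ring.
  by rewrite E; ring.
have E : 'C(s, j.+1) * j.+1 = s * 'C(s.-1, j) by rewrite mulnC mul_bin_diag.
have -> : s - j.+1 = s.-1 - j by lia.
transitivity ('C(r, j) * ('C(s, j.+1) * j.+1) * j`! * inv (r - j) * inv (s.-1 - j)).
  by rewrite factS; ring.
by rewrite E; ring.
Qed.

(** Summing the recursion over j gives that of [involution_number] at r + s. The bound [N] is free
    because the binomial vanishes for j > r; one induction hypothesis then serves sums of different
    lengths. *)
Lemma matched_sum N r s : r < N -> \sum_(j < N) matched_term r s j = inv (r + s).
Proof.
have widen r' s' N' : r' < N' -> \sum_(j < N'.+1) matched_term r' s' j = \sum_(j < N') matched_term r' s' j.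
  by move=> rN; rewrite big_ord_recr /= {2}/matched_term bin_small // !mul0n addn0.
have [m] := ubnP (r + s); elim: m r s N => // m IH [|r] s [|N] // rs rN.
  rewrite big_ord_recl big1 => [|j _]; last by rewrite /matched_term bin0n !mul0n.
  by rewrite /matched_term !bin0 fact0 !mul1n !subn0 addn0.
rewrite big_ord_recl matched_termS0 (eq_bigr (fun j : 'I_N => matched_term r s j.+1
   + r * matched_term r.-1 s j.+1 + s * matched_term r s.-1 j)) => [|j _]; last exact: matched_termS.
rewrite !big_split /= -!big_distrr /=.
have -> : matched_term r s 0 + r * matched_term r.-1 s 0 +
    (\sum_(i < N) matched_term r s i.+1 + r * \sum_(i < N) matched_term r.-1 s i.+1
       + s * \sum_(i < N) matched_term r s.-1 i)
  = (matched_term r s 0 + \sum_(i < N) matched_term r s i.+1)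
    + r * (matched_term r.-1 s 0 + \sum_(i < N) matched_term r.-1 s i.+1)
    + s * \sum_(i < N) matched_term r s.-1 i by ring.
have R r' s' : matched_term r' s' 0 + \sum_(i < N) matched_term r' s' i.+1 = \sum_(i < N.+1) matched_term r' s' i.
  by rewrite big_ord_recl.
rewrite !R !IH; try lia.
case: r rs rN => [|r] rs rN; case: s rs => [|s] rs; rewrite ?mul0n ?addn0 //=.
- by rewrite add0n add1n involution_numberS.
- by rewrite involution_numberS.
have -> : r.+2 + s.+1 = (r + s).+3 by lia.
have -> : r.+1 + s.+1 = (r + s).+2 by lia.
have -> : r + s.+1 = (r + s).+1 by lia.
rewrite addSn [RHS]involution_numberS -addnA -mulnDl.
by congr (_ + _ * _); lia.
Qed.

(** Two groups of n points with n - k crossing pairs leave k points in each group for an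
    involution. *)
Lemma involution_number_double n : inv (2 * n) =
  \sum_(0 <= k < n.+1) inv k ^ 2 * 'C(n, k) ^ 2 * (n - k)`!.
Proof.
rewrite mul2n -addnn -(@matched_sum n.+1) // big_mkord (reindex_inj rev_ord_inj) /=.
apply: eq_bigr => j _; have jn : j <= n by rewrite -ltnS.
by rewrite subSS /matched_term bin_sub // subKn // !expnS !expn0; ring.
Qed.

(** * Composition of diagrams *)

(** As long as f moves, g undoes it. A repetition in the orbit of x could be traced back by g to x,
    where g is stationary, so an orbit that never stops would be injective in a finite type. *)
Lemma iter_fixed_point (T : finType) (f g : T -> T) (x : T) :
  (forall y, f y != y -> g (f y) = y) -> g x = x -> exists n, f (iter n f x) = iter n f x.
Proof.
move=> gK gx; apply: boolp.contrapT => H.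
have nf n : f (iter n f x) != iter n f x by apply/eqP => E; apply: H; exists n.
have giter n m : iter n g (iter (n + m) f x) = iter m f x.
  elim: n => [//|n IH]; rewrite iterSr addSn /= gK //; exact: nf.
have inj_iter : injective (fun i : 'I_#|T|.+1 => iter i f x).
  suff W (i j : nat) : i < j -> iter i f x <> iter j f x.
    move=> i j /= E; apply/val_inj; case: (ltngtP i j) => // [/W|/W]; [exact|by rewrite E].
  move=> ij E; have := giter i 0; rewrite addn0 E -(subnKC ij) addSnnS giter /= => yx.
  have := gK _ (nf (j - i.+1)); rewrite yx gx => xy.
  by have := nf (j - i.+1); rewrite yx -{1}xy eqxx.
by have := leq_card _ inj_iter; rewrite card_ord ltnn.
Qed.

Section Composite.
Variables (u v w : word) (d1 : diagram u v) (d2 : diagram v w).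
Local Notation stack := (stack_points u v w).
Local Notation e := (stack_edge d1 d2).

Definition is_up (a : arrow) : bool := if a is Up then true else false.

(* Strands are oriented from the sources (bottom up-arrows, top down-arrows) to the other points. *)
Definition source (v w : word) (p : points v w) : bool :=
  match p with inl i => is_up (letter i) | inr j => ~~ is_up (letter j) end.

Lemma orientableE (v' w' : word) (x y : points v' w') : orientable x y = (source x != source y).
Proof. by case: x y => [i|i] [j|j] /=; case: (letter i); case: (letter j). Qed.

Lemma diagram_source (v' w' : word) (d : diagram v' w') x : source (d x) = ~~ source x.
Proof.
case/and3P: (forallP (partnerP d) x) => _ _; rewrite orientableE.
by case: (source x); case: (source (d x)).
Qed.

(** Orientation turns the undirected picture into a walk. [low] and [upp] cross a strand of the
    lower or upper diagram, and stay put on points outside it; [sgn] tells whether the strand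
    leaving the vertex is a lower one. Thus [next] follows the orientation, [prev] goes back, and
    only outer points can be stationary. *)
Let low (x : stack) : stack := match x with inl p => inl (d1 p) | inr k => inr k end.
Let upp (x : stack) : stack :=
  match x with
  | inl (inl i) => inl (inl i)
  | inl (inr j) => in_upper u (d2 (inl j))
  | inr k => in_upper u (d2 (inr k))
  end.
Let sgn (x : stack) : bool :=
  match x with inl p => source p | inr k => is_up (letter k) end.
Let next x := if sgn x then low x else upp x.
Let prev x := if sgn x then upp x else low x.

Let in_upper_inj : injective (@in_upper u v w).
Proof. by case=> i [] j //= [->]. Qed.

Let sgn_upper (p : points v w) : sgn (in_upper u p) = ~~ source p.
Proof. by case: p => i //=; rewrite negbK. Qed.

Let lowK x : low (low x) = x.
Proof. by case: x => //= p; rewrite diagramK. Qed.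

Let upp_upper p : upp (in_upper u p) = in_upper u (d2 p).
Proof. by case: p. Qed.

Let uppK x : upp (upp x) = x.
Proof. by case: x => [[i|j]|k] //=; rewrite upp_upper diagramK. Qed.

Let low_sgn x : low x != x -> sgn (low x) = ~~ sgn x.
Proof. by case: x => [p|k] /=; rewrite ?eqxx // diagram_source. Qed.

Let upp_sgn x : upp x != x -> sgn (upp x) = ~~ sgn x.
Proof. by case: x => [[i|j]|k] /=; rewrite ?eqxx // sgn_upper diagram_source /= ?negbK. Qed.

Let prev_next x : next x != x -> prev (next x) = x.
Proof.
rewrite /next /prev; case: ifP => sx xN; first by rewrite low_sgn // sx /= lowK.
by rewrite upp_sgn // sx /= uppK.
Qed.

Let next_prev x : prev x != x -> next (prev x) = x.
Proof.
rewrite /next /prev; case: ifP => sx xN; first by rewrite upp_sgn // sx /= uppK.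
by rewrite low_sgn // sx /= lowK.
Qed.

Let edgeP x y : reflect ((y = low x \/ y = upp x) /\ y != x) (e x y).
Proof.
apply: (iffP orP) => [[/existsP[p /andP[/eqP -> /eqP ->]]|/existsP[p /andP[/eqP -> /eqP ->]]]|].
- split; first by left.
  by apply: contraNneq (diagram_neq d1 p) => -[->].
- split; first by right; rewrite upp_upper.
  by apply: contraNneq (diagram_neq d2 p) => /in_upper_inj ->.
case=> -[->|->]; case: x => [[i|j]|k] //= yN; rewrite ?eqxx // in yN *.
- by left; apply/existsP; exists (inl i); rewrite !eqxx.
- by left; apply/existsP; exists (inr j); rewrite !eqxx.
- by right; apply/existsP; exists (inl j); rewrite !eqxx.
- by right; apply/existsP; exists (inr k); rewrite !eqxx.
Qed.

Let edge_next x y : e x y -> (y = next x /\ x = prev y) \/ (y = prev x /\ x = next y).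
Proof.
move/edgeP => [yx yN].
have [yn|yp] : y = next x \/ y = prev x.
  by rewrite /next /prev; case: ifP; case: yx; [left|right|right|left].
- by left; split=> //; rewrite yn prev_next // -yn.
by right; split=> //; rewrite yp next_prev // -yp.
Qed.

Lemma stack_edge_sym : connect_sym e.
Proof.
apply: sym_connect_sym => x y; apply/idP/idP => /edgeP[yx yN]; apply/edgeP; split.
- by case: yx => ->; [left; rewrite lowK|right; rewrite uppK].
- by rewrite eq_sym.
- by case: yx => ->; [left; rewrite lowK|right; rewrite uppK].
by rewrite eq_sym.
Qed.

Let connect_next x : connect e x (next x).
Proof.
have [->|xN] := eqVneq (next x) x; first exact: connect0.
apply/connect1/edgeP; split=> //; rewrite /next; case: ifP; [left|right] => //.
Qed.

Let connect_prev x : connect e x (prev x).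
Proof.
have [->|xN] := eqVneq (prev x) x; first exact: connect0.
apply/connect1/edgeP; split=> //; rewrite /prev; case: ifP; [right|left] => //.
Qed.

Let connect_iter (f : stack -> stack) n x : (forall y, connect e y (f y)) -> connect e x (iter n f x).
Proof. by move=> fP; elim: n => [|n IH] /=; [exact: connect0|exact: connect_trans IH (fP _)]. Qed.

Let reaches (f : stack -> stack) x z := exists n, iter n f x = z /\ f z = z.

Let reaches_step f x z : reaches f x z <-> reaches f (f x) z.
Proof.
split=> -[n [nz fz]]; last by exists n.+1; rewrite iterSr.
by exists n; rewrite -iterSr /= nz.
Qed.

(** The end of the walk is constant on components, since of two adjacent vertices each is the [next]
    or the [prev] of the other. *)
Let reaches_connect f x y z : (f = next \/ f = prev) -> connect e x y -> reaches f x z -> reaches f y z.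
Proof.
move=> fE /connectP[p]; elim: p x => [x _ -> //|x' p IH x /= /andP[/edge_next xx' px'] yE] H.
move: H; suff S : reaches f x z -> reaches f x' z by move=> /S; apply: IH.
case: fE => ->; case: xx' => -[E E'] H.
- by rewrite E; apply: (reaches_step _ _ _).1.
- by apply: (reaches_step _ _ _).2; rewrite -E'.
- by apply: (reaches_step _ _ _).2; rewrite -E'.
- by rewrite E; apply: (reaches_step _ _ _).1.
Qed.

Let reaches_fixed f x z : f x = x -> reaches f x z -> z = x.
Proof. by move=> fx [n [<- _]]; elim: n => //= n ->. Qed.

Let next_outer p : next (in_outer v p) = in_outer v p <-> ~~ source p.
Proof.
case: p => [i|k] /=; rewrite /next /=; case: ifP => // _; split=> // -[E].
  by have := diagram_neq d1 (inl i); rewrite E eqxx.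
by have := in_upper_inj (E : _ = in_upper u (inr k)) => /eqP; rewrite (negPf (diagram_neq d2 _)).
Qed.

Let prev_outer p : prev (in_outer v p) = in_outer v p <-> source p.
Proof.
case: p => [i|k] /=; rewrite /prev /=; case: ifP => // _; split=> // -[E].
  by have := diagram_neq d1 (inl i); rewrite E eqxx.
by have := in_upper_inj (E : _ = in_upper u (inr k)) => /eqP; rewrite (negPf (diagram_neq d2 _)).
Qed.

Let fixed_outer x : next x = x \/ prev x = x -> exists p, x = in_outer v p.
Proof.
case: x => [[i|j]|k]; [by exists (inl i)| |by exists (inr k)].
have l : low (inl (inr j)) != inl (inr j) by apply: contraNneq (diagram_neq d1 (inr j)) => -[->].
have r : upp (inl (inr j)) != inl (inr j).
  by apply: contraNneq (diagram_neq d2 (inl j)) => /(@in_upper_inj _ (inl j)) ->.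
by rewrite /next /prev; case: ifP => _ [] E; rewrite ?E eqxx // in l r.
Qed.

(** A source is stationary for [prev] and any other outer point for [next], so it is the unique end
    of its component in that direction. *)
Lemma connect_outer_source p q : connect e (in_outer v p) (in_outer v q) -> source p = source q -> p = q.
Proof.
move=> pq; case sp: (source p) => sq; apply: esym.
- have fp := (prev_outer p).2 sp; have fq := (prev_outer q).2 (esym sq).
  have /(reaches_fixed fp) : reaches prev (in_outer v p) (in_outer v q).
    apply: (@reaches_connect _ (in_outer v q)); [by right|by rewrite stack_edge_sym|].
    by exists 0.
  by case: (p) (q) => [i|i] [j|j] //= [->].
have fp := (next_outer p).2 (negbT sp); have fq := (next_outer q).2 (negbT (esym sq)).
have /(reaches_fixed fp) : reaches next (in_outer v p) (in_outer v q).
  apply: (@reaches_connect _ (in_outer v q)); [by left|by rewrite stack_edge_sym|].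
  by exists 0.
by case: (p) (q) => [i|i] [j|j] //= [->].
Qed.

(** The strand is followed along its orientation from a source and against it otherwise;
    [iter_fixed_point] makes it stop, necessarily at an outer point of the opposite kind. *)
Lemma connect_outer_ex p : exists q, connect e (in_outer v p) (in_outer v q) && (source q != source p).
Proof.
case sp: (source p).
  have fp := (prev_outer p).2 sp.
  have [n nE] := iter_fixed_point prev_next fp.
  have [q qE] := fixed_outer (or_introl nE).
  exists q; rewrite -qE connect_iter //=; rewrite qE in nE.
  by rewrite (negPf ((next_outer q).1 nE)).
have fp := (next_outer p).2 (negbT sp).
have [n nE] := iter_fixed_point next_prev fp.
have [q qE] := fixed_outer (or_intror nE).
exists q; rewrite -qE connect_iter //=; rewrite qE in nE.
by rewrite ((prev_outer q).1 nE).
Qed.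

(** The default [p] never occurs, by [connect_outer_ex]. *)
Definition comp_partner : {ffun points u w -> points u w} :=
  [ffun p => odflt p [pick q | connect e (in_outer v p) (in_outer v q) && (source q != source p)]].

Let comp_partnerP p : connect e (in_outer v p) (in_outer v (comp_partner p))
   && (source (comp_partner p) != source p).
Proof.
rewrite ffunE; case: pickP => [q //|H].
by have [q] := connect_outer_ex p; rewrite H.
Qed.

Fact comp_is_diagram : is_diagram comp_partner.
Proof.
apply/forallP => p; have /andP[c1 s1] := comp_partnerP p; have /andP[c2 s2] := comp_partnerP (comp_partner p).
apply/and3P; split; first by apply: contraNneq s1 => ->.
  apply/eqP/esym/connect_outer_source; first exact: connect_trans c1 c2.
  by move: s1 s2; case: (source p); case: (source (comp_partner p)); case: (source _).
by rewrite orientableE eq_sym.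
Qed.

Definition dcomp : diagram u w := Diagram comp_is_diagram.

Lemma stacks_toE d : stacks_to d1 d2 d = (dcomp == d).
Proof.
apply/forallP/eqP => [st|<- p]; last by have /andP[] := comp_partnerP p.
apply/val_inj/ffunP => p /=; have /andP[c1 s1] := comp_partnerP p.
apply: connect_outer_source; first by rewrite (connect_trans _ (st p)) // stack_edge_sym.
by rewrite diagram_source; move: s1; case: (source p); case: (source _).
Qed.

Lemma connect_dcomp p q : connect e (in_outer v p) (in_outer v q) = (q == p) || (q == dcomp p).
Proof.
have /andP[c1 s1] := comp_partnerP p.
apply/idP/orP => [c|[/eqP -> //|/eqP -> //]].
have [sq|sq] := eqVneq (source q) (source p).
  by left; apply/eqP/esym/connect_outer_source.
right; apply/eqP/esym/connect_outer_source; first by rewrite (connect_trans _ c) // stack_edge_sym.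
by move: s1 sq => /=; case: (source p); case: (source q); case: (source _).
Qed.

End Composite.

(** * Counting colourings *)

Section Colouring.

(** Over these colourings, [compat d] is the 0/1 matrix of the diagram in the representation where a
    loop has the value 2: the orientation is forgotten, and a strand imposes equal colours at its
    ends. *)
Definition colouring (w : word) := {ffun 'I_(size w) -> bool}.

Definition colour (v w : word) (a : colouring v) (b : colouring w) (p : points v w) : bool :=
  match p with inl i => a i | inr j => b j end.

Definition compat (v w : word) (d : diagram v w) (a : colouring v) (b : colouring w) : bool :=
  [forall p, colour a b (d p) == colour a b p].

Lemma compatP v w (d : diagram v w) a b :
  reflect (forall p, colour a b (d p) = colour a b p) (compat d a b).
Proof. by apply: (iffP forallP) => H p; apply/eqP/H. Qed.

Lemma compat_false v w (d : diagram v w) : compat d [ffun => false] [ffun => false].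
Proof. by apply/compatP => p; case: (d p) => i; case: p => j; rewrite /= !ffunE. Qed.

Lemma compat_inj v w (d d' : diagram v w) : (forall a b, compat d a b -> compat d' a b) -> d = d'.
Proof.
move=> H; apply/val_inj/ffunP => p.
(* The colouring that is true exactly on p and on its partner in d. *)
pose a : colouring v := [ffun i => (inl i == p) || (inl i == d p)].
pose b : colouring w := [ffun i => (inr i == p) || (inr i == d p)].
have cE q : colour a b q = (q == p) || (q == d p) by case: q => i; rewrite /= ffunE.
have : compat d a b.
  apply/compatP => q; rewrite !cE (can_eq (@diagramK _ _ d)).
  by rewrite -[in d q == p](diagramK d p) (can_eq (@diagramK _ _ d)) orbC.
move/H/compatP/(_ p); rewrite !cE eqxx /= (negPf (diagram_neq d' p)) /=.
by move/eqP.
Qed.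

Section Count.
Variables (u v w : word) (d1 : diagram u v) (d2 : diagram v w) (a : colouring u) (c : colouring w).
Local Notation e := (stack_edge d1 d2).

Definition middle_colourings : {set colouring v} := [set b | compat d1 a b && compat d2 b c].

Let ext (b : colouring v) (x : stack_points u v w) : bool :=
  match x with inl p => colour a b p | inr k => c k end.

Let ext_upper b (p : points v w) : ext b (in_upper u p) = colour b c p.
Proof. by case: p. Qed.

Let ext_outer b (p : points u w) : ext b (in_outer v p) = colour a c p.
Proof. by case: p. Qed.

Let ext_edge b : reflect (forall x y, e x y -> ext b x = ext b y) (b \in middle_colourings).
Proof.
rewrite inE; apply: (iffP andP) => [[/compatP c1 /compatP c2] x y|H].
  case/orP => /existsP[p /andP[/eqP -> /eqP ->]] /=; first by rewrite c1.
  by rewrite !ext_upper c2.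
split; apply/compatP => p.
  by apply/esym/(H (inl p) (inl (d1 p)))/orP; left; apply/existsP; exists p; rewrite !eqxx.
rewrite -!ext_upper; apply/esym/H/orP; right; apply/existsP; exists p.
by rewrite !eqxx.
Qed.

Let ext_connect b x y : b \in middle_colourings -> connect e x y -> ext b x = ext b y.
Proof.
move/ext_edge => H /connectP[p]; elim: p x => [x _ ->//|x' p IH x /= /andP[xx' px'] yE].
by rewrite (H _ _ xx'); apply: IH.
Qed.

Let has_outer x := [exists p, connect e x (in_outer v p)].
Let free : {set stack_points u v w} := [set x | roots e x && ~~ has_outer x].

Let has_outer_connect x y : connect e x y -> has_outer x = has_outer y.
Proof.
move=> xy; apply: eq_existsb => p; apply/idP/idP; last exact: connect_trans.
by apply: connect_trans; rewrite stack_edge_sym.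
Qed.

Let rootK x : fingraph.root e (fingraph.root e x) = fingraph.root e x.
Proof. exact/fingraph.root_root/stack_edge_sym. Qed.

Let root_eq x y : connect e x y -> fingraph.root e x = fingraph.root e y.
Proof. by move=> xy; apply/eqP; rewrite fingraph.root_connect //; exact: stack_edge_sym. Qed.

(* A colouring of the middle points is determined by its values on the roots of the closed loops. *)
Lemma card_middle_colourings :
  #|middle_colourings| = (2 ^ loops d1 d2 * compat (dcomp d1 d2) a c)%N.
Proof.
have [/compatP ac|nac] := boolP (compat (dcomp d1 d2) a c); last first.
  rewrite muln0; apply/eqP; rewrite cards_eq0; apply: contraR nac => /set0Pn[b bM].
  apply/compatP => p; rewrite -!(ext_outer b); apply: ext_connect => //.
  by rewrite stack_edge_sym connect_dcomp eqxx orbT.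
rewrite muln1.
have -> : loops d1 d2 = #|free|.
  by rewrite /loops /n_comp_mem cardsE; apply: eq_card => x; rewrite !inE.
rewrite -card_powerset.
(* [f] collects the roots of closed loops that are coloured true. Conversely, [val X] colours a
   component like its outer points if it has some, and otherwise by membership of its root in
   [X]. *)
pose f b := [set x in free | ext b x].
pose val (X : {set stack_points u v w}) (x : stack_points u v w) : bool :=
  if [pick p | connect e x (in_outer v p)] is Some p then colour a c p else fingraph.root e x \in X.
pose g X : colouring v := [ffun j => val X (inl (inr j))].
have val_connect X x y : connect e x y -> val X x = val X y.
  move=> xy; rewrite /val (root_eq xy).
  suff -> : [pick p | connect e x (in_outer v p)] = [pick p | connect e y (in_outer v p)] by [].
  apply: eq_pick => p /=; apply/idP/idP; last exact: connect_trans.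
  by apply: connect_trans; rewrite stack_edge_sym.
have val_outer X p : val X (in_outer v p) = colour a c p.
  rewrite /val; case: pickP => [q|/(_ p)]; last by rewrite connect0.
  by rewrite connect_dcomp => /orP[/eqP ->//|/eqP ->]; apply: ac.
have gE X x : ext (g X) x = val X x.
  by case: x => [[i|j]|k] /=; [have := val_outer X (inl i)|rewrite ffunE|have := val_outer X (inr k)].
have gM X : g X \in middle_colourings.
  by apply/ext_edge => x y xy; rewrite !gE; apply: val_connect; apply: connect1.
have fg X : X \in powerset free -> f (g X) = X.
  rewrite powersetE => /subsetP XF; apply/setP => x; rewrite inE gE.
  have [xF|xF] /= := boolP (x \in free); last by apply/esym/negP => /XF; rewrite (negPf xF).
  move: xF; rewrite inE => /andP[/eqP rx no]; rewrite /val rx.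
  by case: pickP => // p xp; case/existsP: no; exists p.
have finj : {in middle_colourings &, injective f}.
  move=> b b' bM b'M ff; apply/ffunP => j; set x : stack_points u v w := inl (inr j).
  rewrite -[b j]/(ext b x) -[b' j]/(ext b' x).
  have [/existsP[p xp]|no] := boolP (has_outer x).
    by rewrite !(ext_connect _ xp) // !ext_outer.
  have xr := connect_root e x; rewrite !(ext_connect _ xr) //.
  have rF : fingraph.root e x \in free.
    by rewrite inE /roots /= rootK eqxx -(has_outer_connect xr).
  by have /setP/(_ (fingraph.root e x)) := ff; rewrite [LHS]in_set [RHS]in_set rF.
rewrite -(card_in_imset finj); congr #|pred_of_set _|; apply/setP => X.
apply/imsetP/idP => [[b _ ->]|XF]; first by rewrite powersetE; apply/subsetP => x; rewrite inE => /andP[].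
by exists (g X); rewrite ?fg.
Qed.

End Count.

(** The all-false colouring is compatible with every diagram, so its count determines the number of
    loops; the remaining counts then determine the diagram. *)
Lemma composite_unique u v w (d1 : diagram u v) (d2 : diagram v w) (d : diagram u w) k :
  (forall a c, #|middle_colourings d1 d2 a c| = (2 ^ k * compat d a c)%N) ->
  dcomp d1 d2 = d /\ loops d1 d2 = k.
Proof.
move=> H; have kE : loops d1 d2 = k.
  have := H [ffun => false] [ffun => false].
  by rewrite card_middle_colourings !compat_false !muln1 => /eqP; rewrite eqn_exp2l // => /eqP.
split=> //; apply: compat_inj => a b ab; have := H a b.
rewrite card_middle_colourings kE ab => /eqP.
by rewrite eqn_pmul2l ?expn_gt0 //; case: (compat _ _ _).
Qed.

Lemma card_middleE u v w (d1 : diagram u v) (d2 : diagram v w) a c :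
  #|middle_colourings d1 d2 a c| = \sum_b compat d1 a b * compat d2 b c.
Proof.
rewrite -sum1dep_card big_mkcond; apply: eq_bigr => b _.
by case: compat; case: compat.
Qed.

(** Associativity of the product of colouring matrices. The powers of 2 are compared at the
    all-false colouring, which gives the identity of loop numbers. *)
Lemma dcompA u v w x (d1 : diagram u v) (d2 : diagram v w) (d3 : diagram w x) :
  dcomp (dcomp d1 d2) d3 = dcomp d1 (dcomp d2 d3) /\
  (loops d1 d2 + loops (dcomp d1 d2) d3 = loops d2 d3 + loops d1 (dcomp d2 d3))%N.
Proof.
have E a e : (2 ^ (loops d1 d2 + loops (dcomp d1 d2) d3) * compat (dcomp (dcomp d1 d2) d3) a e
    = 2 ^ (loops d2 d3 + loops d1 (dcomp d2 d3)) * compat (dcomp d1 (dcomp d2 d3)) a e)%N.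
  rewrite !expnD -!mulnA -!card_middle_colourings !card_middleE !big_distrr /=.
  transitivity (\sum_c \sum_b compat d1 a b * compat d2 b c * compat d3 c e).
    apply: eq_bigr => c _; rewrite mulnA -card_middle_colourings card_middleE big_distrl /=.
    by apply: eq_bigr.
  rewrite exchange_big; apply: eq_bigr => b _ /=.
  rewrite mulnCA -card_middle_colourings card_middleE big_distrr /=.
  by apply: eq_bigr => c _; rewrite mulnA.
have lE : (loops d1 d2 + loops (dcomp d1 d2) d3 = loops d2 d3 + loops d1 (dcomp d2 d3))%N.
  have := E [ffun => false] [ffun => false].
  by rewrite !compat_false !muln1 => /eqP; rewrite eqn_exp2l // => /eqP.
split=> //; apply: compat_inj => a b ab; move/eqP: (E a b).
by rewrite lE eqn_pmul2l ?expn_gt0 // ab; case: compat.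
Qed.

End Colouring.

(** * Turning diagrams upside down *)

Section Flip.

Definition flip_point (v w : word) (p : points v w) : points w v :=
  match p with inl i => inr i | inr j => inl j end.

Lemma flip_pointK v w : cancel (@flip_point v w) (@flip_point w v).
Proof. by case. Qed.

Definition flip_fun (v w : word) (d : diagram v w) : {ffun points w v -> points w v} :=
  [ffun p => flip_point (d (flip_point p))].

Fact flip_is_diagram v w (d : diagram v w) : is_diagram (flip_fun d).
Proof.
apply/forallP => p; rewrite !ffunE flip_pointK diagramK flip_pointK eqxx /= -{2}[p]flip_pointK.
rewrite (can_eq (@flip_pointK v w)) diagram_neq /= orientableE.
have fs q : source (@flip_point v w q) = ~~ source q by case: q => i /=; rewrite ?negbK.
by rewrite -{1}[p]flip_pointK !fs diagram_source; case: source.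
Qed.

Definition flip v w (d : diagram v w) : diagram w v := Diagram (flip_is_diagram d).

Lemma flipE v w (d : diagram v w) p : flip d p = flip_point (d (flip_point p)).
Proof. by rewrite ffunE. Qed.

Lemma flipK v w : cancel (@flip v w) (@flip w v).
Proof. by move=> d; apply/val_inj/ffunP => p /=; rewrite !flipE !flip_pointK. Qed.

Lemma compat_flip v w (d : diagram v w) a b : compat (flip d) a b = compat d b a.
Proof.
have cE v' w' (a' : colouring v') (b' : colouring w') p :
  colour a' b' (flip_point p) = colour b' a' p by case: p.
apply/compatP/compatP => H p.
  by have := H (flip_point p); rewrite flipE flip_pointK !cE.
by rewrite flipE cE H cE.
Qed.

Lemma flip_dcomp u v w (d1 : diagram u v) (d2 : diagram v w) :
  dcomp (flip d2) (flip d1) = flip (dcomp d1 d2) /\ loops (flip d2) (flip d1) = loops d1 d2.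
Proof.
apply: composite_unique => a c; rewrite compat_flip -card_middle_colourings.
by apply: eq_card => b; rewrite !inE !compat_flip andbC.
Qed.

End Flip.

Import VectorInternalTheory.
Local Open Scope ring_scope.

(* [vector.hom] and [fingroup.idm] shadow the names of Defs. *)
Local Notation hom := Defs.hom.
Local Notation idm := Defs.idm.

(** * Idempotents and the trace of an anti-involution *)

(** Cayley-Hamilton with a split characteristic polynomial; the product is a [foldr] so that factors
    can be peeled off one at a time. *)
Lemma annihilating_roots (K : closedFieldType) n (M : 'M[K]_n) :
  exists rs : seq K, foldr (fun r N => N *m (M - r%:M)) 1%:M rs = 0.
Proof.
case: n M => [|n] M; first by exists [::]; apply/matrixP => i; have := ltn_ord i.
have [rs rsE] := closed_field_poly_normal (char_poly M).
exists rs; have := Cayley_Hamilton M; rewrite rsE linearZ /= => /eqP.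
rewrite scaler_eq0 lead_coef_eq0 (negPf (monic_neq0 (char_poly_monic M))) /= => /eqP <-.
elim: rs {rsE} => [|r rs IH] /=; first by rewrite big_nil !rmorph1.
by rewrite IH big_cons mulrC rmorphM /= rmorphB /= horner_mx_X horner_mx_C.
Qed.

Section Idempotents.
Variables (K : numClosedFieldType) (A : falgType K).
Implicit Types (C : {vspace A}) (s : seq A).

Definition mul_closed C := forall x y, x \in C -> y \in C -> x * y \in C.
(** Von Neumann regularity, the form in which semisimplicity enters the arguments about
    idempotents. *)
Definition regular_in C := forall x, x \in C -> exists2 a, a \in C & x = x * a * x.
Definition orthogonal_seq s := pairwise (fun a b : A => (a * b == 0) && (b * a == 0)) s.
Definition primitive_in C (g : A) :=
  [/\ g \in C, g * g = g, g != 0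
    & forall e, e \in C -> e * e = e -> g * e = e -> e * g = e -> e = 0 \/ e = g].

Lemma amullE (x v : A) : amull x v = x * v.
Proof. exact: lfunE. Qed.

(** The factors x - r are applied successively to g, with final result 0; the last nonzero vector is
    an eigenvector, and it stays in g A. *)
Lemma eigenvector_idem (g x : A) : g != 0 -> g * g = g -> g * x = x -> x * g = x ->
  exists l v, [/\ v != 0, g * v = v & x * v = l *: v].
Proof.
move=> g0 gg gx xg.
pose M := f2mx (amull x).
have ME v : v2r (x * v) = v2r v *m M.
  by rewrite -amullE unlock /= r2vK.
have [rs rs0] := annihilating_roots M.
have H0 v : v2r (foldr (fun r v => x * v - r *: v) v rs) = 0.
  have -> : v2r (foldr (fun r v => x * v - r *: v) v rs)
     = v2r v *m foldr (fun r N => N *m (M - r%:M)) 1%:M rs.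
    elim: rs {rs0} => [|r rs IH] /=; first by rewrite mulmx1.
    by rewrite linearB linearZ /= ME IH mulmxA mulmxBr mul_mx_scalar.
  by rewrite rs0 mulmx0.
have : foldr (fun r v => x * v - r *: v) g rs = 0.
  by apply: (can_inj v2rK); rewrite H0 linear0.
elim: rs {rs0 H0} => [|r rs IH] /=; first by move/eqP; rewrite (negPf g0).
set v := foldr _ _ _ in IH *.
have gv : g * v = v.
  rewrite /v; elim: (rs) => [//|r' rs' IH'] /=.
  by rewrite mulrBr mulrA gx -scalerAr IH'.
have [v0|v0] := eqVneq v 0; first by move=> _; apply: IH.
by move/eqP; rewrite subr_eq0 => /eqP xv; exists r, v.
Qed.

Lemma primitive_idem C g : primitive_in C g -> g * g = g.
Proof. by case. Qed.

Lemma orthogonal_sum_mul s g : orthogonal_seq s -> (forall h, h \in s -> h * h = h) ->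
  g \in s -> g * (\sum_(h <- s) h) = g /\ (\sum_(h <- s) h) * g = g.
Proof.
elim: s => // a s IHs; rewrite /orthogonal_seq /= => /andP[/allP oa os] sP.
rewrite inE big_cons mulrDr mulrDl => /predU1P[->|gs].
  rewrite (sP a (mem_head _ _)).
  rewrite big_distrr big_distrl /= !big1_seq ?addr0 // => i /andP[_ /oa /andP[/eqP ? /eqP ?]] //.
have /andP[/eqP-> /eqP->] := oa g gs.
by rewrite !add0r; apply: IHs => // i ii; apply: sP; rewrite inE ii orbT.
Qed.

(** The measure that drops when an idempotent is split: h A lies in e A, and h' lies in e A but not
    in h A, for h' = h u would give h' = h' h' = h' h u = 0. *)
Lemma dim_amull_lt (e h h' : A) : e * h = h -> e * h' = h' -> h' * h = 0 -> h' * h' = h' ->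
  h' != 0 -> (\dim (limg (amull h)) < \dim (limg (amull e)))%N.
Proof.
move=> eh eh' h'h h'h' h'0; rewrite ltnNge; apply/negP => le.
have s1 : (limg (amull h) <= limg (amull e))%VS.
  apply/subvP => _ /memv_imgP[u _ ->]; rewrite amullE -eh -mulrA.
  by rewrite -[X in X \in _](amullE e) memv_img ?memvf.
rewrite (geq_leqif (dimv_leqif_sup s1)) in le.
have : h' \in limg (amull h).
  by apply: (subvP le); rewrite -eh' -[X in X \in _](amullE e) memv_img ?memvf.
case/memv_imgP => u _; rewrite amullE => h'E.
by case/eqP: h'0; rewrite -h'h' {2}h'E mulrA h'h mul0r.
Qed.

Section Sub.
Variable C : {vspace A}.
Hypotheses (CM : mul_closed C) (CR : regular_in C).

(** Let v be an eigenvector of g x g in g A, with eigenvalue l. Then z = g x g - l g kills v. Write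
    z = z a z: the idempotent e = g a z of C lies under g and satisfies z e = z. If e = g then v = e
    v = 0, so e = 0 and z = 0. *)
Lemma primitive_scalar g x : primitive_in C g -> x \in C -> exists k, g * x * g = k *: g.
Proof.
move=> [gC gg g0 gP] xC; pose y := g * x * g.
have gy : g * y = y by rewrite /y !mulrA gg.
have yg : y * g = y by rewrite /y -!mulrA gg.
have [l [v [v0 gv yv]]] := eigenvector_idem g0 gg gy yg.
exists l; apply/eqP; rewrite -subr_eq0 -/y; set z := y - l *: g.
have zC : z \in C by rewrite rpredB ?rpredZ // CM // CM.
have zv : z * v = 0 by rewrite mulrBl -scalerAl gv yv subrr.
have gz : g * z = z by rewrite mulrBr -scalerAr gg gy.
have zg : z * g = z by rewrite mulrBl -scalerAl gg yg.
have [a aC za] := CR zC.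
pose e := g * a * z.
have ze : z * e = z by rewrite /e !mulrA zg -za.
have ee : e * e = e by rewrite {1}/e -!mulrA ze /e mulrA.
case: (gP e) => //.
- by rewrite /e !CM.
- by rewrite /e !mulrA gg.
- by rewrite /e -mulrA zg.
- by move=> e0; rewrite -ze e0 mulr0.
by move=> eg; case/eqP: v0; rewrite -gv -eg /e -mulrA zv mulr0.
Qed.

Lemma primitive_decomposition e : e \in C -> e * e = e ->
  exists s, [/\ orthogonal_seq s, \sum_(g <- s) g = e & forall g, g \in s -> primitive_in C g].
Proof.
have [n] := ubnP (\dim (limg (amull e))).
elim: n e => // n IH e dn eC ee.
have [->|e0] := eqVneq e 0; first by exists [::]; split => //; rewrite big_nil.
have [prim|] := boolp.pselect (primitive_in C e).
  exists [:: e]; split => //; first by rewrite big_seq1.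
  by move=> g; rewrite inE => /eqP ->.
move=> nprim.
have [f [fC ff ef fe /andP[f0 fe']]] : exists f, [/\ f \in C, f * f = f, e * f = f, f * e = f & (f != 0) && (f != e)].
  apply: boolp.contrapT => H; apply: nprim; split => // f fC ff ef fe.
  apply: boolp.contrapT => /boolp.not_orP [/eqP f0 /eqP f1]; apply: H.
  by exists f; split => //; rewrite f0 f1.
pose f' := e - f.
have f'f' : f' * f' = f' by rewrite /f' mulrBl !mulrBr ee ef fe ff subrr subr0.
have ef' : e * f' = f' by rewrite /f' mulrBr ee ef.
have f'e : f' * e = f' by rewrite /f' mulrBl ee fe.
have f'f : f' * f = 0 by rewrite /f' mulrBl ef ff subrr.
have ff' : f * f' = 0 by rewrite /f' mulrBr fe ff subrr.
have f'0 : f' != 0 by rewrite subr_eq0 eq_sym.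
have f'C : f' \in C by rewrite rpredB.
have [s1 [o1 S1 P1]] := IH f (leq_trans (dim_amull_lt ef ef' f'f f'f' f'0) dn) fC ff.
have [s2 [o2 S2 P2]] := IH f' (leq_trans (dim_amull_lt ef' ef ff' ff f0) dn) f'C f'f'.
exists (s1 ++ s2); split.
- rewrite /orthogonal_seq pairwise_cat; apply/and3P; split => //.
  apply/allrelP => x y xs ys.
  have [xf fx] := orthogonal_sum_mul o1 (fun h i => primitive_idem (P1 h i)) xs.
  have [yf fy] := orthogonal_sum_mul o2 (fun h i => primitive_idem (P2 h i)) ys.
  rewrite S1 in xf fx; rewrite S2 in yf fy.
  have -> : x * y = 0 by rewrite -xf -fy -mulrA (mulrA f) ff' mul0r mulr0.
  have -> : y * x = 0 by rewrite -yf -fx -mulrA (mulrA f') f'f mul0r mulr0.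
  by rewrite eqxx.
- by rewrite big_cat /= S1 S2 /f' addrC subrK.
by move=> g; rewrite mem_cat => /orP[/P1|/P2].
Qed.

End Sub.
Lemma scalar_primitive (g : A) : g != 0 -> g * g = g ->
  (forall x, exists k, g * x * g = k *: g) -> primitive_in fullv g.
Proof.
move=> g0 gg gP; split=> //; first exact: memvf.
move=> e _ ee ge eg; have [k kE] := gP e.
have ek : e = k *: g by rewrite -kE ge eg.
move: ee; rewrite ek -scalerAr -scalerAl gg scalerA => /eqP.
rewrite -subr_eq0 -scalerBl scaler_eq0 (negPf g0) orbF -{3}[k]mul1r -mulrBl mulf_eq0 subr_eq0.
by case/orP => /eqP ->; [right; rewrite scale1r|left; rewrite scale0r].
Qed.

Definition ltrace (f : 'End(A)) : K := \tr (f2mx f).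

Lemma v2r_lfun (f : 'End(A)) x : v2r (f x) = v2r x *m f2mx f.
Proof. by rewrite unlock /= r2vK. Qed.

Lemma row_f2mx (f : 'End(A)) i : row i (f2mx f) = v2r (f (r2v (delta_mx 0 i))).
Proof. by rewrite v2r_lfun r2vK rowE. Qed.

Fact ltrace_is_linear : linear_for *%R ltrace.
Proof.
move=> k f g; rewrite /ltrace -mxtraceZ -mxtraceD; congr mxtrace.
apply/row_matrixP => i; rewrite linearP /= !row_f2mx.
by rewrite add_lfunE scale_lfunE linearP.
Qed.
HB.instance Definition _ := GRing.isSemilinear.Build K 'End(A) K *%R ltrace
  (GRing.semilinear_linear ltrace_is_linear).

Lemma ltraceC (f g : 'End(A)) : ltrace (f \o g)%VF = ltrace (g \o f)%VF.
Proof.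
have comp (h k : 'End(A)) : f2mx (h \o k)%VF = f2mx k *m f2mx h.
  by apply/row_matrixP => i; rewrite row_mul !row_f2mx comp_lfunE v2r_lfun.
by rewrite /ltrace !comp mxtrace_mulC.
Qed.

Lemma ltrace_rank1 (f : 'End(A)) (phi : 'Hom(A, K^o)) (u : A) :
  (forall x, f x = phi x *: u) -> ltrace f = phi u.
Proof.
move=> fE; pose c : 'cV[K]_(dim A) := \col_i (phi (r2v (delta_mx 0 i)) : K).
have -> : ltrace f = \tr (c *m v2r u).
  congr mxtrace; apply/row_matrixP => i.
  by rewrite row_f2mx fE linearZ /= row_mul; apply/rowP=> j; rewrite !mxE big_ord1 !mxE.
have uE : u = \sum_j v2r u 0 j *: r2v (delta_mx 0 j).
  rewrite -{1}[u]v2rK {1}(row_sum_delta (v2r u)) linear_sum.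
  by apply: eq_bigr => j _; rewrite linearZ.
rewrite mxtrace_mulC /mxtrace big_ord1 mxE [in RHS]uE linear_sum.
by apply: eq_bigr => i _; rewrite linearZ /= mxE.
Qed.

(** [phi] is the basis dual to [delta]; f is the sum of the rank-one maps sending x to phi d x *:
    delta (pi d), of trace 1 or 0. *)
Lemma ltrace_permuted_basis (D : finType) (delta : D -> A) (phi : D -> 'Hom(A, K^o))
    (f : 'End(A)) (pi : D -> D) :
  (forall x, x = \sum_d phi d x *: delta d) -> (forall d d', phi d (delta d') = (d == d')%:R) ->
  (forall d, f (delta d) = delta (pi d)) -> ltrace f = #|[set d | pi d == d]|%:R.
Proof.
move=> xE phiE fE.
have comp d : exists u : 'End(A), forall x, u x = phi d x *: delta (pi d).
  have lin : linear (fun x => phi d x *: delta (pi d)).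
    by move=> k x y; rewrite linearP scalerDl scalerA.
  pose F : {linear A -> A} := HB.pack (fun x => phi d x *: delta (pi d))
     (GRing.isLinear.Build _ _ _ _ _ lin).
  by exists (linfun F) => x; rewrite lfunE.
have [u uE] := fin_all_exists comp.
have -> : f = \sum_d u d.
  apply/lfunP => x; rewrite sum_lfunE {1}[x]xE linear_sum; apply: eq_bigr => d _.
  by rewrite linearZ /= fE uE.
rewrite linear_sum -sum1dep_card natr_sum [RHS]big_mkcond; apply: eq_bigr => d _ /=.
rewrite (@ltrace_rank1 _ (phi d) (delta (pi d))) => [|x]; last by rewrite uE.
by rewrite phiE eq_sym; case: eqP.
Qed.

(** For idempotents a and b it projects onto a A b, so its trace is the dimension of a A b. *)
Definition sandwich (a b : A) : 'End(A) := linfun (a \*o (b \o* @idfun A)).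

Lemma sandwichE a b x : sandwich a b x = a * x * b.
Proof. by rewrite lfunE /= mulrA. Qed.

Lemma sandwich_suml s b : sandwich (\sum_(a <- s) a) b = \sum_(a <- s) sandwich a b.
Proof. by apply/lfunP => x; rewrite sum_lfunE sandwichE !mulr_suml; apply: eq_bigr => a _; rewrite sandwichE. Qed.

Lemma sandwich_sumr s a : sandwich a (\sum_(b <- s) b) = \sum_(b <- s) sandwich a b.
Proof. by apply/lfunP => x; rewrite sum_lfunE sandwichE !mulr_sumr; apply: eq_bigr => b _; rewrite sandwichE. Qed.

Lemma coordinate_functional (e : A) : e != 0 -> exists psi : 'Hom(A, K^o), psi e = 1.
Proof.
move=> e0; have [j ej] : exists j, v2r e 0 j != 0.
  apply/existsP; apply: contraR e0; rewrite negb_exists => /forallP H.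
  rewrite -(can_eq v2rK) linear0; apply/eqP/rowP => j; rewrite mxE; apply/eqP.
  by have := H j; rewrite negbK.
have lin : linear (fun x : A => (v2r x 0 j / v2r e 0 j : K^o)).
  by move=> k x y; rewrite linearP !mxE mulrDl -mulrA.
pose f := GRing.isLinear.Build _ _ _ _ _ lin.
pose F : {linear A -> K^o} := HB.pack (fun x : A => (v2r x 0 j / v2r e 0 j : K^o)) f.
by exists (linfun F); rewrite lfunE /= divff.
Qed.

Lemma orthogonal_uniq s : orthogonal_seq s -> (forall h, h \in s -> h * h = h /\ h != 0) -> uniq s.
Proof.
elim: s => // a s IHs; rewrite /orthogonal_seq /= => /andP[/allP oa os] sP.
apply/andP; split; last by apply: IHs => // h hs; apply: sP; rewrite inE hs orbT.
apply/negP => /oa /andP[/eqP aa _]; have [] := sP a (mem_head _ _).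
by rewrite aa => <-; rewrite eqxx.
Qed.

Lemma orthogonal_neq s a b : orthogonal_seq s -> a \in s -> b \in s -> a != b -> a * b = 0.
Proof.
elim: s => // c s IHs; rewrite /orthogonal_seq /= => /andP[/allP oc os].
rewrite !inE => /predU1P[->|as_] /predU1P[->|bs]; rewrite ?eqxx //.
- by have /andP[/eqP] := oc b bs.
- by have /andP[_ /eqP] := oc a as_.
exact: IHs.
Qed.

Section Whole.
Hypothesis AR : regular_in (fullv : {vspace A}).
Let AM : mul_closed (fullv : {vspace A}). Proof. by move=> *; exact: memvf. Qed.

(** A nonzero u in e A f has an inverse: with u = u a' u and a = f a' e, both u a and a u are
    nonzero idempotents under the primitive e and f. *)
Lemma linked_primitives e f x : primitive_in fullv e -> primitive_in fullv f -> e * x * f != 0 ->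
  exists u a, [/\ e * u = u, u * f = u, f * a = a & a * e = a] /\ u * a = e /\ a * u = f.
Proof.
move=> pe pf u0; set u := e * x * f in u0.
have [[_ ee _ eP] [_ ff _ fP]] := (pe, pf).
have eu : e * u = u by rewrite /u !mulrA ee.
have uf : u * f = u by rewrite /u -!mulrA ff.
clearbody u; have [a' _ ua'] := AR (memvf u).
pose a := f * a' * e.
have uau : u * a * u = u by rewrite /a !mulrA uf -!mulrA eu mulrA -ua'.
have fa : f * a = a by rewrite /a !mulrA ff.
have ae : a * e = a by rewrite /a -!mulrA ee.
exists u, a; split=> //; split.
- case: (eP (u * a)) => //; first exact: memvf.
  + by rewrite mulrA uau.
  + by rewrite mulrA eu.
  + by rewrite -mulrA ae.
  by move=> ua0; case/eqP: u0; rewrite -uau ua0 mul0r.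
case: (fP (a * u)) => //; first exact: memvf.
- by rewrite -mulrA (mulrA u) uau.
- by rewrite mulrA fa.
- by rewrite -mulrA uf.
by move=> au0; case/eqP: u0; rewrite -uau -mulrA au0 mulr0.
Qed.

(** e A f is the line spanned by u: e y f = (e y a) u, and e y a lies in e A e = K e. *)
Lemma ltrace_sandwich1 e f x : primitive_in fullv e -> primitive_in fullv f -> e * x * f != 0 ->
  ltrace (sandwich e f) = 1.
Proof.
move=> pe pf xN; have [u [a [[eu uf fa ae] [ua au]]]] := linked_primitives pe pf xN.
have [_ ee e0 _] := pe.
have [psi psie] := coordinate_functional e0.
rewrite (@ltrace_rank1 _ (psi \o sandwich e a)%VF u).
  by rewrite comp_lfunE sandwichE eu ua.
move=> y; rewrite sandwichE comp_lfunE sandwichE.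
have [k kE] := primitive_scalar AM AR pe (memvf (y * a)).
have kE' : e * y * a = k *: e by rewrite -kE -!mulrA ae.
by rewrite kE' linearZ /= psie [k *: 1]mulr1 -au mulrA kE' -scalerAl eu.
Qed.

(** When e and f are linked, left multiplication by e is that by u after that by a, left
    multiplication by f is the reverse, and traces are cyclic. *)
Lemma ltrace_sandwich_sym e f : primitive_in fullv e -> primitive_in fullv f ->
  ltrace (sandwich e f) = ltrace (sandwich f e)
  /\ (ltrace (sandwich e f) != 0 -> ltrace (sandwich e 1) = ltrace (sandwich f 1)).
Proof.
move=> pe pf.
have z a b : (forall x, a * x * b = 0) -> ltrace (sandwich a b) = 0.
  move=> h; have -> : sandwich a b = 0 by apply/lfunP=> x; rewrite sandwichE h lfunE.
  by rewrite linear0.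
have [[x xN]|N] := boolp.pselect (exists x, e * x * f != 0).
  have [u [a [[eu uf fa ae] [ua au]]]] := linked_primitives pe pf xN.
  have aN : f * a * e != 0.
    rewrite fa ae; apply: contraNneq (_ : f != 0); last by case: pf.
    by move=> a0; rewrite -au a0 mul0r.
  rewrite (ltrace_sandwich1 pe pf xN) (ltrace_sandwich1 pf pe aN); split=> // _.
  have -> : sandwich e 1 = (amull u \o amull a)%VF.
    by apply/lfunP => y; rewrite sandwichE comp_lfunE !amullE mulr1 mulrA ua.
  rewrite ltraceC; congr ltrace; apply/lfunP => y.
  by rewrite sandwichE comp_lfunE !amullE mulr1 mulrA au.
have ef0 y : e * y * f = 0 by apply: boolp.contrapT => /eqP yN; apply: N; exists y.
rewrite (z e f) // eqxx; split=> //; rewrite z // => y.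
apply: boolp.contrapT => /eqP yN.
have [u [a [[fu ue ea af] [ua au]]]] := linked_primitives pf pe yN.
have a0 : a = 0 by rewrite -(ef0 a) ea af.
by case: pf => _ _ /eqP[]; rewrite -ua a0 mulr0.
Qed.

Lemma ltrace_sandwich01 e f : primitive_in fullv e -> primitive_in fullv f ->
  0 <= ltrace (sandwich e f).
Proof.
move=> pe pf; have [[x xN]|N] := boolp.pselect (exists x, e * x * f != 0).
  by rewrite (ltrace_sandwich1 pe pf xN).
suff -> : sandwich e f = 0 by rewrite linear0.
apply/lfunP=> x; rewrite sandwichE lfunE; apply: boolp.contrapT => /eqP h.
by apply: N; exists x.
Qed.

(* Krull-Schmidt: both sizes are the sum of ltrace (e_i . f_j) / dim (e_i A), and e_i A, f_j A have
   the same dimension when linked. *)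
Lemma primitive_decomposition_size (s s' : seq A) :
  orthogonal_seq s -> \sum_(e <- s) e = 1 -> (forall e, e \in s -> primitive_in fullv e) ->
  orthogonal_seq s' -> \sum_(e <- s') e = 1 -> (forall e, e \in s' -> primitive_in fullv e) ->
  size s = size s'.
Proof.
move=> os S1 sP os' S1' sP'.
(* The trace splits into nonnegative traces over the members of r, and the one at e itself equals
   1. *)
have D0 r e : orthogonal_seq r -> \sum_(h <- r) h = 1 -> (forall h, h \in r -> primitive_in fullv h) ->
    e \in r -> ltrace (sandwich e 1) != 0.
  move=> orr rS rP er; rewrite gt_eqF // -rS sandwich_sumr linear_sum /=.
  rewrite (perm_big _ (perm_to_rem er)) big_cons /=.
  rewrite ltr_wpDr //; last first.
    have [_ ee e0 _] := rP e er.
    by rewrite (@ltrace_sandwich1 e e e) ?ltr01 ?ee //; exact: rP.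
  rewrite big_seq; apply: sumr_ge0 => h /mem_rem hr.
  by apply: ltrace_sandwich01; apply: rP.
have K1 (r r' : seq A) : orthogonal_seq r -> \sum_(h <- r) h = 1 -> (forall h, h \in r -> primitive_in fullv h) ->
     \sum_(h <- r') h = 1 ->
   (size r)%:R = \sum_(e <- r) \sum_(f <- r') ltrace (sandwich e f) / ltrace (sandwich e 1).
  move=> orr rS rP rS'; rewrite -sum1_size natr_sum; apply: eq_big_seq => e er.
  by rewrite -mulr_suml -linear_sum /= -sandwich_sumr rS' divff // (D0 r).
apply/eqP; rewrite -(eqr_nat K) (K1 _ _ os S1 sP S1') (K1 _ _ os' S1' sP' S1).
rewrite exchange_big; apply/eqP; apply: eq_big_seq => f fs'; apply: eq_big_seq => e es.
have [E1 E2] := ltrace_sandwich_sym (sP e es) (sP' f fs').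
rewrite -E1; have [->|n0] := eqVneq (ltrace (sandwich e f)) 0; first by rewrite !mul0r.
by rewrite E2.
Qed.

Variable star : 'End(A).
Hypothesis starM : forall x y, star (x * y) = star y * star x.

Lemma ltrace_star s :
  orthogonal_seq s -> \sum_(e <- s) e = 1 -> (forall e, e \in s -> primitive_in fullv e /\ star e = e) ->
  ltrace star = (size s)%:R.
Proof.
move=> os S1 sP.
have us : uniq s by apply: orthogonal_uniq => // h /sP[[_ hh h0 _] _].
rewrite -sum1_size natr_sum.
have -> : star = \sum_(a <- s) \sum_(b <- s) (sandwich a b \o star)%VF.
  apply/lfunP => x; rewrite sum_lfunE -[LHS]mul1r -[LHS]mulr1 -sandwichE -[in sandwich 1]S1.
  rewrite sandwich_suml !sum_lfunE; apply: eq_bigr => a _; rewrite -S1.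
  by rewrite sandwich_sumr !sum_lfunE; apply: eq_bigr => b _; rewrite comp_lfunE.
rewrite linear_sum; apply: eq_big_seq => a sa /=.
rewrite linear_sum /= (bigD1_seq a) //= big_seq_cond big1 ?addr0.
  have [pa sta] := sP a sa; have [_ aa a0 _] := pa.
  have [psi psia] := coordinate_functional a0.
  rewrite (@ltrace_rank1 _ (psi \o sandwich a a)%VF a).
    by rewrite comp_lfunE sandwichE !aa.
  move=> x; rewrite !comp_lfunE !sandwichE.
  have -> : a * star x * a = star (a * x * a) by rewrite !starM sta mulrA.
  have [k ->] := primitive_scalar AM AR pa (memvf x).
  by rewrite !linearZ /= sta psia [k *: 1]mulr1.
move=> b /andP[sb ba]; have [[_ aa _ _] sta] := sP a sa; have [[_ bb _ _] stb] := sP b sb.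
have ab0 : a * b = 0 by apply: orthogonal_neq sa sb _; rewrite // eq_sym.
(* An off-diagonal block has trace 0: the projector onto a A b is inserted once more and moved
   around the trace; [star] sends a A b to b A a, which it kills because a b = 0. *)
have -> : (sandwich a b \o star)%VF = (sandwich a b \o (sandwich a b \o star))%VF.
  by apply/lfunP => x; rewrite !comp_lfunE !sandwichE !mulrA aa -!mulrA bb.
rewrite ltraceC; suff -> : ((sandwich a b \o star) \o sandwich a b)%VF = 0 by rewrite linear0.
apply/lfunP => x; rewrite !comp_lfunE !sandwichE !starM sta stb lfunE /=.
by rewrite !mulrA ab0 !mul0r.
Qed.

Hypothesis starK : forall x, star (star x) = x.

Let star1 : star 1 = 1.
Proof. by rewrite -[RHS]starK -[star 1 in RHS]mul1r starM starK mul1r. Qed.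

(** Equivalently, h kills from the left the two-sided ideal generated by [es]. *)
Definition annihilates (es : seq A) (h : A) := forall e y, e \in es -> h * y * e = 0.

(* If the symmetric bilinear form v, v' |-> star v * v' on f A e with values in e A e = K e were
   alternating, it would vanish, contradicting regularity. *)
Lemma good_idempotent_below (f e y : A) : primitive_in fullv e -> star e = e ->
  f * f = f -> star f = f -> f * y * e != 0 ->
  exists v, [/\ f * v = v, v * e = v & exists2 l, l != 0 & star v * v = l *: e].
Proof.
move=> pe ste ff stf; set u := f * y * e => u0; have [_ ee e0 _] := pe.
have fu : f * u = u by rewrite /u !mulrA ff.
have ue : u * e = u by rewrite /u -!mulrA ee.
clearbody u.
apply: boolp.contrapT => H.
have sc v v' : v * e = v -> v' * e = v' -> exists k, star v * v' = k *: e.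
  move=> ve ve'; have [k kE] := primitive_scalar AM AR pe (memvf (star v * v')).
  by exists k; rewrite -kE -{1}ve -{1}ve' starM ste !mulrA.
have sq0 v : f * v = v -> v * e = v -> star v * v = 0.
  move=> fv ve; have [k kE] := sc v v ve ve.
  apply: boolp.contrapT => /eqP N; apply: H; exists v; split=> //; exists k => //.
  by apply: contraNneq N => k0; rewrite kE k0 scale0r.
have form0 v v' : f * v = v -> v * e = v -> f * v' = v' -> v' * e = v' -> star v * v' = 0.
  move=> fv ve fv' ve'; have [k kE] := sc v v' ve ve'.
  have := sq0 (v + v'); rewrite mulrDr mulrDl fv fv' ve ve' => /(_ erefl erefl).
  rewrite linearD /= mulrDl !mulrDr !sq0 // add0r addr0.
  have -> : star v' * v = star v * v'.
    by rewrite -[LHS]starK starM starK kE linearZ /= ste.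
  by move/eqP; rewrite -mulr2n -scaler_nat scaler_eq0 pnatr_eq0 /= => /eqP.
have [a _ ua] := AR (memvf u).
have fv : f * (f * star a * e) = f * star a * e by rewrite !mulrA ff.
have ve : f * star a * e * e = f * star a * e by rewrite -!mulrA ee.
have := form0 _ _ fv ve fu ue; rewrite !starM starK ste stf => eafu.
by case/eqP: u0; rewrite ua -{1}ue -{2}fu -(mulr0 u) -eafu !mulrA.
Qed.

(** The sum j of the family found is the identity of the ideal generated by [es]. It is built
    greedily: while f = 1 - j does not annihilate [es], an idempotent under f, fixed by [star] and
    equivalent to a member of [es], is added, and dim f A drops. *)
Lemma annihilator_decomposition (es : seq A) :
  (forall e, e \in es -> primitive_in fullv e /\ star e = e) ->
  exists s, [/\ orthogonal_seq s, forall e, e \in s -> primitive_in fullv e /\ star e = e,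
    annihilates es (1 - \sum_(e <- s) e)
    & forall h, annihilates es h -> h * (\sum_(e <- s) e) = 0].
Proof.
move=> esP.
suff H : forall (n : nat) s, (\dim (limg (amull (1 - \sum_(e <- s) e)%R)) < n)%N ->
   orthogonal_seq s -> (forall e, e \in s -> primitive_in fullv e /\ star e = e) ->
   (forall h, annihilates es h -> h * (\sum_(e <- s) e) = 0) ->
  exists s, [/\ orthogonal_seq s, forall e, e \in s -> primitive_in fullv e /\ star e = e,
    annihilates es (1 - \sum_(e <- s) e)
    & forall h, annihilates es h -> h * (\sum_(e <- s) e) = 0].
  have [n ln] := ubnP (\dim (limg (amull (1 - \sum_(e <- [::] : seq A) e)))).
  by apply: H ln _ _ _ => // h _; rewrite big_nil mulr0.
elim=> // n IH s dn os sP sA.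
have [an|] := boolp.pselect (annihilates es (1 - \sum_(e <- s) e)); first by exists s.
set j := \sum_(e <- s) e; set f := 1 - j.
have js e : e \in s -> e * j = e /\ j * e = e.
  by apply: orthogonal_sum_mul => // h /sP[[]].
have jj : j * j = j by rewrite mulr_suml; apply: eq_big_seq => e /js[].
have stj : star j = j by rewrite linear_sum; apply: eq_big_seq => e /sP[].
have ff : f * f = f by rewrite mulrBl mul1r mulrBr mulr1 jj subrr subr0.
have stf : star f = f by rewrite linearB /= star1 stj.
move=> nan; have [e [y [ees ye]]] : exists e y, e \in es /\ f * y * e != 0.
  apply: boolp.contrapT => H; apply: nan => e y ees; apply: boolp.contrapT => /eqP N.
  by apply: H; exists e, y.
have [pe ste] := esP e ees.
have [v [fv ve [l l0 vv]]] := good_idempotent_below pe ste ff stf ye.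
have [_ ee e0 _] := pe.
(* From [star v * v = l *: e], g is an idempotent equivalent to e; g x g reduces to e ([star v] x v)
   e, a multiple of e, hence g is primitive. *)
pose g := l^-1 *: (v * star v).
have vf : star v * f = star v by rewrite -{1}stf -starM fv.
have ev : e * star v = star v by rewrite -{1}ste -starM ve.
have gg : g * g = g.
  rewrite /g -scalerAl -scalerAr !mulrA -(mulrA v) vv -scalerAr ve -scalerAl !scalerA.
  by rewrite mulfVK.
have stg : star g = g by rewrite linearZ /= starM starK.
have gv : g * v = v by rewrite /g -scalerAl -mulrA vv -scalerAr ve scalerA mulVf ?scale1r.
have v0 : v != 0.
  apply: contraNneq e0 => v0; move/eqP: vv; rewrite v0 mulr0 eq_sym scaler_eq0.
  by rewrite (negPf l0).
have g0 : g != 0 by apply: contraNneq v0 => g0; rewrite -gv g0 mul0r.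
have pg : primitive_in fullv g.
  apply: scalar_primitive => // x.
  have [k kE] := primitive_scalar AM AR pe (memvf (star v * x * v)).
  have E : v * star v * x * (v * star v) = k *: (v * star v).
    have <- : v * (e * (star v * x * v) * e) * star v = v * star v * x * (v * star v).
      by rewrite !mulrA ve -(mulrA _ e (star v)) ev.
    by rewrite kE -scalerAr ve -scalerAl.
  by exists (k / l); rewrite /g -!scalerAl -!scalerAr E !scalerA mulrC mulrA (mulrC k).
have fg : f * g = g by rewrite /g -scalerAr mulrA fv.
have gf : g * f = g by rewrite /g -scalerAl -mulrA vf.
have jg : j * g = 0 by rewrite -fg mulrA mulrBr mulr1 jj subrr mul0r.
have gj : g * j = 0 by rewrite -gf -mulrA mulrBl mul1r jj subrr mulr0.
apply: (IH (g :: s)).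
- rewrite big_cons opprD addrCA addrC -/j -/f.
  rewrite ltnS in dn; apply: leq_trans dn.
  by apply: (@dim_amull_lt f (f - g) g) => //; rewrite (mulrBr _ f g) ?ff ?fg // gf gg subrr.
- rewrite /orthogonal_seq /= -[pairwise _ _]/(orthogonal_seq s) os andbT; apply/allP => h hs.
  have [hj jh] := js h hs.
  by rewrite -{1}jh mulrA gj mul0r -hj -mulrA jg mulr0 eqxx.
- by move=> h; rewrite inE => /predU1P[->|/sP].
move=> h hA; rewrite big_cons mulrDr sA // addr0.
by rewrite /g -scalerAr mulrA -ve mulrA -[v]mul1r (hA e) // ?mul0r ?scaler0 // mulrA hA ?mul0r ?scaler0.
Qed.

(* The summand f = 1 - sum s killed by es is central, and f A = f B. *)
Lemma good_decomposition_extend (es ps : seq A) (B : A -> Prop) :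
  (forall e, e \in es -> primitive_in fullv e /\ star e = e) ->
  orthogonal_seq ps -> \sum_(p <- ps) p = 1 ->
  (forall p, p \in ps -> [/\ p * p = p, star p = p & forall x, B x -> exists k, p * x * p = k *: p]) ->
  (forall x, exists2 b, B b & forall h, annihilates es h -> h * x = h * b) ->
  exists s, [/\ orthogonal_seq s, \sum_(e <- s) e = 1
    & forall e, e \in s -> primitive_in fullv e /\ star e = e].
Proof.
move=> esP ops ps1 psP BP.
have [s [os sP fA jA]] := annihilator_decomposition esP.
set j := \sum_(e <- s) e in fA jA; set f := 1 - j in fA.
have js e : e \in s -> e * j = e /\ j * e = e.
  by apply: orthogonal_sum_mul => // h /sP[[]].
have jj : j * j = j by rewrite mulr_suml; apply: eq_big_seq => e /js[].
have stj : star j = j by rewrite linear_sum; apply: eq_big_seq => e /sP[].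
have ff : f * f = f by rewrite mulrBl mul1r mulrBr mulr1 jj subrr subr0.
have stf : star f = f by rewrite linearB /= star1 stj.
have jf : j * f = 0 by rewrite mulrBr mulr1 jj subrr.
have fj : f * j = 0 by rewrite mulrBl mul1r jj subrr.
(* f x annihilates [es] because f does. Applying [star] gives j x f = 0 as well, and the two
   together say that f is central. *)
have fxj x : f * x * j = 0 by apply: jA => e y ees; rewrite -(mulrA f) fA.
have jxf x : j * x * f = 0.
  by rewrite -[LHS]starK (starM _ f) (starM j) stf stj mulrA fxj linear0.
have fC x : f * x = x * f.
  have -> : f * x = f * x * f by rewrite [in RHS]/f mulrBr mulr1 fxj subr0.
  by rewrite -[f * x * f]addr0 -(jxf x) -mulrDl -mulrDl subrK mul1r.
(* The products p f that vanish are dropped, since primitive idempotents are nonzero. *)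
pose qs := [seq p <- [seq p * f | p <- ps] | p != 0].
have qsP q : q \in qs -> q * f = q /\ primitive_in fullv q /\ star q = q.
  rewrite mem_filter => /andP[q0 /mapP[p pps qE]].
  have [pp stp pB] := psP p pps.
  have qf : q * f = q by rewrite qE -mulrA ff.
  have qq : q * q = q by rewrite qE -mulrA (mulrA f) fC -(mulrA p) ff mulrA pp.
  split=> //; split; last by rewrite qE starM stf stp fC.
  apply: scalar_primitive => // x.
  have [b bB xb] := BP x; have [k kE] := pB b bB.
  exists k; rewrite qE; have -> : p * f * x * (p * f) = p * b * p * f.
    rewrite -!mulrA (mulrA f x) (xb f fA) (fC b) -!mulrA (mulrA f p) (fC p) -(mulrA p f f).
    by rewrite ff.
  by rewrite kE scalerAl.
exists (s ++ qs); split.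
- rewrite /orthogonal_seq pairwise_cat; apply/and3P; split => //.
    apply/allrelP => x q xs qqs; have [qf [_ stq]] := qsP q qqs; have [xj jx] := js x xs.
    by rewrite -qf -fC -xj -mulrA (mulrA j) jf mul0r mulr0 -jx fC -!mulrA (mulrA f) fj mul0r mulr0 eqxx.
  apply: pairwise_filter.
  rewrite pairwise_map; apply: sub_pairwise ops => p q /= /andP[/eqP pq /eqP qp].
  by rewrite !mulrA -(mulrA p) fC mulrA pq mul0r -(mulrA q) fC mulrA qp !mul0r eqxx.
- rewrite big_cat /= -/j big_filter big_mkcond /= big_map.
  rewrite (eq_bigr (fun p => p * f)) => [|p _]; last by case: eqP => // ->.
  by rewrite -mulr_suml ps1 mul1r /f addrC subrK.
by move=> e; rewrite mem_cat => /orP[/sP|/qsP[_]].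
Qed.

End Whole.
End Idempotents.

(** * Symmetric group algebras *)

Section GroupAlgebra.
Variables (K : fieldType) (gT : finGroupType).

Definition galg : Type := {ffun gT -> K^o}.
HB.instance Definition _ := Vector.on galg.

Definition gdelta (x : gT) : galg := [ffun y => (y == x)%:R].
Definition galg_mul (f g : galg) : galg := [ffun x => \sum_y (f y : K) * (g (y^-1 * x)%g : K)].

Lemma gdelta_sum (f : galg) : f = \sum_x f x *: gdelta x.
Proof.
apply/ffunP => y; rewrite sum_ffunE (bigD1 y) //= big1 => [|z zy].
  by rewrite !ffunE eqxx [_ *: _]mulr1 addr0.
by rewrite !ffunE eq_sym (negPf zy) [_ *: _]mulr0.
Qed.

Fact galg_mulA : associative galg_mul.
Proof.
move=> f g h; apply/ffunP => x; rewrite !ffunE.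
under eq_bigr do rewrite ffunE mulr_sumr.
under [RHS]eq_bigr do rewrite ffunE mulr_suml.
rewrite [RHS]exchange_big /=; apply: eq_bigr => y _.
rewrite [RHS](reindex_inj (mulgI y)) /=; apply: eq_bigr => z _.
by rewrite mulKg mulrA invMg !mulgA.
Qed.

Fact gdelta_mul x y : galg_mul (gdelta x) (gdelta y) = gdelta (x * y)%g.
Proof.
apply/ffunP => z; rewrite !ffunE (bigD1 x) //= big1 => [|w wx].
  by rewrite !ffunE eqxx mul1r addr0 -(inj_eq (mulgI x)) mulKVg.
by rewrite !ffunE (negPf wx) mul0r.
Qed.

Fact galg_mulDl : left_distributive galg_mul +%R.
Proof.
move=> f g h; apply/ffunP => x; rewrite !ffunE -big_split.
by apply: eq_bigr => y _; rewrite ffunE mulrDl.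
Qed.

Fact galg_mulDr : right_distributive galg_mul +%R.
Proof.
move=> f g h; apply/ffunP => x; rewrite !ffunE -big_split.
by apply: eq_bigr => y _; rewrite ffunE mulrDr.
Qed.

Fact galg_scalerAl (k : K) f g : k *: (galg_mul f g) = galg_mul (k *: f) g.
Proof.
apply/ffunP => x; rewrite !ffunE [LHS]mulr_sumr.
by apply: eq_bigr => y _; rewrite ffunE mulrA.
Qed.

Fact galg_scalerAr (k : K) f g : k *: (galg_mul f g) = galg_mul f (k *: g).
Proof.
apply/ffunP => x; rewrite !ffunE [LHS]mulr_sumr.
by apply: eq_bigr => y _; rewrite ffunE mulrCA.
Qed.

Fact galg_mul1r : left_id (gdelta 1%g) galg_mul.
Proof.
move=> f; apply/ffunP => x; rewrite ffunE (bigD1 1%g) //= big1 => [|w wx].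
  by rewrite ffunE eqxx mul1r addr0 invg1 mul1g.
by rewrite ffunE (negPf wx) mul0r.
Qed.

Fact galg_mulr1 : right_id (gdelta 1%g) galg_mul.
Proof.
move=> f; apply/ffunP => x; rewrite ffunE (bigD1 x) //= big1 => [|w wx].
  by rewrite ffunE mulVg eqxx mulr1 addr0.
by rewrite ffunE -eq_mulVg1 (negPf wx) mulr0.
Qed.

Fact gdelta1_neq0 : gdelta 1%g != 0.
Proof. by apply/eqP => /ffunP/(_ 1%g); rewrite !ffunE eqxx => /eqP; rewrite oner_eq0. Qed.

HB.instance Definition _ := GRing.Zmodule_isNzRing.Build galg
  galg_mulA galg_mul1r galg_mulr1 galg_mulDl galg_mulDr gdelta1_neq0.
HB.instance Definition _ := GRing.Lmodule_isLalgebra.Build K galg galg_scalerAl.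
HB.instance Definition _ := GRing.Lalgebra_isAlgebra.Build K galg galg_scalerAr.
HB.instance Definition _ := Algebra_isFalgebra.Build K galg.

Lemma gdelta1 : gdelta 1%g = 1. Proof. by []. Qed.

Lemma gdeltaM x y : gdelta x * gdelta y = gdelta (x * y)%g.
Proof. exact: gdelta_mul. Qed.

Lemma galg_mulE (f g : galg) x : (f * g) x = \sum_y (f y : K) * (g (y^-1 * x)%g : K).
Proof. by rewrite [LHS]ffunE. Qed.

Definition ginv (f : galg) : galg := [ffun x => f x^-1%g].
Lemma gdelta_mulE a f x : (gdelta a * f) x = f (a^-1 * x)%g.
Proof.
rewrite galg_mulE (bigD1 a) //= big1 ?addr0 => [|y yg]; first by rewrite ffunE eqxx mul1r.
by rewrite ffunE (negPf yg) mul0r.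
Qed.

Lemma gmul_delta a f x : (f * gdelta a) x = f (x * a^-1)%g.
Proof.
rewrite galg_mulE (bigD1 (x * a^-1)%g) //= big1 ?addr0 => [|y yg].
  by rewrite ffunE invMg invgK -mulgA mulVg mulg1 eqxx mulr1.
rewrite ffunE -(inj_eq (mulgI y)) mulKVg -(inj_eq (mulIg a^-1%g)) mulgK eq_sym.
by rewrite (negPf yg) mulr0.
Qed.

Fact gstar_is_linear : linear ginv.
Proof. by move=> k f g; apply/ffunP => x; rewrite !ffunE. Qed.
HB.instance Definition _ := GRing.isSemilinear.Build K galg galg *:%R ginv
  (GRing.semilinear_linear gstar_is_linear).
Definition gstar : 'End(galg) := linfun ginv.

Lemma gstarE f x : gstar f x = f x^-1%g.
Proof. by rewrite lfunE /= ffunE. Qed.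

Lemma gstarM f g : gstar (f * g) = gstar g * gstar f.
Proof.
apply/ffunP => x; rewrite gstarE !galg_mulE [RHS](reindex_inj (mulgI x)) /=.
by apply: eq_bigr => y _; rewrite !gstarE mulrC !invMg !invgK mulKg.
Qed.

Lemma gstar_delta x : gstar (gdelta x) = gdelta x^-1%g.
Proof. by apply/ffunP => y; rewrite gstarE !ffunE eq_invg_sym eq_sym. Qed.

End GroupAlgebra.

Arguments gdelta {K gT} x.
Arguments gstar {K gT}.

(** * Primitive idempotents along a chain of subgroups *)

Section GelfandTsetlin.
Variables (K : numClosedFieldType) (gT : finGroupType).
Local Notation galg := (galg K gT).
Implicit Types (H : {group gT}) (f e : galg).

(** The group algebra of a subgroup is kept as a subspace, so that a whole chain of subgroups lives
    in one algebra. *)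
Definition gspan H : {vspace galg} := <<[seq gdelta h | h <- enum H]>>%VS.

Lemma gspanP H f : reflect (forall x, x \notin H -> f x = 0) (f \in gspan H).
Proof.
apply: (iffP idP) => [/coord_span -> x xH | fH].
  rewrite sum_ffunE big1 // => i _; rewrite !ffunE.
  have /mapP[h hH ->] : ([seq gdelta h | h <- enum H] : seq galg)`_i \in ([seq gdelta h | h <- enum H] : seq galg).
    by apply: mem_nth; rewrite size_map -cardE.
  rewrite ffunE; case: eqP => [xh|_]; last exact: mulr0.
  by rewrite mem_enum -xh (negPf xH) in hH.
rewrite [f]gdelta_sum; apply: rpred_sum => x _.
have [xH|/fH ->] := boolP (x \in H); last by rewrite scale0r mem0v.
by apply/rpredZ/memv_span/map_f; rewrite mem_enum.
Qed.

Lemma gspan_delta H h : h \in H -> gdelta h \in gspan H.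
Proof. by move=> hH; apply/memv_span/map_f; rewrite mem_enum. Qed.

Lemma gspanE H f : f \in gspan H -> f = \sum_(h in H) f h *: gdelta h.
Proof.
move/gspanP => fH; rewrite {1}[f]gdelta_sum [LHS](bigID (mem H)) /= [X in _ + X]big1 ?addr0 //.
by move=> x /fH ->; rewrite scale0r.
Qed.

Lemma gspanM H : mul_closed (gspan H).
Proof.
move=> f g fH gH; rewrite (gspanE fH) mulr_suml; apply: rpred_sum => x xH.
rewrite (gspanE gH) mulr_sumr; apply: rpred_sum => y yH.
by rewrite -scalerAl -scalerAr gdeltaM !rpredZ // gspan_delta // groupM.
Qed.

Lemma gspan1 H : 1 \in gspan H.
Proof. by rewrite -gdelta1 gspan_delta. Qed.

Lemma gspanT : gspan [set: gT] = fullv.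
Proof. by apply/vspaceP => f; rewrite memvf; apply/gspanP => x; rewrite inE. Qed.

Lemma gspan_sub H H' : H \subset H' -> (gspan H <= gspan H')%VS.
Proof.
move=> sHH; apply/subvP => f /gspanP fH; apply/gspanP => x xH; apply: fH.
by apply: contra xH; apply: (subsetP sHH).
Qed.

(* Maschke: average a projection onto the left ideal generated by f. *)
Lemma gspan_regular H : regular_in (gspan H).
Proof.
move=> f fH; pose I := (amulr f @: gspan H)%VS.
have Iact c v : c \in gspan H -> v \in I -> c * v \in I.
  move=> cH /memv_imgP[a aH ->]; rewrite lfunE /= mulrA.
  by rewrite -[X in X \in _](lfunE (f \o* idfun)) memv_img ?gspanM.
pose P : 'End(galg) := #|H|%:R^-1 *: \sum_(h in H) (amull (gdelta h) \o (projv I \o amull (gdelta h^-1%g)))%VF.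
have PE v : P v = #|H|%:R^-1 *: \sum_(h in H) gdelta h * projv I (gdelta h^-1%g * v).
  rewrite scale_lfunE sum_lfunE; congr (_ *: _); apply: eq_bigr => h _.
  by rewrite !comp_lfunE !amullE.
have nH : #|H|%:R != 0 :> K by rewrite pnatr_eq0 -lt0n cardG_gt0.
have PI v : P v \in I.
  rewrite PE rpredZ //; apply: rpred_sum => h hH; apply: Iact; first exact: gspan_delta.
  exact: memv_proj.
have Pid v : v \in I -> P v = v.
  move=> vI; rewrite PE (eq_bigr (fun _ => v)) => [|h hH].
    by rewrite sumr_const -scaler_nat scalerA mulVf ?scale1r.
  rewrite projv_id ?Iact ?gspan_delta ?groupV //.
  by rewrite mulrA gdeltaM mulgV mul1r.
have PG g v : g \in H -> P (gdelta g * v) = gdelta g * P v.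
  move=> gH; rewrite !PE -scalerAr mulr_sumr (reindex_inj (mulgI g)) /=; congr (_ *: _).
  apply: eq_big => h; first by rewrite groupMl.
  by move=> _; rewrite (mulrA (gdelta (g * h)^-1%g)) gdeltaM invMg -mulgA mulVg mulg1 -gdeltaM -mulrA.
have PC c : c \in gspan H -> P c = c * P 1.
  move=> cH; rewrite {1}(gspanE cH) linear_sum {2}(gspanE cH) mulr_suml; apply: eq_bigr => g gH.
  by rewrite linearZ /= -{1}[gdelta g]mulr1 PG // scalerAl.
have fI : f \in I by rewrite -[f]mul1r -[X in X \in _](lfunE (f \o* idfun)) memv_img ?gspan1.
have /memv_imgP[a aH aE] := PI 1.
by exists a => //; rewrite -mulrA -{1}(Pid f fI) PC // aE lfunE.
Qed.

(** With e h e = l(h) e, the sum is c x for c the sum of l(h) l(h^-1). The coefficient of e at h is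
    l(h^-1) e(1), so expanding e = e e e yields e = e(1) c e, and c = 0 would force e = 0. *)
Lemma primitive_conj_sum H e : primitive_in (gspan H) e ->
  exists2 c : K, c != 0 & forall x : galg, e * x * e = x ->
    e * (\sum_(h in H) gdelta h * x * gdelta h^-1%g) * e = c *: x.
Proof.
move=> pe; have [eH ee e0 _] := pe.
have [l lE] : exists l : gT -> K, forall h, h \in H -> e * gdelta h * e = l h *: e.
  have : forall h, exists k : K, h \in H -> e * gdelta h * e = k *: e.
    move=> h; have [hH|_] := boolP (h \in H); last by exists 0.
    by have [k kE] := primitive_scalar (@gspanM H) (@gspan_regular H) pe (gspan_delta hH); exists k.
  by move/boolp.choice => [l lE]; exists l.
(* The coefficient at 1 is a trace form on the group algebra. *)
have tauC (f g : galg) : (f * g) 1%g = (g * f) 1%g.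
  rewrite !galg_mulE (reindex_inj invg_inj) /=; apply: eq_bigr => y _.
  by rewrite invgK !mulg1 mulrC.
have eE h : h \in H -> e h = l h^-1%g * e 1%g :> K.
  move=> hH; have : (e * gdelta h^-1%g * e) 1%g = l h^-1%g * e 1%g :> K.
    by rewrite lE ?groupV // ffunE.
  move=> <-; rewrite tauC mulrA ee galg_mulE (bigD1 h) //= big1 ?addr0 => [|y yh].
    by rewrite ffunE mulg1 eqxx mulr1.
  by rewrite ffunE mulg1 (inj_eq invg_inj) (negPf yh) mulr0.
exists (\sum_(h in H) l h * l h^-1%g).
  apply: contra_neq e0 => c0.
  have -> : e = \sum_(h in H) e h *: (e * gdelta h * e).
    transitivity (e * e * e); first by rewrite !ee.
    rewrite {2}(gspanE eH) mulr_sumr mulr_suml.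
    by apply: eq_bigr => h _; rewrite -scalerAr -scalerAl.
  rewrite (eq_bigr (fun h => (e 1%g * (l h * l h^-1%g)) *: e)) => [|h hH].
    by rewrite -scaler_suml -mulr_sumr c0 mulr0 scale0r.
  by rewrite lE // scalerA eE // mulrAC mulrC [l _ * _]mulrC.
move=> x ex; rewrite mulr_sumr mulr_suml scaler_suml; apply: eq_bigr => h hH.
rewrite -{1}ex.
have -> : e * (gdelta h * (e * x * e) * gdelta h^-1%g) * e
   = (e * gdelta h * e) * x * (e * gdelta h^-1%g * e) by rewrite !mulrA.
rewrite !lE ?groupV // -scalerAl -scalerAr -scalerAl scalerA; congr (_ *: _).
  by rewrite mulrC.
exact: ex.
Qed.

(* e K[H'] e consists of elements fixed by the star: each e x e is up to a nonzero scalar e z, with z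
   the average of e x e, which commutes with K[H] and is fixed by the star by hypothesis. *)
Lemma corner_star_fixed (H H' : {group gT}) e f : H \subset H' ->
  (forall g, g \in H' -> exists2 h, h \in H & (g ^ h)%g = g^-1%g) ->
  primitive_in (gspan H) e -> gstar e = e -> f \in gspan H' -> e * f * e = f -> gstar f = f.
Proof.
move=> sHH conjH pe ste fH' ef; have [eH ee _ _] := pe.
have [c c0 cE] := primitive_conj_sum pe.
pose z := \sum_(h in H) gdelta h * f * gdelta h^-1%g.
have zJ g : g \in H -> gdelta g * z * gdelta g^-1%g = z.
  move=> gH; rewrite mulr_sumr mulr_suml [RHS](reindex_inj (mulgI g)) /=.
  apply: eq_big => h; first by rewrite groupMl.
  by move=> _; rewrite !mulrA gdeltaM -!mulrA gdeltaM invMg.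
have zC a : a \in gspan H -> a * z = z * a.
  move=> aH; rewrite (gspanE aH) mulr_suml mulr_sumr; apply: eq_bigr => g gH.
  rewrite -scalerAl -scalerAr; congr (_ *: _).
  by rewrite -[in RHS](zJ g gH) -!mulrA gdeltaM mulVg mulr1.
have zH' : z \in gspan H'.
  apply: rpred_sum => h hH; have hH' := subsetP sHH _ hH.
  by rewrite !gspanM // gspan_delta ?groupV.
have stz : gstar z = z.
  apply/ffunP => g; rewrite gstarE; have [gH|gH] := boolP (g \in H'); last first.
    by rewrite !(gspanP _ _ zH') // groupV.
  have [h hH gh] := conjH g gH.
  rewrite -gh -[in LHS](zJ h^-1%g) ?groupV // invgK.
  by rewrite gmul_delta gdelta_mulE invgK conjgE !mulgA mulgV mul1g mulgK.
have ze : e * z * e = e * z by rewrite -mulrA -zC // mulrA ee.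
have fE : f = c^-1 *: (e * z) by rewrite -ze cE // scalerA mulVf ?scale1r.
by rewrite {1}fE linearZ /= gstarM stz ste -zC // -fE.
Qed.

(** Each e is refined by any decomposition into primitive idempotents of K[H']; the parts lie in e
    K[H'] e, hence are fixed by [gstar]. The last conclusion, that every part lies under a member of
    s, gives orthogonality of the parts of different members. *)
Lemma gelfand_tsetlin_step (H H' : {group gT}) (s : seq galg) : H \subset H' ->
  (forall g, g \in H' -> exists2 h, h \in H & (g ^ h)%g = g^-1%g) ->
  orthogonal_seq s -> (forall e, e \in s -> primitive_in (gspan H) e /\ gstar e = e) ->
  exists s', [/\ orthogonal_seq s', \sum_(e <- s') e = \sum_(e <- s) e,
     forall e, e \in s' -> primitive_in (gspan H') e /\ gstar e = e
     & forall e', e' \in s' -> exists2 e, e \in s & e' * e = e' /\ e * e' = e'].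
Proof.
move=> sHH conjH; elim: s => [|e s IH]; first by exists [::]; split.
rewrite {1}/orthogonal_seq /= -/(orthogonal_seq s) => /andP[/allP eo os] sP.
have [||s1 [o1 S1 P1 Q1]] := IH; first exact: os.
  by move=> h hs; apply: sP; rewrite inE hs orbT.
have [pe ste] := sP e (mem_head _ _); have [eH ee e0 _] := pe.
have eH' : e \in gspan H' by apply: subvP eH; apply: gspan_sub.
have [s2 [o2 S2 P2]] := primitive_decomposition eH' ee.
have Q2 h : h \in s2 -> h * e = h /\ e * h = h.
  by move=> hs; rewrite -S2; apply: orthogonal_sum_mul => // i /P2; apply: primitive_idem.
exists (s2 ++ s1); split.
- rewrite /orthogonal_seq pairwise_cat; apply/and3P; split => //.
  apply/allrelP => x y /Q2[xe ex] /Q1[y' y's [yy y'y]].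
  have /andP[/eqP ey' /eqP y'e] := eo y' y's.
  have -> : x * y = 0 by rewrite -xe -y'y -mulrA (mulrA e) ey' mul0r mulr0.
  have -> : y * x = 0 by rewrite -yy -ex -mulrA (mulrA y') y'e mul0r mulr0.
  by rewrite eqxx.
- by rewrite big_cat /= S2 S1 big_cons.
- move=> h; rewrite mem_cat => /orP[hs2|/P1//]; split; first exact: P2.
  have [he eh] := Q2 h hs2; have [hH' _ _ _] := P2 h hs2.
  by apply: (corner_star_fixed sHH conjH pe ste hH'); rewrite eh he.
move=> h; rewrite mem_cat => /orP[/Q2 Q|/Q1[h' h's Q]]; first by exists e; rewrite ?mem_head.
by exists h' => //; rewrite inE h's orbT.
Qed.

Lemma gelfand_tsetlin (G : nat -> {group gT}) n : G 0 = 1%G -> (forall i, G i \subset G i.+1) ->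
  (forall i g, g \in G i.+1 -> exists2 h, h \in G i & (g ^ h)%g = g^-1%g) ->
  exists s : seq galg, [/\ orthogonal_seq s, \sum_(e <- s) e = 1
     & forall e, e \in s -> primitive_in (gspan (G n)) e /\ gstar e = e].
Proof.
move=> G0 Gsub GJ; elim: n => [|n [s [os S1 sP]]]; last first.
  have [s' [os' S' P' _]] := gelfand_tsetlin_step (Gsub n) (GJ n) os sP.
  by exists s'; rewrite S'.
exists [:: 1]; split=> //; first by rewrite big_seq1.
move=> e; rewrite inE => /eqP ->; rewrite -{2 3}gdelta1 gstar_delta invg1; split=> //.
split; rewrite ?mulr1 ?oner_eq0 //; first exact: gspan1.
move=> f; rewrite G0 => fH ff _ _.
have fE : f = f 1%g *: 1 by rewrite {1}(gspanE fH) big_set1.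
move: ff; rewrite fE -scalerAl mul1r scalerA => /eqP.
rewrite -subr_eq0 -scalerBl scaler_eq0 oner_eq0 orbF -{3}[f 1%g]mul1r -mulrBl mulf_eq0 subr_eq0.
by case/orP => /eqP ->; [right; rewrite scale1r|left; rewrite scale0r].
Qed.

End GelfandTsetlin.

(* Reverse every cycle, fixing the point of P on it if there is one. *)
Lemma perm_conj_inv (T : finType) (s : {perm T}) (P : pred T) :
  (forall x y, P x -> P y -> x = y) ->
  exists h : {perm T}, [/\ (s ^ h = s^-1)%g, forall x, P x -> h x = x & forall x, h x \in porbit s x].
Proof.
(* [b x] is a base point that depends only on the orbit of x: its point in P if there is one,
   otherwise an arbitrary one. *)
move=> Puniq; pose b x := if [pick y in porbit s x | P y] is Some y then y else odflt x [pick y in porbit s x].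
have bP x : b x \in porbit s x.
  rewrite /b; case: pickP => [y /andP[]//|_] /=; case: pickP => [y //|/(_ x)] /=.
  by rewrite porbit_id.
have bE x y : y \in porbit s x -> b y = b x.
  rewrite -eq_porbit_mem => /eqP xy; rewrite /b xy.
  case: pickP => //= _; case: pickP => //= /(_ x).
  by rewrite porbit_id.
have bfix x : P x -> b x = x.
  rewrite /b; case: pickP => [y /andP[_ Py] Px|/(_ x)]; first exact: Puniq.
  by rewrite porbit_id => /= ->.
have /fin_all_exists[k kE] : forall x, exists k, x = (s ^+ k)%g (b x).
  by move=> x; apply/porbitP; rewrite porbit_sym.
pose h x := (s ^- k x)%g (b x).
(* The exponent [k] is only determined modulo the length of the orbit; h inverts every exponent, not
   only the chosen one. *)
have hE x m : h ((s ^+ m)%g (b x)) = (s ^- m)%g (b x).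
  have bb : b ((s ^+ m)%g (b x)) = b x.
    apply: bE; have <- : porbit s (b x) = porbit s x by apply/eqP; rewrite eq_porbit_mem bP.
    exact: mem_porbit.
  rewrite /h bb; set j := k _.
  have := kE ((s ^+ m)%g (b x)); rewrite bb -/j => mj.
  have cmm : (s ^- m * s ^- j = s ^- j * s ^- m)%g.
    by apply: commuteV; apply/commute_sym/commuteV/commuteX2.
  have -> : (s ^- m)%g (b x) = (s ^- j * s ^- m)%g ((s ^+ j)%g (b x)).
    by rewrite -permM mulgA mulgV mul1g.
  by rewrite -mj -permM -cmm mulgA mulgV mul1g.
have hh x : h (h x) = x.
  have /cycleP[j jE] : (s ^- k x)%g \in <[s]>%g by rewrite groupV mem_cycle.
  by rewrite {2}/h jE hE -jE invgK -kE.
have h_inj : injective h by apply: can_inj hh.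
have hs x : h (s x) = s^-1%g (h x).
  have -> : s x = (s ^+ (k x).+1)%g (b x) by rewrite expgSr permM -kE.
  by rewrite hE expgS invMg permM.
exists (perm h_inj); split.
- apply/permP => x; rewrite conjgE !permM permE hs; congr (_ _).
  by rewrite -[LHS](permE h_inj) permKV.
- move=> x Px; rewrite permE; have := hE x 0; rewrite expg0 invg1 !perm1.
  by rewrite bfix.
move=> x; rewrite permE porbit_sym.
have <- : porbit s (b x) = porbit s (h x).
  have /cycleP[j jE] : (s ^- k x)%g \in <[s]>%g by rewrite groupV mem_cycle.
  by apply/eqP; rewrite eq_porbit_mem porbit_sym /h jE mem_porbit.
by rewrite porbit_sym.
Qed.

Section LetterPerm.
Variables (n : nat) (X : eqType) (l : 'I_n -> X).

(** The labels [l] let one chain serve two groups: constant labels give the symmetric group, the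
    arrows of a word give the permutations preserving its letters. *)
Definition letter_perm k : {set {perm 'I_n}} :=
  [set s : {perm 'I_n} | [forall i, l (s i) == l i] && [forall i : 'I_n, (k <= i)%N ==> (s i == i)]].

Lemma letter_permP k (s : {perm 'I_n}) :
  reflect ((forall i, l (s i) = l i) /\ (forall i : 'I_n, (k <= i)%N -> s i = i)) (s \in letter_perm k).
Proof.
rewrite inE; apply: (iffP andP) => -[H1 H2]; split.
- by move=> i; apply/eqP/(forallP H1).
- by move=> i ki; apply/eqP; move: (forallP H2 i); rewrite ki.
- by apply/forallP => i; rewrite H1.
by apply/forallP => i; apply/implyP => /H2 ->.
Qed.

Fact letter_perm_group k : group_set (letter_perm k).
Proof.
apply/group_setP; split.
  by apply/letter_permP; split=> i; rewrite perm1.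
move=> s t /letter_permP[s1 s2] /letter_permP[t1 t2]; apply/letter_permP.
by split=> i => [|ki]; rewrite permM ?t1 ?s1 // s2 ?t2.
Qed.
Canonical letter_perm_Group k := Group (letter_perm_group k).

Lemma letter_perm_good (K : numClosedFieldType) :
  exists s : seq (galg K {perm 'I_n}), [/\ orthogonal_seq s, \sum_(e <- s) e = 1
     & forall e, e \in s -> primitive_in (gspan K (letter_perm_Group n)) e /\ gstar e = e].
Proof.
apply: gelfand_tsetlin.
- apply/val_inj/setP => s; rewrite /= in_set1; apply/letter_permP/eqP => [[_ s0]|->].
    by apply/permP => i; rewrite perm1 s0.
  by split=> i; rewrite perm1.
- move=> i; apply/subsetP => s /letter_permP[s1 s2]; apply/letter_permP; split=> // j /ltnW.
  exact: s2.
move=> k s /letter_permP[s1 s2].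
(* The marked point is k. As h maps each point into its own orbit under s, it preserves labels and
   fixes every point that s fixes; fixing k too, it lies in the previous group. *)
have [|h [hs hk ho]] := @perm_conj_inv _ s [pred i : 'I_n | k == i :> nat].
  by move=> x y /= /eqP kx /eqP ky; apply/val_inj; rewrite /= -kx -ky.
exists h => //; apply/letter_permP; split => i.
  have /porbitP[j ->] := ho i; elim: j => [|j IH]; first by rewrite expg0 perm1.
  by rewrite expgSr permM s1.
rewrite leq_eqVlt => /predU1P[ki|ki]; first by apply: hk; rewrite /= ki.
have /porbitP[j ->] := ho i; elim: j => [|j IH]; first by rewrite expg0 perm1.
by rewrite expgSr permM IH s2.
Qed.

End LetterPerm.

Section SymmetricGroup.
Variables (K : numClosedFieldType) (gT : finGroupType).

Lemma ltrace_gstar : ltrace (@gstar K gT) = #|[set x : gT | x^-1%g == x]|%:R.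
Proof.
have ev x : exists phi : 'Hom(galg K gT, K^o), forall f, phi f = f x.
  have lin : linear (fun f : galg K gT => f x : K^o) by move=> k f g; rewrite !ffunE.
  pose F : {linear galg K gT -> K^o} := HB.pack (fun f : galg K gT => f x : K^o)
     (GRing.isLinear.Build _ _ _ _ _ lin).
  by exists (linfun F) => f; rewrite lfunE.
have [phi phiE] := fin_all_exists ev.
apply: (ltrace_permuted_basis (phi := phi) (delta := gdelta)) => [f|x y|x].
- by rewrite {1}[f]gdelta_sum; apply: eq_bigr => x _; rewrite phiE.
- by rewrite phiE ffunE.
exact: gstar_delta.
Qed.

Definition galg_rep n (rG : mx_representation K [set: gT] n) (f : galg K gT) : 'M[K]_n :=
  \sum_x f x *: rG x.

Section Rep.
Variables (n : nat) (rG : mx_representation K [set: gT] n).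

Lemma galg_repM f g : galg_rep rG (f * g) = galg_rep rG f *m galg_rep rG g.
Proof.
rewrite /galg_rep mulmx_suml; under [RHS]eq_bigr do rewrite mulmx_sumr.
rewrite exchange_big /=.
under eq_bigr do rewrite galg_mulE scaler_suml.
rewrite exchange_big [RHS]exchange_big /=; apply: eq_bigr => y _.
rewrite (reindex_inj (mulgI y)) /=; apply: eq_bigr => x _.
by rewrite mulKg repr_mxM ?inE // -scalemxAl -scalemxAr scalerA.
Qed.

Lemma galg_rep_sum s : galg_rep rG (\sum_(e <- s) e) = \sum_(e <- s) galg_rep rG e.
Proof.
rewrite /galg_rep exchange_big; apply: eq_bigr => x _ /=.
by rewrite -scaler_suml sum_ffunE.
Qed.

Lemma galg_repZ k f : galg_rep rG (k *: f) = k *: galg_rep rG f.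
Proof. by rewrite /galg_rep scaler_sumr; apply: eq_bigr => x _; rewrite ffunE scalerA. Qed.

Lemma galg_rep1 : galg_rep rG 1 = 1%:M.
Proof.
rewrite -gdelta1 /galg_rep (bigD1 1%g) //= ffunE eqxx scale1r repr_mx1 big1 ?addr0 // => x x1.
by rewrite ffunE (negPf x1) scale0r.
Qed.

(* An idempotent P <> 0 with P M P in K P for all matrices M has rank one; compare the entries of
   P E_ba P = l P. *)
Lemma galg_rep_trace_primitive e : mx_irreducible rG -> primitive_in fullv e -> galg_rep rG e != 0 ->
  \tr (galg_rep rG e) = 1.
Proof.
move=> irrG pe P0; set P := galg_rep rG e in P0 *; have [_ ee _ _] := pe.
have PP : P *m P = P by rewrite /P -galg_repM ee.
have absG := group_closure_closed_field irrG.
have reg : regular_in (fullv : {vspace galg K gT}) by rewrite -gspanT; apply: gspan_regular.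
have PMP (M : 'M_n) : exists k, P *m M *m P = k *: P.
  have /andP[_ /row_fullP[B BE]] := absG.
  have : (M \in enveloping_algebra_mx rG)%MS by apply: submx_full; case/andP: absG.
  case/envelop_mxP => a ME.
  have [k kE] := primitive_scalar (fun _ _ _ _ => memvf _) reg pe (memvf ([ffun x => a x] : galg K gT)).
  exists k; rewrite /P -galg_repZ -kE !galg_repM; congr (_ *m _ *m _).
  by rewrite ME /galg_rep; apply: eq_big => x; rewrite ?inE // ffunE.
have [a [b Pab]] : exists a b, P a b != 0.
  apply: boolp.contrapT => H; case/eqP: P0; apply/matrixP => a b; rewrite mxE.
  by apply: boolp.contrapT => /eqP N; apply: H; exists a, b.
have [k kE] := PMP (delta_mx b a).
have kab : k = P a b.
  have := congr1 (fun M : 'M_n => M a b) kE.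
  rewrite !mxE (bigD1 a) //= big1 ?addr0 => [|i ia].
    rewrite !mxE (bigD1 b) //= big1 ?addr0 => [|i ib].
      by rewrite mxE !eqxx mulr1 => /(mulIf Pab).
    by rewrite mxE (negPf ib) mulr0.
  by rewrite !mxE big1 ?mul0r // => j _; rewrite mxE (negPf ia) andbF mulr0.
have := congr1 mxtrace kE; rewrite -mulmxA mxtrace_mulC -mulmxA PP linearZ /= kab.
have -> : \tr (delta_mx b a *m P) = P a b.
  rewrite /mxtrace (bigD1 b) //= big1 ?addr0 => [|i ib]; rewrite mxE.
    rewrite (bigD1 a) //= big1 ?addr0 => [|i ia]; rewrite mxE ?eqxx ?mul1r //.
    by rewrite (negPf ia) andbF mul0r.
  by rewrite big1 // => j _; rewrite mxE (negPf ib) mul0r.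
by move/eqP; rewrite -{1}[P a b]mulr1 (inj_eq (mulfI Pab)) eq_sym => /eqP.
Qed.

End Rep.

(** A degree is the trace of 1, that is of the sum of the e. Each primitive e acts as a rank-one
    idempotent in exactly one irreducible representation and as 0 in the others. *)
Lemma sum_irr_degree_size (s : seq (galg K gT)) :
  orthogonal_seq s -> \sum_(e <- s) e = 1 -> (forall e, e \in s -> primitive_in fullv e) ->
  (\sum_(i : DecSocleType (regular_repr K [set: gT])) irr_degree i)%N = size s.
Proof.
move=> os S1 sP; set aG := regular_repr K [set: gT].
have charG : pgroup (negn [pchar K]) [set: gT].
  by rewrite /pgroup /pnat cardG_gt0; apply/allP => p _; rewrite inE /= pchar_num.
have opE (i : DecSocleType aG) f : gring_op (irr_repr i) (galg_rep aG f) = galg_rep (irr_repr i) f.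
  rewrite /galg_rep linear_sum; apply: eq_bigr => x _; rewrite linearZ /= gring_opG ?inE //.
have repP A : (A \in group_ring K [set: gT])%MS -> exists f, A = galg_rep aG f.
  case/envelop_mxP => a ->; exists [ffun x => a x].
  by rewrite /galg_rep; apply: eq_big => x; rewrite ?inE // ffunE.
have rep_inj f : galg_rep aG f = 0 -> f = 0.
  move=> f0; apply/ffunP => x; have := congr1 (gring_proj x) f0.
  rewrite linear0 linear_sum (bigD1 x) //= big1 ?addr0 => [|y yx]; last first.
    by rewrite linearZ /= gring_projE ?inE // eq_sym (negPf yx) scaler0.
  rewrite linearZ /= gring_projE ?inE // eqxx => /matrixP/(_ 0 0).
  by rewrite !mxE mulr1 ffunE.
apply/eqP; rewrite -(eqr_nat K) natr_sum.
rewrite (eq_bigr (fun i => \sum_(e <- s) \tr (galg_rep (irr_repr i) e))); last first.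
  by move=> i _; rewrite -linear_sum /= -galg_rep_sum S1 galg_rep1 mxtrace1.
rewrite exchange_big -sum1_size natr_sum; apply/eqP; apply: eq_big_seq => e es /=.
have [i0 ei0] : exists i : DecSocleType aG, galg_rep (irr_repr i) e != 0.
  apply: boolp.contrapT => H.
  case: (sP e es) => _ _ /eqP e0 _; apply: e0; apply: rep_inj.
  rewrite -[LHS]mul1mx -(Wedderburn_sum_id_pchar (DecSocleType aG) charG) mulmx_suml big1 // => i _.
  have RE : (galg_rep aG e \in group_ring K [set: gT])%MS.
    by apply/envelop_mxP; exists e; rewrite /galg_rep; apply: eq_bigl => x; rewrite inE.
  have idR := Wedderburn_ideal i; have /andP[_ idr] := idR.
  apply: (@regular_op_inj_pchar _ _ _ (DecSocleType aG) charG _ _ (socle_irr i : mx_irreducible (irr_repr i))); rewrite ?inE.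
  - rewrite irr_reprK_pchar //; apply: submx_trans idr.
    by apply: mem_mulsmx => //; exact: Wedderburn_id_mem.
  - by rewrite linear0 sub0mx.
  rewrite gring_opM // opE (_ : galg_rep _ e = 0) ?mulmx0 ?linear0 //.
  by apply: boolp.contrapT => /eqP N; apply: H; exists i.
have tr1 := galg_rep_trace_primitive (socle_irr i0) (sP e es) ei0.
rewrite (bigD1 i0) //= [X in X + _]tr1 big1 ?addr0 // => i ii0.
(* z is the central idempotent of the block of i0, and e z e = k e. In representation i0 this reads
   k = 1; in any other one z acts as 0, hence so does e. *)
have [z zE] : exists z, Wedderburn_id i0 = galg_rep aG z.
  apply: repP; rewrite -(Wedderburn_sum_pchar (DecSocleType aG) charG).
  by rewrite (sumsmx_sup i0) ?Wedderburn_id_mem.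
have reg : regular_in (fullv : {vspace galg K gT}) by rewrite -gspanT; apply: gspan_regular.
have [_ ee _ _] := sP e es.
have [k kE] := primitive_scalar (fun _ _ _ _ => memvf _) reg (sP e es) (memvf z).
have := congr1 (galg_rep (irr_repr i0)) kE.
rewrite galg_repZ !galg_repM -(opE i0 z) -zE op_Wedderburn_id_pchar // mulmx1 -galg_repM ee.
move/eqP; rewrite -{1}[galg_rep _ e]scale1r -subr_eq0 -scalerBl scaler_eq0 (negPf ei0) orbF subr_eq0 => /eqP k1.
have := congr1 (galg_rep (irr_repr i)) kE.
rewrite galg_repZ !galg_repM -(opE i z) -zE (irr_repr'_op0_pchar charG _ (Wedderburn_id_mem i0)); last by rewrite eq_sym.
by rewrite mulmx0 mul0mx -k1 scale1r => <-; rewrite linear0.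
Qed.
End SymmetricGroup.

Lemma cd_involutions (K : numClosedFieldType) n :
  (\sum_(i : DecSocleType (regular_repr K [set: 'S_n])) irr_degree i)%N
   = #|[set s : 'S_n | (s^-1 == s)%g]|.
Proof.
have [s [os S1 sP]] := letter_perm_good (fun _ : 'I_n => tt) K.
have full : gspan K (letter_perm_Group (fun _ : 'I_n => tt) n) = fullv.
  rewrite -gspanT; congr gspan; apply/val_inj/setP => x; rewrite /= [RHS]in_setT.
  by apply/letter_permP; split=> // i; rewrite leqNgt ltn_ord.
rewrite full in sP.
have reg : regular_in (fullv : {vspace galg K 'S_n}) by rewrite -gspanT; apply: gspan_regular.
rewrite (sum_irr_degree_size os S1) => [|e /sP[]//].
by apply/eqP; rewrite -(eqr_nat K) -ltrace_gstar (ltrace_star reg _ os S1 sP) //; exact: gstarM.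
Qed.

(** * Endomorphism algebras of words *)

Section Bilinear.
Variables (K : fieldType) (t : K).

Definition hdelta v w (d : diagram v w) : hom K v w := [ffun d' => (d' == d)%:R].

Lemma hdelta_sum v w (f : hom K v w) : f = \sum_d (f d : K) *: hdelta d.
Proof.
apply/ffunP => d; rewrite sum_ffunE (bigD1 d) //= big1 => [|d' dd].
  by rewrite !ffunE eqxx [_ *: _]mulr1 addr0.
by rewrite !ffunE eq_sym (negPf dd) [_ *: _]mulr0.
Qed.

Lemma compmDl u v w (g g' : hom K v w) (f : hom K u v) :
  compm t (g + g') f = compm t g f + compm t g' f.
Proof.
apply/ffunP => d; rewrite !ffunE -big_split; apply: eq_bigr => d1 _ /=.
rewrite -big_split; apply: eq_bigr => d2 _ /=.
by rewrite ffunE mulrDr mulrDl.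
Qed.

Lemma compmDr u v w (g : hom K v w) (f f' : hom K u v) :
  compm t g (f + f') = compm t g f + compm t g f'.
Proof.
apply/ffunP => d; rewrite !ffunE -big_split; apply: eq_bigr => d1 _ /=.
by rewrite -big_split; apply: eq_bigr => d2 _ /=; rewrite ffunE mulrDr.
Qed.

Lemma compmZl u v w k (g : hom K v w) (f : hom K u v) : compm t (k *: g) f = k *: compm t g f.
Proof.
apply/ffunP => d; rewrite !ffunE [RHS]mulr_sumr; apply: eq_bigr => d1 _ /=.
by rewrite mulr_sumr; apply: eq_bigr => d2 _ /=; rewrite ffunE [_ *: _]/(k * _) mulrCA !mulrA.
Qed.

Lemma compmZr u v w k (g : hom K v w) (f : hom K u v) : compm t g (k *: f) = k *: compm t g f.
Proof.
apply/ffunP => d; rewrite !ffunE [RHS]mulr_sumr; apply: eq_bigr => d1 _ /=.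
by rewrite mulr_sumr; apply: eq_bigr => d2 _ /=; rewrite ffunE [_ *: _]/(k * _) mulrCA.
Qed.

Lemma compm0l u v w (f : hom K u v) : compm t (0 : hom K v w) f = 0.
Proof. by rewrite -(scale0r (0 : hom K v w)) compmZl scale0r. Qed.

Lemma compm0r u v w (g : hom K v w) : compm t g (0 : hom K u v) = 0.
Proof. by rewrite -(scale0r (0 : hom K u v)) compmZr scale0r. Qed.

Lemma compm_suml u v w (I : Type) (r : seq I) (F : I -> hom K v w) (f : hom K u v) :
  compm t (\sum_(i <- r) F i) f = \sum_(i <- r) compm t (F i) f.
Proof. by elim/big_rec2: _ => [|i x y _ <-]; rewrite ?compm0l ?compmDl. Qed.

Lemma compm_sumr u v w (I : Type) (r : seq I) (g : hom K v w) (F : I -> hom K u v) :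
  compm t g (\sum_(i <- r) F i) = \sum_(i <- r) compm t g (F i).
Proof. by elim/big_rec2: _ => [|i x y _ <-]; rewrite ?compm0r ?compmDr. Qed.

Lemma compm_delta u v w (d2 : diagram v w) (d1 : diagram u v) :
  compm t (hdelta d2) (hdelta d1) = t ^+ loops d1 d2 *: hdelta (dcomp d1 d2).
Proof.
apply/ffunP => d; rewrite [LHS]ffunE (bigD1 d1) //= [X in _ + X]big1 ?addr0 => [|d1' dd]; last first.
  by rewrite big1 // => d2' _; rewrite [hdelta d1 _]ffunE (negPf dd) mulr0.
rewrite !ffunE big_mkcond (bigD1 d2) //= [X in _ + X]big1 ?addr0 => [|d2' dd]; last first.
  by rewrite ffunE (negPf dd) mulr0 mul0r; case: ifP.
rewrite stacks_toE !ffunE !eqxx !mulr1 eq_sym; case: eqP => _; last by rewrite [_ *: _]mulr0.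
by rewrite [_ *: _]mulr1.
Qed.

Lemma compmA u v w x (h : hom K w x) (g : hom K v w) (f : hom K u v) :
  compm t h (compm t g f) = compm t (compm t h g) f.
Proof.
rewrite (hdelta_sum f) !compm_sumr; apply: eq_bigr => d1 _.
rewrite (hdelta_sum g) !(compm_suml, compm_sumr); apply: eq_bigr => d2 _.
rewrite (hdelta_sum h) !(compm_suml, compm_sumr); apply: eq_bigr => d3 _.
rewrite !(compmZl, compmZr) !compm_delta !(compmZl, compmZr) !compm_delta.
have [-> l] := dcompA d1 d2 d3.
rewrite !scalerA; congr (_ *: _).
by rewrite -[LHS]mulrA -exprD l exprD mulrA [h d3 * _ * _]mulrC mulrA.
Qed.

Lemma idmE w : idm K w = hdelta (id_diagram w).
Proof. by apply/ffunP => d; rewrite !ffunE is_id_diagramE. Qed.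

Definition flipm v w (f : hom K v w) : hom K w v := [ffun d : diagram w v => f (flip d)].

Lemma flipmD v w (f g : hom K v w) : flipm (f + g) = flipm f + flipm g.
Proof. by apply/ffunP => d; rewrite !ffunE. Qed.

Lemma flipmZ v w k (f : hom K v w) : flipm (k *: f) = k *: flipm f.
Proof. by apply/ffunP => d; rewrite !ffunE. Qed.

Lemma flipm_sum v w (I : Type) (r : seq I) (F : I -> hom K v w) :
  flipm (\sum_(i <- r) F i) = \sum_(i <- r) flipm (F i).
Proof.
elim/big_rec2: _ => [|i x y _ <-]; last by rewrite flipmD.
by apply/ffunP => d; rewrite !ffunE.
Qed.

Lemma flipm_delta v w (d : diagram v w) : flipm (hdelta d) = hdelta (flip d).
Proof. by apply/ffunP => d'; rewrite !ffunE (can2_eq (@flipK _ _) (@flipK _ _)). Qed.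

Lemma flipmK v w : cancel (@flipm v w) (@flipm w v).
Proof. by move=> f; apply/ffunP => d; rewrite !ffunE flipK. Qed.

Lemma flipm_comp u v w (g : hom K v w) (f : hom K u v) :
  flipm (compm t g f) = compm t (flipm f) (flipm g).
Proof.
rewrite (hdelta_sum f) compm_sumr !flipm_sum compm_suml; apply: eq_bigr => d1 _.
rewrite (hdelta_sum g) compm_suml !flipm_sum compm_sumr; apply: eq_bigr => d2 _.
rewrite !(compmZl, compmZr, flipmZ) !flipm_delta !compm_delta flipmZ flipm_delta.
have [-> ->] := flip_dcomp d1 d2.
rewrite !scalerA; congr (_ *: _); congr (_ * _); exact: mulrC.
Qed.

Lemma flipm_id w : flipm (idm K w) = idm K w.
Proof.
rewrite idmE flipm_delta; congr hdelta; apply/val_inj/ffunP => -[i|i];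
by rewrite flipE !ffunE.
Qed.

Lemma compm_idl v w (f : hom K v w) : compm t (idm K w) f = f.
Proof. by apply: (can_inj (@flipmK _ _)); rewrite flipm_comp flipm_id compm_idr. Qed.

End Bilinear.
Arguments hdelta K {v w} d.

(** The parameter is part of the type because the ring structure depends on it. *)
Definition dalg (K : fieldType) (t : K) (w : word) : Type := hom K w w.

Section EndAlgebra.
Variables (K : fieldType) (t : K) (w : word).
Local Notation dalg := (dalg t w).
HB.instance Definition _ := Vector.on dalg.

Fact dalg_1_neq0 : idm K w != 0 :> dalg.
Proof. by apply/eqP => /ffunP/(_ (id_diagram w)); rewrite idmE !ffunE eqxx => /eqP; rewrite oner_eq0. Qed.

HB.instance Definition _ := GRing.Zmodule_isNzRing.Build dalg
  (@compmA K t w w w w) (@compm_idl K t w w) (@compm_idr K t w w)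
  (fun g g' f => @compmDl K t w w w g g' f) (fun g f f' => @compmDr K t w w w g f f') dalg_1_neq0.
HB.instance Definition _ := GRing.Lmodule_isLalgebra.Build K dalg
  (fun k f g => esym (@compmZl K t w w w k f g)).
HB.instance Definition _ := GRing.Lalgebra_isAlgebra.Build K dalg
  (fun k f g => esym (@compmZr K t w w w k f g)).
HB.instance Definition _ := Algebra_isFalgebra.Build K dalg.

Lemma dalg_mulE (x y : dalg) : x * y = compm t (x : hom K w w) y.
Proof. by []. Qed.

Lemma dalg_oneE : 1 = idm K w :> dalg. Proof. by []. Qed.

Definition dflip (x : dalg) : dalg := flipm (x : hom K w w).
Fact dflip_is_linear : linear dflip.
Proof. by move=> k f g; rewrite /dflip flipmD flipmZ. Qed.
HB.instance Definition _ := GRing.isSemilinear.Build K dalg dalg *:%R dflip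
  (GRing.semilinear_linear dflip_is_linear).
Definition dstar : 'End(dalg) := linfun dflip.

Lemma dstarE x : dstar x = flipm (x : hom K w w). Proof. exact: lfunE. Qed.

Lemma dstarK x : dstar (dstar x) = x.
Proof. by rewrite !dstarE flipmK. Qed.

Lemma dstarM x y : dstar (x * y) = dstar y * dstar x.
Proof. by rewrite !dstarE dalg_mulE flipm_comp. Qed.

End EndAlgebra.

(** Let J be a complement of the left ideal A x and 1 = a x + z with z in J. Then x z = x - x a x
    lies in both A x and J, so it vanishes. *)
Lemma dalg_regular (K : numClosedFieldType) (t : K) (w : word) : semisimple_end t w -> regular_in (fullv : {vspace dalg t w}).
Proof.
move=> ss x _; pose I : {vspace dalg t w} := limg (amulr x).
have mulI a : a * x \in I by rewrite -[X in X \in _](lfunE (x \o* idfun)) memv_img ?memvf.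
have IP y : y \in I -> exists a, y = a * x.
  by move=> /memv_imgP[c _ ->]; exists c; rewrite lfunE.
have lI : left_ideal t (I : {vspace hom K w w}).
  move=> a y /IP[c ->]; rewrite -[compm t a _]/((a : dalg t w) * (c * x)) mulrA.
  exact: mulI.
have [J [lJ IJ1 IJ0]] := ss I lI.
have : (1 : dalg t w) \in (I + J)%VS by rewrite IJ1 memvf.
case/memv_addP => y yI [z zJ yz].
have [a ya] := IP y yI.
exists a; first exact: memvf.
have xz : x * z = x - x * a * x by rewrite -{2}[x]mulr1 yz mulrDr ya mulrA addrC addKr.
have : x * z \in (I :&: J)%VS.
  rewrite memv_cap; apply/andP; split; last exact: lJ.
  have xI : x \in I by have := mulI 1; rewrite mul1r.
  by rewrite xz rpredB.
by rewrite IJ0 memv0 xz subr_eq0 => /eqP.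
Qed.

(** * Letter-preserving permutations as diagrams *)

Section PermDiagram.
Variable w : word.
Local Notation G := (letter_perm_Group (fun i : 'I_(size w) => is_up (letter i)) (size w)).

Lemma letter_GP (s : {perm 'I_(size w)}) : reflect (forall i, letter (s i) = letter i) (s \in G).
Proof.
apply: (iffP (letter_permP _ _ _)) => [[H _] i|H].
  by move: (H i); case: letter; case: letter.
by split=> i; [rewrite H|rewrite leqNgt ltn_ord].
Qed.

Definition perm_fun (s : {perm 'I_(size w)}) : {ffun points w w -> points w w} :=
  [ffun p => match p with inl i => inr (s i) | inr j => inl (s^-1%g j) end].

(* Junk value: the identity diagram when s does not preserve the letters. *)
Definition perm_diagram (s : {perm 'I_(size w)}) : diagram w w := insubd (id_diagram w) (perm_fun s).

Lemma perm_diagramE s : s \in G -> perm_diagram s = perm_fun s :> {ffun points w w -> points w w}.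
Proof.
move=> /letter_GP sG; apply: insubdK; rewrite unfold_in; apply/forallP => -[i|j]; rewrite !ffunE /=.
  by rewrite permK eqxx sG same_arrowxx.
rewrite permKV eqxx /= -{1}[j](permKV s) sG; exact: same_arrowxx.
Qed.

Lemma compat_perm s a b : s \in G -> compat (perm_diagram s) a b = [forall i, b (s i) == a i].
Proof.
move=> sG; apply/compatP/forallP => H.
  by move=> i; apply/eqP; have := H (inl i); rewrite perm_diagramE // ffunE.
move=> [i|j]; rewrite perm_diagramE // ffunE /=; first exact/eqP.
by rewrite -{2}[j](permKV s) (eqP (H _)).
Qed.

Lemma perm_diagram_comp s s' : s \in G -> s' \in G ->
  dcomp (perm_diagram s) (perm_diagram s') = perm_diagram (s * s')%g /\
  loops (perm_diagram s) (perm_diagram s') = 0.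
Proof.
move=> sG s'G; apply: composite_unique => a c; rewrite expn0 mul1n.
pose b : colouring w := [ffun i => a (s^-1%g i)].
have -> : middle_colourings (perm_diagram s) (perm_diagram s') a c
   = if compat (perm_diagram s') b c then [set b] else set0.
  apply/setP => b'; rewrite inE compat_perm //.
  have -> : [forall i, b' (s i) == a i] = (b' == b).
    apply/forallP/eqP => [H|-> i]; last by rewrite ffunE permK.
    by apply/ffunP => i; rewrite ffunE -{1}[i](permKV s) (eqP (H _)).
  by case: ifP => H; rewrite !inE; case: eqP => //= ->; rewrite H.
rewrite (fun_if (fun A : {set _} => #|A|)) cards1 cards0.
rewrite !compat_perm ?groupM //.
have -> : [forall i, c (s' i) == b i] = [forall i, c ((s * s')%g i) == a i].
  apply/forallP/forallP => H i; first by have := H (s i); rewrite permM ffunE permK.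
  by have := H (s^-1%g i); rewrite permM permKV ffunE.
by case: ifP.
Qed.

Lemma flip_perm s : s \in G -> flip (perm_diagram s) = perm_diagram s^-1%g.
Proof.
move=> sG; apply/val_inj/ffunP => p.
by rewrite /= perm_diagramE ?groupV // flipE perm_diagramE // !ffunE; case: p => i; rewrite ?invgK.
Qed.

Lemma perm_diagram1 : perm_diagram 1%g = id_diagram w.
Proof.
apply/val_inj/ffunP => -[i|i]; rewrite /= perm_diagramE ?group1 // !ffunE ?invg1 perm1 //.
Qed.

(** If no two top points are joined, every top point has a bottom partner; the resulting injection
    of positions is a permutation. *)
Lemma perm_or_cup (d : diagram w w) :
  (exists2 s, s \in G & d = perm_diagram s) \/ exists i j, d (inr i) = inr j.
Proof.
have [cup|nocup] := boolp.pselect (exists i j, d (inr i) = inr j); first by right.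
left; have dr j : exists i, d (inr j) = inl i.
  by case E: (d (inr j)) => [i|i]; [exists i|case: nocup; exists j, i].
have [f fE] := fin_all_exists dr.
have f_inj : injective f.
  by move=> j j' ff; have := congr1 d (congr1 inl ff); rewrite -!fE !diagramK => -[].
pose s := perm f_inj.
have sG : (s^-1)%g \in G.
  rewrite groupV; apply/letter_GP => j; rewrite permE.
  have := diagram_source d (inr j); rewrite fE /= negbK.
  by case: letter; case: letter.
exists s^-1%g => //; apply/val_inj/ffunP => p; rewrite /= perm_diagramE // ffunE.
case: p => i; last by rewrite fE invgK permE.
apply: (can_inj (@diagramK _ _ d)).
by rewrite diagramK fE -(permE f_inj) permKV.
Qed.

End PermDiagram.

(** * Removing two letters by a cap *)

Section Cap.
Variables (w : word) (i j : 'I_(size w)).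
Hypothesis lij : ~~ same_arrow (letter i) (letter j).

Let S := enum [pred k : 'I_(size w) | (k != i) && (k != j)].

Definition capped_word : word := [seq letter k | k <- S].

Let sizeS : size capped_word = size S. Proof. exact: size_map. Qed.

Definition capped_pos (k : 'I_(size capped_word)) : 'I_(size w) := nth i S k.

Let pos_lt (k : 'I_(size capped_word)) : (k < size S)%N. Proof. by rewrite -sizeS ltn_ord. Qed.

Lemma capped_pos_inj : injective capped_pos.
Proof.
move=> k k' /eqP; rewrite nth_uniq ?pos_lt ?enum_uniq // => /eqP kk.
exact: val_inj.
Qed.

Lemma letter_capped k : letter (capped_pos k) = letter k.
Proof. by rewrite [RHS]/letter (tnth_nth Up) /= (nth_map i) ?pos_lt. Qed.

Lemma capped_pos_neq k : (capped_pos k != i) && (capped_pos k != j).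
Proof. by have := mem_nth i (pos_lt k); rewrite mem_enum. Qed.

Lemma capped_pos_surj x : x != i -> x != j -> exists k, capped_pos k = x.
Proof.
move=> xi xj; have xS : x \in S by rewrite mem_enum inE xi.
have lt : (index x S < size capped_word)%N by rewrite sizeS index_mem.
by exists (Ordinal lt); rewrite /capped_pos nth_index.
Qed.

Lemma size_capped : (size capped_word < size w)%N.
Proof.
rewrite sizeS -cardE -[X in (_ < X)%N]card_ord; apply: proper_card.
apply/properP; split; first exact/subsetP.
by exists i; rewrite // inE eqxx.
Qed.

(** The last default [inl x] never occurs, by [capped_pos_surj]. *)
Definition cap_fun : {ffun points w capped_word -> points w capped_word} :=
  [ffun p => match p with
    | inl x => if x == i then inl j else if x == j then inl i
               else if [pick k | capped_pos k == x] is Some k then inr k else inl x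
    | inr k => inl (capped_pos k)
    end].

Let ij : i != j. Proof. by apply: contraNneq lij => ->; rewrite same_arrowxx. Qed.

Let cap_pos k : cap_fun (inl (capped_pos k)) = inr k.
Proof.
have /andP[ki kj] := capped_pos_neq k; rewrite ffunE (negPf ki) (negPf kj).
case: pickP => [k' /eqP/capped_pos_inj -> //|/(_ k)]; by rewrite eqxx.
Qed.

Let cap_i : cap_fun (inl i) = inl j. Proof. by rewrite ffunE eqxx. Qed.

Let cap_j : cap_fun (inl j) = inl i.
Proof. by rewrite ffunE eq_sym (negPf ij) eqxx. Qed.

Fact cap_is_diagram : is_diagram cap_fun.
Proof.
apply/forallP => -[x|k]; last first.
  by rewrite [cap_fun (inr k)]ffunE cap_pos eqxx /= letter_capped same_arrowxx.
have [->|xi] := eqVneq x i.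
  rewrite cap_i cap_j eqxx /= lij andbT.
  by apply: contra ij => /eqP[->].
have [->|xj] := eqVneq x j.
  rewrite cap_j cap_i eqxx /=.
  apply/andP; split; first by apply: contra ij => /eqP[->].
  by move: lij; case: letter; case: letter.
have [k <-] := capped_pos_surj xi xj.
by rewrite cap_pos [cap_fun _]ffunE eqxx /= letter_capped same_arrowxx.
Qed.

Definition cap : diagram w capped_word := Diagram cap_is_diagram.

Lemma compat_cap a b : compat cap a b = (a i == a j) && [forall k, b k == a (capped_pos k)].
Proof.
apply/compatP/andP => [H|[/eqP aij /forallP H] [x|k]].
- split.
    by have := H (inl i); rewrite /= cap_i /= => ->.
  by apply/forallP => k; have := H (inr k); rewrite /= ffunE /= => ->.
- rewrite /=; have [->|xi] := eqVneq x i; first by rewrite cap_i /= aij.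
  have [->|xj] := eqVneq x j; first by rewrite cap_j /= aij.
  by have [k <-] := capped_pos_surj xi xj; rewrite cap_pos /= (eqP (H k)).
by rewrite /= ffunE /= (eqP (H k)).
Qed.

(** As [be] runs over both colours, these are all the colourings of [w] compatible with the cap and
    m; sums over them have two terms. *)
Definition uncap (m : colouring capped_word) (be : bool) : colouring w :=
  [ffun x => if [pick k | capped_pos k == x] is Some k then m k else be].

Let uncap_pos m be k : uncap m be (capped_pos k) = m k.
Proof. by rewrite ffunE; case: pickP => [k' /eqP/capped_pos_inj -> //|/(_ k)]; rewrite eqxx. Qed.

Let uncap_i m be : uncap m be i = be.
Proof. by rewrite ffunE; case: pickP => // k /eqP ki; have := capped_pos_neq k; rewrite ki eqxx. Qed.

Let uncap_j m be : uncap m be j = be.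
Proof. by rewrite ffunE; case: pickP => // k /eqP ki; have := capped_pos_neq k; rewrite ki eqxx andbF. Qed.

Let compat_uncap a m : compat cap a m = (a == uncap m (a i)).
Proof.
rewrite compat_cap; apply/andP/eqP => [[/eqP aij /forallP H]|E].
  apply/ffunP => x; have [->|xi] := eqVneq x i; first by rewrite uncap_i.
  have [->|xj] := eqVneq x j; first by rewrite uncap_j.
  by have [k <-] := capped_pos_surj xi xj; rewrite uncap_pos (eqP (H k)).
split; first by rewrite [a j](congr1 (fun f : colouring w => f j) E) uncap_j.
by apply/forallP => k; rewrite E uncap_pos.
Qed.

Lemma sum_compat_cap (F : colouring w -> nat) m :
  (\sum_a F a * compat cap a m = F (uncap m true) + F (uncap m false))%N.
Proof.
rewrite (bigD1 (uncap m true)) //= (bigD1 (uncap m false)) /=; last first.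
  by apply/eqP => /ffunP/(_ i); rewrite !uncap_i.
rewrite !compat_uncap !uncap_i !eqxx !muln1 big1 ?addn0 // => a /andP[a1 a2].
by rewrite compat_uncap; case: (a i); rewrite ?(negPf a1) ?(negPf a2) muln0.
Qed.

Lemma cap_flip_cap : dcomp (flip cap) cap = id_diagram capped_word /\ loops (flip cap) cap = 1%N.
Proof.
apply: composite_unique => a c; rewrite card_middleE.
under eq_bigr do rewrite compat_flip mulnC.
rewrite -[LHS]/(\sum_b compat cap b c * compat cap b a)%N sum_compat_cap !compat_uncap !uncap_i.
have E be : (uncap a be == uncap c be) = (a == c).
  apply/eqP/eqP => [/ffunP E|->//]; apply/ffunP => k.
  by have := E (capped_pos k); rewrite !uncap_pos.
have -> : compat (id_diagram capped_word) a c = (a == c).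
  apply/compatP/eqP => [H|-> p]; last by rewrite ffunE; case: p.
  by apply/ffunP => k; have := H (inr k); rewrite ffunE.
by rewrite !E; case: eqP.
Qed.

Lemma compat_cup v (d : diagram v w) a (b b' : colouring w) : d (inr i) = inr j -> compat d a b ->
  b' i = b' j -> (forall k, b' (capped_pos k) = b (capped_pos k)) -> compat d a b'.
Proof.
move=> dij /compatP H bij E; apply/compatP.
have dji : d (inr j) = inr i by rewrite -dij diagramK.
have same p : p != inr i -> p != inr j -> colour a b' p = colour a b p.
  case: p => //= x xi xj; have [k <-] : exists k, capped_pos k = x; last exact: E.
  by apply: capped_pos_surj; [apply: contra xi => /eqP ->|apply: contra xj => /eqP ->].
move=> p; have [->|pi] := eqVneq p (inr i); first by rewrite dij.
have [->|pj] := eqVneq p (inr j); first by rewrite dji.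
rewrite !same // -?H //.
  by rewrite -[inr i]dji (can_eq (@diagramK _ _ d)).
by rewrite -[inr j]dij (can_eq (@diagramK _ _ d)).
Qed.

(** Two-colourings show the composite: i and j may be recoloured together, a factor 2, while all
    other colours are forced. Hence t d = c' c d for the cap c and its reflection c'. *)
Lemma cup_factor v (d : diagram v w) : d (inr i) = inr j ->
  dcomp (dcomp d cap) (flip cap) = d /\ (loops d cap + loops (dcomp d cap) (flip cap) = 1)%N.
Proof.
move=> dij.
have E a e : (2 ^ (loops d cap + loops (dcomp d cap) (flip cap)) * compat (dcomp (dcomp d cap) (flip cap)) a e
    = 2 ^ 1 * compat d a e)%N.
  rewrite expnD -mulnA -card_middle_colourings card_middleE big_distrr /=.
  under eq_bigr => m _ do rewrite mulnA -card_middle_colourings card_middleE compat_flip sum_compat_cap.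
  have [eij|neij] := eqVneq (e i) (e j); last first.
    rewrite big1 => [|m _]; last by rewrite compat_cap (negPf neij) muln0.
    case: compatP => // H; have := H (inr i); rewrite dij /= => eji.
    by rewrite eji eqxx in neij.
  pose m : colouring capped_word := [ffun k => e (capped_pos k)].
  rewrite (bigD1 m) //= big1 ?addn0 => [|m' mm].
    rewrite compat_cap eij eqxx (_ : [forall k, _]) ?muln1; last by apply/forallP => k; rewrite ffunE.
    have U be : compat d a (uncap m be) = compat d a e.
      apply/idP/idP => H; apply: (compat_cup dij H) => //.
      - by move=> k; rewrite uncap_pos ffunE.
      - by rewrite uncap_i uncap_j.
      by move=> k; rewrite uncap_pos ffunE.
    by rewrite !U addnn -mul2n.
  rewrite compat_cap; case: forallP => [H|]; last by rewrite andbF muln0.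
  by case/eqP: mm; apply/ffunP => k; rewrite ffunE (eqP (H k)).
have lE : (loops d cap + loops (dcomp d cap) (flip cap) = 1)%N.
  have := E [ffun => false] [ffun => false].
  by rewrite !compat_false !muln1 => /eqP; rewrite eqn_exp2l // => /eqP.
split=> //; apply/esym/compat_inj => a b ab; move/eqP: (E a b).
by rewrite lE eqn_pmul2l // ab; case: compat.
Qed.

End Cap.

Section GoodDecomposition.
Variables (K : numClosedFieldType) (t : K).
Hypothesis t_generic : generic t.

Let reg w : regular_in (fullv : {vspace dalg t w}).
Proof. exact/dalg_regular/t_generic. Qed.

Definition has_good_decomposition (w : word) := exists s : seq (dalg t w),
  [/\ orthogonal_seq s, \sum_(e <- s) e = 1 & forall e, e \in s -> primitive_in fullv e /\ dstar t w e = e].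

(* At t = 0 the diagram cup . cap on the word up-down would generate a nilpotent ideal: every closure
   cap . d . cup contains a closed loop. *)
Lemma generic_neq0 : t != 0.
Proof.
pose w0 : word := [:: Up; Down].
pose i : 'I_(size w0) := ord0; pose j : 'I_(size w0) := ord_max.
have lij : ~~ same_arrow (letter i) (letter j) by [].
set w' := capped_word i j; pose c := cap lij.
have w'0 : size w' = 0%N.
  apply/eqP; rewrite -leqn0 leqNgt; apply/negP => lt0.
  have := capped_pos_neq (Ordinal lt0); case: (capped_pos _) => [[|[|k]] lt] //.
have mE (m m' : colouring w') : m = m'.
  by apply/ffunP => k; have := ltn_ord k; rewrite [X in (_ < X)%N]w'0.
(* The middle word is empty, so there is a single colouring and no room for a loop. *)
have lc : loops c (flip c) = 0%N.
  have := card_middle_colourings c (flip c) [ffun => false] [ffun => false].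
  rewrite compat_false muln1 => cE; have := max_card (mem (middle_colourings c (flip c) [ffun => false] [ffun => false])).
  rewrite cE card_ffun card_bool card_ord w'0 expn0.
  by case: (loops _ _) => // n; rewrite leqNgt -[X in (X < _)%N](expn0 2) ltn_exp2l.
apply/eqP => t0.
pose x : dalg t w0 := compm t (hdelta K (flip c)) (hdelta K c).
have [a _ xE] := reg (memvf x).
have cac : compm t (hdelta K c) (compm t (a : hom K w0 w0) (hdelta K (flip c))) = 0.
  rewrite (hdelta_sum (a : hom K w0 w0)) compm_suml compm_sumr big1 // => d _.
  rewrite compmZl compmZr compm_delta compmZr compm_delta !scalerA -mulrA -exprD t0.
  rewrite expr0n (_ : (_ + _ == 0)%N = false) ?mulr0 ?scale0r //; apply/negbTE; rewrite -lt0n.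
  rewrite lt0n; apply/negP => /eqP l0.
  have := card_middle_colourings (dcomp (flip c) d) c [ffun => false] [ffun => false].
  rewrite compat_false muln1 card_middleE => cE.
  have : (2 <= 2 ^ (loops (flip c) d + loops (dcomp (flip c) d) c))%N.
    rewrite expnD -cE big_distrr /=.
    under eq_bigr => b _ do rewrite mulnA -card_middle_colourings card_middleE.
    rewrite (sum_compat_cap lij (fun b => \sum_b0 compat (flip c) [ffun => false] b0 * compat d b0 b)%N [ffun => false]).
    (* Both constant colourings of the middle points are admissible, so there are at least two and
       hence a closed loop. *)
    have pos be : (0 < \sum_b compat (flip c) [ffun => false] b * compat d b (uncap (i := i) (j := j) [ffun => false] be))%N.
      rewrite (bigD1 (uncap (i := i) (j := j) [ffun => false] be)) //= addn_gt0.
      suff E : uncap (i := i) (j := j) [ffun => false] be = [ffun => be].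
        rewrite E compat_flip compat_cap !ffunE eqxx /=.
        have -> /= : [forall k : 'I_(size (capped_word i j)), [ffun=> false] k == [ffun=> be] (capped_pos k)].
          by apply/forallP => k; have := ltn_ord k; rewrite [X in (_ < X)%N]w'0.
        suff -> : compat d [ffun => be] [ffun => be] by [].
        by apply/compatP => p; case: (d p) => k; case: p => k'; rewrite /= !ffunE.
      apply/ffunP => k; rewrite !ffunE; case: pickP => // k' _.
      by have := ltn_ord k'; rewrite [X in (_ < X)%N]w'0.
    by rewrite -(addn1 1) leq_add.
  by rewrite l0.
have : x = 0.
  by rewrite xE !dalg_mulE /x -!compmA (compmA t (a : hom K w0 w0) (hdelta K (flip c))) (compmA t (hdelta K c)) cac compm0l compm0r.
rewrite /x compm_delta lc expr0 scale1r => /ffunP/(_ (dcomp c (flip c))).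
by rewrite !ffunE eqxx => /eqP; rewrite oner_eq0.
Qed.

(** For the cap c one has c c' = t, so [mu] embeds End(w') multiplicatively in End(w), commutes with
    [dstar] and maps primitive idempotents to primitive ones. By [cup_factor], [mu 1] acts as
    identity on the diagrams with a cup at i, j. Equal letters allow no such diagram, and the empty
    list serves. *)
Lemma cup_idempotents w (i j : 'I_(size w)) :
  (forall w', (size w' < size w)%N -> has_good_decomposition w') ->
  exists es : seq (dalg t w), (forall e, e \in es -> primitive_in fullv e /\ dstar t w e = e) /\
    forall d : diagram w w, d (inr i) = inr j ->
      (\sum_(e <- es) e) * (hdelta K d : dalg t w) = hdelta K d.
Proof.
move=> IH; have [same|lij] := boolP (same_arrow (letter i) (letter j)).
  exists [::]; split=> // d dij; have := diagram_source d (inr i); rewrite dij /=.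
  by move: same; case: letter; case: letter.
have t0 := generic_neq0.
have [s [os S1 sP]] := IH _ (size_capped i j).
set w' := capped_word i j in s os S1 sP.
pose c : hom K w w' := hdelta K (cap lij); pose c' : hom K w' w := flipm c.
have cc' : compm t c c' = t *: idm K w'.
  rewrite /c' /c flipm_delta compm_delta; have [-> ->] := cap_flip_cap lij.
  by rewrite expr1 idmE.
pose mu (x : dalg t w') : dalg t w := t^-1 *: compm t c' (compm t (x : hom K w' w') c).
have muD x y : mu (x + y) = mu x + mu y by rewrite /mu compmDl compmDr scalerDr.
have muZ k x : mu (k *: x) = k *: mu x by rewrite /mu compmZl compmZr !scalerA mulrC.
have mu_sum r : mu (\sum_(e <- r) e) = \sum_(e <- r) mu e.
  elim: r => [|e r IHr]; last by rewrite !big_cons muD IHr.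
  by rewrite !big_nil -(scale0r (0 : dalg t w')) muZ scale0r.
have muzmu x z y : mu x * z * mu y = (t^-1 * t^-1) *:
    (compm t c' (compm t (x * (compm t c (compm t (z : hom K w w) c') : dalg t w') * y : dalg t w') c) : dalg t w).
  rewrite /mu !dalg_mulE !(compmZl, compmZr) scalerA; congr (_ *: _).
  by rewrite -!compmA.
have mumu x y : mu x * mu y = mu (x * y).
  rewrite -[mu x]mulr1 muzmu dalg_oneE compm_idl cc'.
  have -> : x * (t *: idm K w' : dalg t w') * y = t *: (x * y) by rewrite -scalerAr -scalerAl -dalg_oneE mulr1.
  by rewrite compmZl compmZr scalerA -mulrA mulVf // mulr1.
have mu_star x : dstar t w (mu x) = mu (dstar t w' x).
  by rewrite !dstarE /mu flipmZ !flipm_comp /c' flipmK compmA.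
have mu_neq0 e : e != 0 -> mu e != 0.
  apply: contra_neq => me0; have : compm t c (compm t (mu e : hom K w w) c') = t *: (e : hom K w' w').
    rewrite /mu compmZl compmZr -!compmA cc' !compmZr compm_idr compmA cc' compmZl compm_idl !scalerA.
    by rewrite mulVf // mul1r.
  by rewrite me0 compm0l compm0r => /esym/eqP; rewrite scaler_eq0 (negPf t0) => /eqP.
exists (map mu s); split=> [_ /mapP[e es ->]|d dij].
  have [pe ste] := sP e es; have [_ ee e0 _] := pe.
  split; last by rewrite mu_star ste.
  apply: scalar_primitive; [exact: mu_neq0|by rewrite mumu ee|].
  move=> z; rewrite muzmu.
  have [k ->] := primitive_scalar (fun _ _ _ _ => memvf _) (@reg w') pe
    (memvf (compm t c (compm t (z : hom K w w) c') : dalg t w')).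
  exists (t^-1 * k); rewrite compmZl compmZr scalerA /mu scalerA; congr (_ *: _).
  by rewrite mulrAC.
rewrite big_map -mu_sum S1 dalg_mulE /mu dalg_oneE compm_idl compmZl -compmA /c' /c flipm_delta.
rewrite compm_delta compmZr compm_delta; have [-> l1] := cup_factor lij dij.
by rewrite !scalerA -mulrA -exprD l1 expr1 mulVf // scale1r.
Qed.

Section PermMap.
Variable w : word.
Local Notation G := (letter_perm_Group (fun i : 'I_(size w) => is_up (letter i)) (size w)).

(** The inverse is due to conventions: permutations multiply from left to right, while [compm]
    composes from right to left. *)
Definition perm_map (f : galg K {perm 'I_(size w)}) : dalg t w :=
  \sum_(s in G) (f s : K) *: (hdelta K (perm_diagram s^-1%g) : dalg t w).

Lemma perm_mapZ k f : perm_map (k *: f) = k *: perm_map f.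
Proof. by rewrite scaler_sumr; apply: eq_bigr => s _; rewrite ffunE scalerA. Qed.

Lemma perm_map_sum r : perm_map (\sum_(f <- r) f) = \sum_(f <- r) perm_map f.
Proof.
rewrite /perm_map exchange_big; apply: eq_bigr => s _ /=.
by rewrite -scaler_suml sum_ffunE.
Qed.

Lemma perm_map_delta s : s \in G -> perm_map (gdelta s) = hdelta K (perm_diagram s^-1%g).
Proof.
move=> sG; rewrite /perm_map (bigD1 s) //= ffunE eqxx scale1r big1 ?addr0 // => s' /andP[_ ss].
by rewrite ffunE (negPf ss) scale0r.
Qed.

Lemma perm_map1 : perm_map 1 = 1.
Proof. by rewrite -gdelta1 perm_map_delta ?group1 // invg1 perm_diagram1 dalg_oneE idmE. Qed.

Lemma perm_mapM f g : f \in gspan K G -> g \in gspan K G -> perm_map (f * g) = perm_map f * perm_map g.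
Proof.
move=> fG gG.
have E h : h \in gspan K G -> h = \sum_(s in G) h s *: gdelta s by exact: gspanE.
have suml (F : {perm 'I_(size w)} -> galg K {perm 'I_(size w)}) :
  perm_map (\sum_(s in G) F s) = \sum_(s in G) perm_map (F s).
  rewrite /perm_map exchange_big; apply: eq_bigr => s _ /=.
  by rewrite -scaler_suml sum_ffunE.
rewrite (E f fG) mulr_suml !suml mulr_suml; apply: eq_bigr => s sG.
rewrite (E g gG) mulr_sumr !suml mulr_sumr; apply: eq_bigr => s' s'G.
rewrite -scalerAl -scalerAr gdeltaM !perm_mapZ !perm_map_delta ?groupM //.
rewrite -scalerAl -scalerAr; congr (_ *: (_ *: _)).
rewrite dalg_mulE compm_delta invMg; have [-> ->] := perm_diagram_comp (groupVr s'G) (groupVr sG).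
by rewrite expr0 scale1r.
Qed.

Lemma perm_map_star f : dstar t w (perm_map f) = perm_map (gstar f).
Proof.
rewrite linear_sum /perm_map (reindex_inj invg_inj) /=; apply: eq_big => s; first by rewrite groupV.
by rewrite groupV => sG; rewrite linearZ /= dstarE flipm_delta invgK flip_perm // gstarE.
Qed.

End PermMap.

Theorem good_decomposition w : has_good_decomposition w.
Proof.
have [n] := ubnP (size w); elim: n w => // n IHn w; rewrite ltnS => wn.
have IH w' : (size w' < size w)%N -> has_good_decomposition w'.
  by move=> lt; apply: IHn; apply: leq_trans wn.
have H0 (p : 'I_(size w) * 'I_(size w)) := cup_idempotents p.1 p.2 IH.
have [es esP] := fin_all_exists H0.
have [ps [ops ps1 psP]] := letter_perm_good (fun i : 'I_(size w) => is_up (letter i)) K.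
set G := letter_perm_Group _ _ in psP.
pose B (x : dalg t w) := exists2 f, f \in gspan K G & x = perm_map f.
apply: (good_decomposition_extend (@reg w) (@dstarM _ t w) (@dstarK _ t w)
   (es := flatten [seq es p | p <- enum {: 'I_(size w) * 'I_(size w)}]) (ps := [seq perm_map p | p <- ps]) (B := B)).
- by move=> e /flatten_mapP[p _]; case: (esP p) => H _; apply: H.
- rewrite /orthogonal_seq pairwise_map.
  have all_in : all (mem (gspan K G)) ps by apply/allP => p /psP[[]].
  apply: (sub_in_pairwise _ all_in ops) => p q pG qG /= /andP[/eqP pq /eqP qp].
  have z : perm_map (0 : galg K {perm 'I_(size w)}) = 0 :> dalg t w.
    by rewrite -(scale0r (0 : galg K _)) perm_mapZ scale0r.
  by rewrite -!perm_mapM // pq qp z eqxx.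
- by rewrite big_map -perm_map_sum ps1 perm_map1.
- move=> _ /mapP[p /psP[pp stp] ->]; have [pG ppE _ _] := pp.
  split; first by rewrite -perm_mapM // ppE.
    by rewrite perm_map_star stp.
  move=> _ [f fG ->]; have [k kE] := primitive_scalar (@gspanM K _ G) (@gspan_regular K _ G) pp fG.
  exists k; rewrite -perm_mapZ -kE !perm_mapM //; exact: gspanM.
(* b is the part of x supported on permutation diagrams; the rest of x consists of diagrams with a
   cup. *)
move=> x; pose b : dalg t w := \sum_(s in G) ((x : hom K w w) (perm_diagram s^-1%g) : K) *: (hdelta K (perm_diagram s^-1%g) : dalg t w).
exists b.
  exists (\sum_(s in G) ((x : hom K w w) (perm_diagram s^-1%g) : K) *: gdelta s).
    by apply: rpred_sum => s sG; apply/rpredZ/gspan_delta.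
  rewrite /b /perm_map; apply: eq_bigr => s sG; congr (_ *: _).
  rewrite sum_ffunE (bigD1 s) //= !ffunE eqxx big1 ?addr0 ?[_ *: _]mulr1 // => s' /andP[_ ss].
  by rewrite !ffunE eq_sym (negPf ss) [_ *: _]mulr0.
move=> h hA.
(* A diagram with a cup equals (sum of [es]) d, and h annihilates every member of [es]. *)
have hd (d : diagram w w) : (exists i j, d (inr i) = inr j) -> h * (hdelta K d : dalg t w) = 0.
  move=> [i [j dij]]; have [_ /(_ d dij) <-] := esP (i, j).
  rewrite mulr_suml mulr_sumr big_seq big1 // => e ee.
  rewrite mulrA -[h]mulr1 hA ?mul0r //.
  by apply/flatten_mapP; exists (i, j); rewrite ?mem_enum.
rewrite {1}[x](hdelta_sum (x : hom K w w)) mulr_sumr /b mulr_sumr.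
pose P : {set diagram w w} := [set perm_diagram s^-1%g | s in G].
rewrite (bigID (mem P)) /= [X in _ + X]big1 ?addr0 => [|d dP]; last first.
  rewrite -scalerAr hd ?scaler0 //; case: (perm_or_cup d) => // -[s sG ds].
  case/negP: dP; apply/imsetP; exists s^-1%g; rewrite ?groupV // invgK //.
rewrite big_imset //= => s s' sG s'G ss.
apply: invg_inj; have := congr1 (fun d : diagram w w => (d : {ffun _ -> _})) ss.
rewrite /= !perm_diagramE ?groupV // => /ffunP E; apply/permP => i.
by have := E (inl i); rewrite !ffunE => -[].
Qed.

End GoodDecomposition.

(** * Summands in the Karoubi envelope *)

Section FixedDiagrams.
Variable w : word.
Local Notation n := (size w).

Definition same_side (i j : 'I_n) : bool := is_up (letter i) == is_up (letter j).

(** In a diagram equal to its reflection, the position of the partner of a point does not depend on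
    its side, which gives an involution s of positions. The letters force the shape: i and [s i] are
    joined by crossing strands if their letters agree, by a cap and a cup otherwise. *)
Definition sym_fun (s : {perm 'I_n}) : {ffun points w w -> points w w} :=
  [ffun p => match p with
    | inl i => if same_side i (s i) then inr (s i) else inl (s i)
    | inr i => if same_side i (s i) then inl (s i) else inr (s i)
    end].

Definition sym_diagram (s : {perm 'I_n}) : diagram w w := insubd (id_diagram w) (sym_fun s).

Lemma sym_diagramE s : (s^-1 == s)%g -> sym_diagram s = sym_fun s :> {ffun _ -> _}.
Proof.
move=> /eqP ss; have sK i : s (s i) = i by rewrite -{1}ss permK.
have sC i j : same_side i j = same_side j i by rewrite /same_side eq_sym.
have yes i : same_side i (s i) -> sym_fun s (inl i) = inr (s i) /\ sym_fun s (inr i) = inl (s i).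
  by move=> E; rewrite !ffunE E.
have no i : ~~ same_side i (s i) -> sym_fun s (inl i) = inl (s i) /\ sym_fun s (inr i) = inr (s i).
  by move=> E; rewrite !ffunE (negPf E).
apply: insubdK; rewrite unfold_in; apply/forallP => p; rewrite orientableE.
have [i pE] : exists i, p = inl i \/ p = inr i by case: p => i; exists i; [left|right].
have [E|E] := boolP (same_side i (s i)).
  have E' : same_side (s i) (s (s i)) by rewrite sK sC.
  have [y1 y2] := yes _ E; have [y3 y4] := yes _ E'; move: E; rewrite /same_side => /eqP E.
  by case: pE => ->; rewrite ?y1 ?y2 ?y3 ?y4 sK eqxx /= E; case: is_up.
have E' : ~~ same_side (s i) (s (s i)) by rewrite sK sC.
have [y1 y2] := no _ E; have [y3 y4] := no _ E'; move: (E); rewrite /same_side => E1.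
have si : s i != i by apply: contraNneq E => ->; rewrite /same_side.
case: pE => ->; rewrite ?y1 ?y2 ?y3 ?y4 sK eqxx /= ?(inj_eq negb_inj) E1 andbT;
  by apply: contra si => /eqP[->].
Qed.

Definition position (p : points w w) : 'I_n := match p with inl i => i | inr i => i end.

Lemma card_flip_fixed : #|[set d : diagram w w | flip d == d]| = #|[set s : {perm 'I_n} | (s^-1 == s)%g]|.
Proof.
have pos_sym s : (s^-1 == s)%g -> forall i, position (sym_diagram s (inl i)) = s i.
  by move=> ss i; rewrite sym_diagramE // ffunE; case: ifP.
have inj : {in [set s : {perm 'I_n} | (s^-1 == s)%g] &, injective sym_diagram}.
  move=> s s'; rewrite !inE => ss ss' E; apply/permP => i.
  by rewrite -(pos_sym s ss) -(pos_sym s' ss') E.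
rewrite -(card_in_imset inj); congr #|pred_of_set _|; apply/setP => d; rewrite inE.
apply/eqP/imsetP => [fd|[s]]; last first.
  rewrite inE => ss ->; apply/val_inj/ffunP => p; rewrite /= flipE sym_diagramE // !ffunE.
  by case: p => i /=; case: ifP.
have dE p : d (flip_point p) = flip_point (d p) by rewrite -{2}fd flipE flip_pointK.
have flip_pos p : position (flip_point p) = position p by case: p.
pose f i := position (d (inl i)).
have pos_d p : position (d p) = f (position p).
  by case: p => i //=; rewrite -[inr i]/(flip_point (inl i)) dE flip_pos.
have fK : involutive f by move=> i; rewrite -pos_d diagramK.
pose s := perm (inv_inj fK).
have ss : (s^-1 == s)%g.
  by rewrite eq_invg_mul; apply/eqP/permP => i; rewrite permM !permE fK.
exists s; first by rewrite inE.
apply/val_inj/ffunP => p; rewrite /= sym_diagramE // ffunE.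
case: p => i; rewrite permE /same_side /f; [have := diagram_source d (inl i)|have := diagram_source d (inr i)].
  by case: (d (inl i)) => j /=; case: is_up; case: is_up.
rewrite -[inr i]/(flip_point (inl i)) dE.
by case: (d (inl i)) => j /=; case: is_up; case: is_up.
Qed.

End FixedDiagrams.

Section Karoubi.
Variables (K : numClosedFieldType) (t : K).

Lemma good_decomposition_size w (s : seq (dalg t w)) : generic t ->
  orthogonal_seq s -> \sum_(e <- s) e = 1 -> (forall e, e \in s -> primitive_in fullv e /\ dstar t w e = e) ->
  size s = #|[set x : {perm 'I_(size w)} | (x^-1 == x)%g]|.
Proof.
move=> gen os S1 sP; apply/eqP; rewrite -(eqr_nat K).
rewrite -(ltrace_star (dalg_regular (gen w)) (@dstarM _ t w) os S1 sP) -card_flip_fixed.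
have ev d : exists phi : 'Hom(dalg t w, K^o), forall x : dalg t w, phi x = (x : hom K w w) d.
  have lin : linear (fun x : dalg t w => (x : hom K w w) d : K^o) by move=> k f g; rewrite !ffunE.
  pose F : {linear dalg t w -> K^o} := HB.pack (fun x : dalg t w => (x : hom K w w) d : K^o)
     (GRing.isLinear.Build _ _ _ _ _ lin).
  by exists (linfun F) => x; rewrite lfunE.
have [phi phiE] := fin_all_exists ev; apply/eqP.
apply: (ltrace_permuted_basis (phi := phi) (delta := fun d => hdelta K d : dalg t w)) => [x|d d'|d].
- by rewrite {1}[x](hdelta_sum (x : hom K w w)); apply: eq_bigr => d _; rewrite phiE.
- by rewrite phiE ffunE.
by rewrite dstarE flipm_delta.
Qed.

Lemma amor_ext (I J : finType) (V : I -> word) (W : J -> word) (f g : amor K V W) :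
  (forall j i, f j i = g j i) -> f = g.
Proof.
move=> fg; apply: boolp.functional_extensionality_dep => j.
by apply: boolp.functional_extensionality_dep => i.
Qed.

Lemma acompA (I J L M : finType) (U : I -> word) (V : J -> word) (W : L -> word) (X : M -> word)
  (h : amor K W X) (g : amor K V W) (f : amor K U V) :
  acomp t h (acomp t g f) = acomp t (acomp t h g) f.
Proof.
apply: amor_ext => m i; rewrite /acomp.
under eq_bigr do rewrite compm_sumr.
rewrite exchange_big; apply: eq_bigr => j _ /=.
by rewrite compm_suml; apply: eq_bigr => l _; rewrite compmA.
Qed.

Lemma acomp0l (I J L : finType) (U : I -> word) (V : J -> word) (W : L -> word) (f : amor K U V) :
  acomp t ((fun _ _ => 0) : amor K V W) f = (fun _ _ => 0).
Proof. by apply: amor_ext => l i; rewrite /acomp big1 // => j _; rewrite compm0l. Qed.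

Lemma acomp0r (I J L : finType) (U : I -> word) (V : J -> word) (W : L -> word) (g : amor K V W) :
  acomp t g ((fun _ _ => 0) : amor K U V) = (fun _ _ => 0).
Proof. by apply: amor_ext => l i; rewrite /acomp big1 // => j _; rewrite compm0r. Qed.

Section OneWord.
Variable w : word.
Let V : unit -> word := fun _ => w.

Definition camor (x : dalg t w) : amor K V V := fun _ _ => x.

Lemma acomp_camor x y : acomp t (camor x) (camor y) = camor (x * y).
Proof. by apply: amor_ext => -[] []; rewrite /acomp (big_pred1 tt) => [|[]]. Qed.

Lemma camor_inj x y : camor x = camor y -> x = y.
Proof. by move=> /(congr1 (fun f : amor K V V => f tt tt)). Qed.

Lemma camorK (f : amor K V V) : camor (f tt tt) = f.
Proof. by apply: amor_ext => -[] []. Qed.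

Lemma acomp_mid (I J : finType) (U : I -> word) (W : J -> word) (p : amor K V W) (q : amor K U V) x y j i :
  acomp t p (acomp t (camor (x + y)) q) j i
  = acomp t p (acomp t (camor x) q) j i + acomp t p (acomp t (camor y) q) j i.
Proof.
rewrite /acomp -big_split; apply: eq_bigr => a _ /=.
by rewrite !(big_pred1 tt) => [|[]|[]|[]] //; rewrite compmDl compmDr.
Qed.

Definition idem_ob (e : dalg t w) (ee : acomp t (camor e) (camor e) = camor e) : kar_ob t :=
  @KarOb K t unit V (camor e) ee.

Lemma idem_obK e : e * e = e -> acomp t (camor e) (camor e) = camor e.
Proof. by move=> ee; rewrite acomp_camor ee. Qed.

(* The summands of (w, e) give orthogonal idempotents inc . prj of End(w) with sum e. *)
Lemma direct_sum_idempotents e ee m (Y : 'I_m -> kar_ob t) :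
  is_direct_sum (@idem_ob e ee) Y ->
  exists f : 'I_m -> dalg t w,
  [/\ forall k, f k * f k = f k, forall k l, k != l -> f k * f l = 0, \sum_k f k = e,
      forall k, f k = 0 -> kar_zero (Y k)
    & forall k, indecomposable (Y k) -> primitive_in fullv (f k)].
Proof.
case=> inc [prj [incP prjP pi pi0 ip]].
have kp k : acomp t (@kidem _ _ (Y k)) (prj k) = prj k.
  by rewrite -[prj k in LHS]prjP acompA kidemK prjP.
have ik k : acomp t (inc k) (@kidem _ _ (Y k)) = inc k.
  by rewrite -[inc k in LHS]incP -!acompA kidemK incP.
pose f k : dalg t w := acomp t (inc k) (prj k) tt tt.
have fE k : acomp t (inc k) (prj k) = camor (f k) by rewrite camorK.
have ff k : f k * f k = f k.
  by apply: camor_inj; rewrite -acomp_camor -fE -acompA (acompA (prj k)) pi kp.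
have kf k : f k = 0 -> kar_zero (Y k).
  move=> f0; rewrite /kar_zero -(@kidemK _ _ (Y k)) -pi -acompA (acompA (inc k)) fE f0.
  by rewrite (_ : camor 0 = fun _ _ => 0) // acomp0l acomp0r.
exists f; split=> //.
- move=> k l kl; apply: camor_inj; rewrite -acomp_camor -!fE -acompA (acompA (prj k)) pi0 //.
  by rewrite acomp0l acomp0r.
- by have := congr1 (fun g : amor K V V => g tt tt) ip.
move=> k [nz ind]; split; rewrite ?memvf ?ff //.
  by apply/eqP => /kf.
move=> g _ gg fg gf.
(* An idempotent g under f k splits f k into g and f k - g; [inc k] and [prj k] identify [Y k] with
   (w, f k), so [Y k] splits too, and indecomposability makes one part vanish. *)
pose h (l : 'I_2) : dalg t w := if l == ord0 then g else f k - g.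
have hh l : h l * h l = h l.
  by rewrite /h; case: ifP => // _; rewrite mulrBl !mulrBr ff fg gf gg subrr subr0.
have fh l : f k * h l = h l by rewrite /h; case: ifP => // _; rewrite mulrBr ff fg.
have hf l : h l * f k = h l by rewrite /h; case: ifP => // _; rewrite mulrBl ff gf.
have hl l l' : l != l' -> h l * h l' = 0.
  rewrite /h => ll'; have [l0|l0] := eqVneq l ord0; have [l'0|l'0] := eqVneq l' ord0.
  - by rewrite l0 l'0 eqxx in ll'.
  - by rewrite mulrBr gf gg subrr.
  - by rewrite mulrBl fg gg subrr.
  by move: l0 l'0 ll'; case: l => [[|[]]] //; case: l' => [[|[]]].
have pf x : f k * x = x -> acomp t (@kidem _ _ (Y k)) (acomp t (prj k) (camor x)) = acomp t (prj k) (camor x).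
  by move=> _; rewrite acompA kp.
have ds : is_direct_sum (Y k) (fun l => idem_ob (idem_obK (hh l))).
  exists (fun l => acomp t (prj k) (camor (h l))), (fun l => acomp t (camor (h l)) (inc k)); split.
  - by move=> l; rewrite /is_kar_mor /= -acompA acomp_camor hh pf.
  - by move=> l; rewrite /is_kar_mor /= -(acompA _ (inc k)) ik acompA acomp_camor hh.
  - by move=> l /=; rewrite -acompA (acompA (inc k)) fE !acomp_camor fh hh.
  - move=> l l' ll'; rewrite -acompA (acompA (inc k)) fE !acomp_camor fh hl //.
  apply: amor_ext => j i; rewrite big_ord_recl big_ord1 /=.
  have E l : acomp t (acomp t (prj k) (camor (h l))) (acomp t (camor (h l)) (inc k))
     = acomp t (prj k) (acomp t (camor (h l)) (inc k)).
    by rewrite -acompA (acompA (camor _)) acomp_camor hh.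
  rewrite !E -acomp_mid (_ : h ord0 + _ = f k); last by rewrite /h /= addrC subrK.
  by rewrite -fE -acompA pi ik pi.
have [l] := ind _ ds; rewrite /kar_zero /= => h0.
have {h0}: h l = 0 by have := congr1 (fun u : amor K V V => u tt tt) h0.
rewrite /h; case: ifP => _; first by left.
by move/eqP; rewrite subr_eq0 => /eqP; right.
Qed.

Lemma idem_ob_indecomposable e ee : primitive_in fullv e -> indecomposable (@idem_ob e ee).
Proof.
move=> [_ ee' e0 eP]; split.
  by move=> /(congr1 (fun u : amor K V V => u tt tt)) /= /eqP; rewrite (negPf e0).
move=> Y /direct_sum_idempotents[f [ff fl fs f0 _]].
have ef k : e * f k = f k.
  by rewrite -fs mulr_suml (bigD1 k) //= ff big1 ?addr0 // => l /fl.
have fe k : f k * e = f k.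
  by rewrite -fs mulr_sumr (bigD1 k) //= ff big1 ?addr0 // => l; rewrite eq_sym => /fl.
have [f00|f0e] := eP (f ord0) (memvf _) (ff _) (ef _) (fe _); first by exists ord0; apply: f0.
exists (lift ord0 ord0); apply: f0.
by move: fs; rewrite big_ord_recl big_ord1 f0e => /(canRL (addKr e)); rewrite addNr.
Qed.

Lemma kar_word_idem : kar_word t w = @idem_ob 1 (kar_word_subproof t w).
Proof. by []. Qed.

(** A decomposition of the object yields orthogonal primitive idempotents, whose number is unique.
    Conversely, each (w, e) is a summand with e as both inclusion and projection. *)
Lemma has_indec_summands_size (s : seq (dalg t w)) m : regular_in (fullv : {vspace dalg t w}) ->
  orthogonal_seq s -> \sum_(e <- s) e = 1 -> (forall e, e \in s -> primitive_in fullv e) ->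
  has_indec_summands (kar_word t w) m <-> m = size s.
Proof.
move=> reg os S1 sP; rewrite kar_word_idem; split=> [[Y [/direct_sum_idempotents[f [ff fl fs _ fP]] Yi]]|->].
  have -> : m = size [seq f k | k <- enum 'I_m] by rewrite size_map size_enum_ord.
  apply: (primitive_decomposition_size reg) => //.
  - rewrite /orthogonal_seq pairwise_map; apply: (sub_pairwise _ (_ : pairwise (fun k l : 'I_m => k != l) _)).
      by move=> k l kl /=; rewrite !fl ?eqxx // eq_sym.
    by rewrite -uniq_pairwise enum_uniq.
  - by rewrite big_map big_enum.
  by move=> _ /mapP[k _ ->]; apply/fP/Yi.
have ei k : (k < size s)%N -> primitive_in fullv s`_k by move=> ks; apply/sP/mem_nth.
have ek (k : 'I_(size s)) : s`_k * s`_k = s`_k by have [] := ei k (ltn_ord k).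
exists (fun k : 'I_(size s) => idem_ob (idem_obK (ek k))); split; last first.
  by move=> k; apply: idem_ob_indecomposable; apply: ei.
exists (fun k => camor s`_k), (fun k => camor s`_k); split.
- by move=> k; rewrite /is_kar_mor /= !acomp_camor mul1r ek.
- by move=> k; rewrite /is_kar_mor /= !acomp_camor mulr1 ek.
- by move=> k; rewrite /= acomp_camor ek.
- move=> k l kl; rewrite acomp_camor.
  have us : uniq s by apply: orthogonal_uniq => // h /sP[].
  by rewrite (orthogonal_neq os) ?mem_nth ?nth_uniq.
apply: amor_ext => -[] [].
rewrite -[RHS]S1 (big_nth 0) big_mkord; apply: eq_bigr => k _.
by rewrite acomp_camor ek.
Qed.

End OneWord.

Theorem b_involutions X n : generic t ->
  b t X n = #|[set s : {perm 'I_(size (tens_pow X n))} | (s^-1 == s)%g]|.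
Proof.
move=> gen; set w := tens_pow X n.
have [s [os S1 sP]] := good_decomposition gen w.
rewrite -(good_decomposition_size gen os S1 sP) /b -/w.
have H m := has_indec_summands_size m (dalg_regular (gen w)) os S1 (fun e h => (sP e h).1).
(* All admissible lengths equal [size s], and the default case is excluded because that length is
   admissible. *)
case: classical_sets.xgetP => [m _ /H //|/(_ (size s))].
by case; apply/H.
Qed.

End Karoubi.

From mathcomp Require Import lra.
From mathcomp Require Import complex.
From mathcomp Require Import all_classical all_reals all_analysis.

Import Order.TTheory GRing.Theory Num.Theory.
Import numFieldNormedType.Exports.

Local Open Scope ring_scope.
Local Open Scope classical_set_scope.

(** * Asymptotics of the number of involutions *)

Section ClosedForm.
Variable R : realType.
Local Notation inv := involution_number.

(** The number of involutions of m points with j transpositions, divided by m!; equivalently the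
    part of exp (x + x^2 / 2) of degree m and of order j in x^2 / 2. *)
Definition inv_term (m j : nat) : R :=
  if (j.*2 <= m)%N then ((2 ^ j * j`! * (m - j.*2)`!)%:R)^-1 else 0.

Lemma inv_termS0 m : m.+2%:R * inv_term m.+2 0 = inv_term m.+1 0.
Proof.
by rewrite /inv_term /= !subn0 !muln1 expn0 !mul1n [(m.+2)`!]factS natrM invfM mulrA divff ?mul1r //.
Qed.

Lemma inv_termS m j : m.+2%:R * inv_term m.+2 j.+1 = inv_term m.+1 j.+1 + inv_term m j.
Proof.
rewrite /inv_term doubleS !ltnS !subSS.
have [jm|mj] := leqP j.*2 m; last first.
  by rewrite leqNgt (leq_trans mj) ?mulr0 ?addr0.
have f0 k : (k`!)%:R != 0 :> R by rewrite pnatr_eq0 -lt0n fact_gt0.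
have p0 k : (2 ^ k)%:R != 0 :> R by rewrite pnatr_eq0 -lt0n expn_gt0.
have j0 : j.+1%:R != 0 :> R by rewrite pnatr_eq0.
have [lt|ge] := ltnP j.*2 m.
  have E : (m - j.*2 = (m - j.*2).-1.+1)%N by lia.
  have -> : (m - j.*2.+1 = (m - j.*2).-1)%N by lia.
  rewrite E /=; set q := (m - j.*2).-1.
  have -> : m.+2%:R = 2 * j.+1%:R + q.+1%:R :> R.
    by rewrite -natrM -natrD; congr _%:R; rewrite /q; lia.
  rewrite !factS expnS !natrM.
  have q0 : q.+1%:R != 0 :> R by rewrite pnatr_eq0.
  have := f0 q; have := f0 j; have := p0 j.
  move: (q`!%:R : R) (j`!%:R : R) ((2 ^ j)%:R : R) (q.+1%:R : R) (j.+1%:R : R) q0 j0 => a b c d e *.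
  by field; apply/and5P; split.
have E : m = j.*2 by apply/eqP; rewrite eqn_leq ge.
have -> : m.+2%:R = 2 * j.+1%:R :> R by rewrite -natrM; congr _%:R; lia.
rewrite E subnn fact0 !muln1 add0r !factS expnS !natrM.
have := f0 j; have := p0 j.
move: (j`!%:R : R) ((2 ^ j)%:R : R) (j.+1%:R : R) j0 => b c e *.
by field; apply/and3P; split.
Qed.

Lemma involution_number_sum N m : (m < N.*2)%N -> (inv m)%:R = m`!%:R * \sum_(j < N) inv_term m j.
Proof.
have [k] := ubnP m; elim: k m N => // k IH [|[|m]] [|N] // mk mN.
- rewrite big_ord_recl big1 => [|j _]; last by rewrite /inv_term.
  by rewrite /inv_term /= expn0 !fact0 invr1 mul1r addr0.
- rewrite big_ord_recl big1 => [|j _]; last by rewrite /inv_term.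
  by rewrite /inv_term /= expn0 !fact0 invr1 mul1r addr0.
rewrite involution_numberS natrD natrM (IH m.+1 N.+1); [|lia|lia].
rewrite (IH m N); [|lia|lia].
have E : m.+2%:R * \sum_(j < N.+1) inv_term m.+2 j
    = \sum_(j < N.+1) inv_term m.+1 j + \sum_(j < N) inv_term m j.
  rewrite mulr_sumr big_ord_recl inv_termS0 [in RHS]big_ord_recl -addrA -big_split /=.
  by congr (_ + _); apply: eq_bigr => j _; rewrite inv_termS.
rewrite [in RHS]factS natrM -[RHS]mulrA [RHS]mulrCA E mulrDr; congr (_ + _).
by rewrite factS natrM mulrA.
Qed.

Definition falling_ratio (n k : nat) : R := (n ^_ k)%:R / n%:R ^+ k.

Lemma involution_number_even n : (0 < n)%N ->
  (inv (2 * n))%:R = ((2 * n)`!)%:R / (2 ^+ n * n`!%:R) *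
     \sum_(k < n.+1) (2 * n%:R) ^+ k / (k.*2)`!%:R * falling_ratio n k :> R.
Proof.
move=> n0; rewrite (@involution_number_sum n.+1); last lia.
rewrite -mulrA; congr (_ * _); rewrite (reindex_inj rev_ord_inj) /= mulr_sumr; apply: eq_bigr => k _.
have kn : (k <= n)%N by rewrite -ltnS.
rewrite subSS /inv_term ifT; last lia.
have -> : (2 * n - (n - k).*2 = k.*2)%N by lia.
rewrite /falling_ratio -(ffact_fact kn) !natrM exprMn natrX.
have f0 j : (j`!)%:R != 0 :> R by rewrite pnatr_eq0 -lt0n fact_gt0.
have ff0 : (n ^_ k)%:R != 0 :> R by rewrite pnatr_eq0 -lt0n ffact_gt0.
have n0' : n%:R ^+ k != 0 :> R by rewrite expf_neq0 // pnatr_eq0 -lt0n.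
have E : 2 ^+ n = 2 ^+ k * 2 ^+ (n - k) :> R by rewrite -exprD subnKC.
have p0 j : 2 ^+ j != 0 :> R by rewrite expf_neq0.
rewrite E; have := f0 (n - k)%N; have := f0 k.*2; have := p0 k; have := p0 (n - k)%N.
move: (2 ^+ k : R) (2 ^+ (n - k) : R) (k.*2`!%:R : R) ((n-k)`!%:R : R) (n%:R ^+ k : R) ((n ^_ k)%:R : R) n0' ff0.
move=> *; field; by do 5?[apply/andP; split].
Qed.

(** The quotients q(n) = I(n + 1) / I(n) satisfy q(n + 1) = 1 + (n + 1) / q(n). This map is
    decreasing, so each bound yields the other at the next step. *)
Lemma involution_ratio n :
  Num.sqrt n.+1%:R * (inv n)%:R <= (inv n.+1)%:R :> R /\
  (inv n.+1)%:R <= (1 + Num.sqrt n.+1%:R) * (inv n)%:R :> R.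
Proof.
elim: n => [|n [IH1 IH2]]; first by rewrite sqrtr1 /involution_number /=; split; lra.
rewrite involution_numberS natrD natrM.
set y : R := Num.sqrt n.+1%:R in IH1 IH2 *; set z : R := Num.sqrt n.+2%:R.
have y0 : 0 < y by rewrite sqrtr_gt0 ltr0n.
have yy : y ^+ 2 = n.+1%:R by rewrite sqr_sqrtr // ler0n.
have z0 : 0 <= z by rewrite sqrtr_ge0.
have zz : z ^+ 2 = y ^+ 2 + 1 by rewrite yy sqr_sqrtr ?ler0n // -natr1.
have yz : y <= z by rewrite ler_sqrt ?ler0n // ler_nat.
have a0 : 0 <= (inv n)%:R :> R by rewrite ler0n.
have b0 : 0 <= (inv n.+1)%:R :> R by rewrite ler0n.
rewrite -yy; move: (inv n)%:R (inv n.+1)%:R a0 b0 IH1 IH2 => a b a0 b0 IH1 IH2; split; last first.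
  have : y ^+ 2 * a <= y * b by rewrite expr2 -mulrA ler_pM2l.
  have : y * b <= z * b by rewrite ler_wpM2r.
  lra.
(* The bound q <= 1 + y gives 1 + y^2 / (1 + y) for the next quotient; the claim is that this is at
   least z = sqrt (y^2 + 1). *)
have zb : z * (1 + y) <= 1 + y + y ^+ 2.
  rewrite -ler_sqr ?nnegrE; [|by rewrite mulr_ge0 //; lra|nra].
  rewrite exprMn zz; nra.
have : z * b * (1 + y) <= (b + y ^+ 2 * a) * (1 + y).
  have : y ^+ 2 * b <= y ^+ 2 * ((1 + y) * a) by rewrite ler_wpM2l // sqr_ge0.
  have : z * (1 + y) * b <= (1 + y + y ^+ 2) * b by rewrite ler_wpM2r.
  lra.
by rewrite ler_pM2r //; lra.
Qed.

Lemma involution_number_bounds n :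
  Num.sqrt n`!%:R <= (inv n)%:R :> R /\
  (inv n)%:R <= Num.sqrt n`!%:R * expR (2 * Num.sqrt n%:R) :> R.
Proof.
elim: n => [|n [IH1 IH2]]; first by rewrite sqrtr0 mulr0 expR0 sqrtr1 mulr1.
have [r1 r2] := involution_ratio n.
rewrite factS natrM sqrtrM ?ler0n //; split.
  by apply: le_trans r1; rewrite ler_wpM2l // sqrtr_ge0.
apply: le_trans r2 _.
set z : R := Num.sqrt n.+1%:R; set y : R := Num.sqrt n%:R in IH2 *.
have z0 : 0 < z by rewrite sqrtr_gt0 ltr0n.
have y0 : 0 <= y by rewrite sqrtr_ge0.
have zz : z ^+ 2 = y ^+ 2 + 1 by rewrite !sqr_sqrtr ?ler0n // -natr1.
have yz : y <= z by rewrite ler_sqrt ?ler0n // ler_nat.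
(* From (z - y) (z + y) = 1 and y <= z follows 2 (z - y) >= 1 / z; this is where the factor 2 in the
   exponent comes from. *)
have E : 1 + z <= z * expR (2 * z - 2 * y).
  apply: (@le_trans _ _ (z * (1 + z^-1))); first by rewrite mulrDr mulr1 divff ?gt_eqF // addrC.
  rewrite ler_pM2l //; apply: le_trans (expR_ge1Dx _); rewrite lerD2l.
  by rewrite -[z^-1]mul1r ler_pdivrMr //; have := sqr_ge0 (z - y); nra.
apply: le_trans (_ : (1 + z) * (Num.sqrt n`!%:R * expR (2 * y)) <= _).
  by rewrite ler_wpM2l //; lra.
have -> : z * Num.sqrt n`!%:R * expR (2 * z) = (z * expR (2 * z - 2 * y)) * (Num.sqrt n`!%:R * expR (2 * y)).
  by rewrite mulrACA -expRD subrK.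
by rewrite ler_wpM2r // mulr_ge0 ?sqrtr_ge0 ?expR_ge0.
Qed.

End ClosedForm.

(** * Stirling's formula with an undetermined constant *)

Section Stirling.
Variable R : realType.

Lemma ge0_of_derive (f df : R -> R) (x : R) : 0 <= x -> f 0 = 0 ->
  (forall y : R, 0 <= y -> is_derive y 1 f (df y)) -> (forall y, 0 <= y -> 0 <= df y) -> 0 <= f x.
Proof.
rewrite le_eqVlt => /predU1P[<- ->//|x0] f0 fd df0.
have [y||c /andP[c0 _]] := @MVT R f df 0 x x0.
- by rewrite in_itv /= => /andP[/ltW y0 _]; exact: fd.
- apply: derivable_within_continuous => y; rewrite in_itv /= => /andP[y0 _].
  by have [] := fd y y0.
rewrite f0 !subr0 => ->; move: c0 => /ltW c0.
by rewrite mulr_ge0 ?df0 // ltW.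
Qed.

Lemma is_derive_ln1D (x : R) : 0 <= x -> is_derive x 1 (fun y : R => ln (1 + y)) (1 + x)^-1.
Proof.
move=> x0; have x1 : 0 < 1 + x by lra.
have d1 : is_derive (1 + x) 1 (@ln R) (1 + x)^-1 by exact: is_derive1_ln.
have d2 : is_derive x 1 (fun y : R => 1 + y) (0 + 1) by apply: is_deriveD.
have := is_derive1_comp d1 d2; rewrite add0r mulr1.
exact.
Qed.

Lemma ln1D_ge (x : R) : 0 <= x -> x / (1 + x) <= ln (1 + x).
Proof.
move=> x0; have x1 : 0 < 1 + x by lra.
have := @le_ln1Dx R ((1 + x)^-1 - 1); rewrite (_ : 1 + ((1 + x)^-1 - 1) = (1 + x)^-1); last by rewrite addrC subrK.
rewrite lnV ?posrE // => H.
have -> : x / (1 + x) = 1 - (1 + x)^-1 by field; lra.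
have H1 : -1 < (1 + x)^-1 - 1 by rewrite ltrBrDl subrr invr_gt0.
by have := H H1; lra.
Qed.

(** At x = 1 / n this reads (n + 1/2) ln (1 + 1/n) >= 1, the monotonicity of [stirling_log]. *)
Lemma ln1D_lower (x : R) : 0 <= x -> 2 * x <= (2 + x) * ln (1 + x).
Proof.
move=> x0; rewrite -subr_ge0.
apply: (@ge0_of_derive (fun y => (2 + y) * ln (1 + y) - 2 * y)
  (fun y => ln (1 + y) - y / (1 + y))) => //.
- by rewrite !addr0 ln1 !mulr0 subr0.
- move=> y y0; have d := is_derive_ln1D y0.
  have y1 : 1 + y != 0 by rewrite gt_eqF //; lra.
  have d2 : is_derive y 1 (fun y : R => 2 + y) (0 + 1) by apply: is_deriveD.
  have := is_deriveB (is_deriveM d2 d) (is_deriveM (is_derive_cst (2 : R) y 1) (is_derive_id y (1 : R))).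
  move=> H; apply: (is_derive_eq (f' := _) H).
  rewrite /GRing.scale /=; field.
  done.
by move=> y y0; rewrite subr_ge0 ln1D_ge.
Qed.

(** Chosen so that at x = 1 / n the decrement of [stirling_log] is bounded by a telescoping term. *)
Lemma ln1D_upper (x : R) : 0 <= x -> 2 * (1 + x) * ln (1 + x) <= x * (2 + x).
Proof.
move=> x0; rewrite -subr_ge0.
apply: (@ge0_of_derive (fun y => y * (2 + y) - 2 * (1 + y) * ln (1 + y))
  (fun y => 2 * (y - ln (1 + y)))) => //.
- by rewrite !addr0 ln1 mulr0 mul0r subr0.
- move=> y y0; have d := is_derive_ln1D y0.
  have y1 : 1 + y != 0 by rewrite gt_eqF //; lra.
  have d1 c : is_derive y 1 (fun y : R => c + y) (0 + 1) by apply: is_deriveD.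
  have H := is_deriveB (is_deriveM (is_derive_id y (1 : R)) (d1 2))
    (is_deriveM (is_deriveM (is_derive_cst (2 : R) y 1) (d1 1)) d).
  apply: (is_derive_eq (f' := _) H).
  rewrite /GRing.scale /= [(cst 2 * _) y]/(2 * (1 + y)); rewrite !add0r !mulr1 !mulr0 addr0 mulfK //. ring.
by move=> y y0; rewrite mulr_ge0 // subr_ge0 le_ln1Dx //; lra.
Qed.

(** The logarithm of n! / (n^(n + 1/2) e^(-n)). *)
Definition stirling_log (n : nat) : R := ln n`!%:R - (n%:R + 2^-1) * ln n%:R + n%:R.

Lemma stirling_log_step n : (0 < n)%N ->
  0 <= stirling_log n - stirling_log n.+1 <= 4^-1 * (n%:R^-1 - n.+1%:R^-1).
Proof.
move=> n0; have N0 : 0 < n%:R :> R by rewrite ltr0n.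
have N1 : 0 < n.+1%:R :> R by rewrite ltr0n.
have f0 : 0 < n`!%:R :> R by rewrite ltr0n fact_gt0.
set x : R := n%:R^-1; have x0 : 0 < x by rewrite invr_gt0.
have E1 : n.+1%:R = n%:R * (1 + x) :> R by rewrite mulrDr mulr1 divff ?gt_eqF // natr1.
have lnE : ln n.+1%:R = ln n%:R + ln (1 + x) :> R by rewrite E1 lnM ?posrE //; lra.
have E : stirling_log n - stirling_log n.+1 = (n%:R + 2^-1) * ln (1 + x) - 1.
  rewrite /stirling_log factS natrM lnM ?posrE // lnE -natr1; lra.
have Nx : n%:R * x = 1 by rewrite divff ?gt_eqF.
rewrite E; apply/andP; split.
  have := ln1D_lower (ltW x0).
  rewrite -(ler_pM2l N0) [n%:R * (2 * x)]mulrCA Nx mulr1 mulrA mulrDr Nx; lra.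
have := ln1D_upper (ltW x0); set L := ln _ => H.
have E2 : n.+1%:R^-1 = x / (1 + x) :> R by rewrite E1 invfM.
rewrite E2; have x1 : 0 < 1 + x by lra.
have : (n%:R + 2^-1) * (2 * (1 + x) * L) <= (n%:R + 2^-1) * (x * (2 + x)) by rewrite ler_wpM2l //; lra.
have -> : (n%:R + 2^-1) * (x * (2 + x)) = 2 + 2 * x + 2^-1 * (x * x).
  have -> : (n%:R + 2^-1) * (x * (2 + x)) = n%:R * x * (2 + x) + 2^-1 * (x * (2 + x)) by ring.
  by rewrite Nx; lra.
have -> : 4^-1 * (x - x / (1 + x)) = 4^-1 * (x * x) / (1 + x) by field; lra.
rewrite ler_pdivlMr // => H2.
rewrite mulrBl mul1r; lra.
Qed.

Lemma stirling_log_cvg : exists l : R, stirling_log n @[n --> \oo] --> l.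
Proof.
have ni : nonincreasing_seq (fun n => stirling_log n.+1).
  apply/nonincreasing_seqP => n; have /andP[] := @stirling_log_step n.+1 isT.
  by rewrite subr_ge0.
have lb n : stirling_log 1 - 4^-1 * (1 - n.+1%:R^-1) <= stirling_log n.+1.
  elim: n => [|n IH]; first by rewrite invr1 subrr mulr0 subr0.
  have /andP[_] := @stirling_log_step n.+1 isT; move: IH.
  move: (n.+1%:R^-1 : R) (n.+2%:R^-1 : R) (stirling_log _) (stirling_log _) (stirling_log _).
  by move=> *; lra.
exists (lim (stirling_log n.+1 @[n --> \oo])); rewrite -cvg_shiftS /=.
apply: nonincreasing_is_cvgn => //; exists (stirling_log 1 - 4^-1) => _ [n _ <-].
apply: le_trans (lb n); have : 0 <= n.+1%:R^-1 :> R by rewrite invr_ge0.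
move: (n.+1%:R^-1 : R) => *; lra.
Qed.

End Stirling.

(** * Concentration of the exponential series around its mean *)

Section Concentration.
Variable R : realType.

Definition exp_term (s : R) (j : nat) : R := s ^+ j / j`!%:R.

Lemma exp_term_ge0 s j : 0 <= s -> 0 <= exp_term s j.
Proof. by move=> s0; rewrite divr_ge0 ?exprn_ge0 // ler0n. Qed.

Lemma exp_sum_cvg (s : R) : (fun n => \sum_(j < n) exp_term s j) @ \oo --> expR s.
Proof.
have -> : (fun n => \sum_(j < n) exp_term s j) = series (exp_coeff s).
  by apply/funext => n; rewrite /series /= big_mkord.
exact: is_cvg_series_exp_coeff.
Qed.

Lemma exp_sum_le s n : 0 <= s -> \sum_(j < n) exp_term s j <= expR s.
Proof.
move=> s0; have nd : nondecreasing_seq (fun n => \sum_(j < n) exp_term s j).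
  by apply/nondecreasing_seqP => m; rewrite big_ord_recr /= lerDl exp_term_ge0.
have := nondecreasing_cvgn_le nd (cvgP _ (@exp_sum_cvg s)) n.
by rewrite (cvg_lim _ (@exp_sum_cvg s)).
Qed.

Definition cosh (s : R) : R := (expR s + expR (- s)) / 2.

Lemma even_sum_split (s : R) n :
  \sum_(k < n) exp_term s k.*2 = (\sum_(j < n.*2) exp_term s j + \sum_(j < n.*2) exp_term (- s) j) / 2.
Proof.
elim: n => [|n IH]; first by rewrite !big_ord0 addr0 mul0r.
have e1 : exp_term (- s) n.*2 = exp_term s n.*2.
  by rewrite /exp_term exprNn -signr_odd odd_double expr0 mul1r.
have e2 : exp_term (- s) n.*2.+1 = - exp_term s n.*2.+1.
  by rewrite /exp_term exprNn -signr_odd /= odd_double expr1 mulN1r mulNr.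
rewrite doubleS !big_ord_recr /= IH e1 e2; lra.
Qed.

Lemma even_sum_cvg (s : R) : (fun n => \sum_(k < n) exp_term s k.*2) @ \oo --> cosh s.
Proof.
rewrite (funext (even_sum_split s)).
have dbl : double @ \oo --> \oo.
  by apply/cvgnyPge => A; near=> n; rewrite -addnn (leq_trans _ (leq_addr _ _)) //; near: n; exact: nbhs_infty_ge.
have c r := cvg_comp _ _ dbl (@exp_sum_cvg r).
by apply: cvgMr_tmp; apply: cvgD; exact: c.
Unshelve. all: by end_near.
Qed.

(* Second moment of a Poisson variable around its mean, truncated. *)
Lemma exp_second_moment (s : R) N :
  \sum_(j < N.+1) (j%:R - s) ^+ 2 * exp_term s j =
  s * \sum_(j < N.+1) exp_term s j + s ^+ N.+1 / N`!%:R * (s - N.+1%:R).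
Proof.
pose E n := \sum_(j < n) exp_term s j.
rewrite -/(E _); elim: N => [|N IH].
  by rewrite /E !big_ord1 /= /exp_term expr0 fact0 invr1 expr1; ring.
have ES : E N.+2 = E N.+1 + exp_term s N.+1 by rewrite /E big_ord_recr.
rewrite big_ord_recr /= IH ES /exp_term factS natrM.
have f0 : N`!%:R != 0 :> R by rewrite pnatr_eq0 -lt0n fact_gt0.
have n0 : N.+1%:R != 0 :> R by rewrite pnatr_eq0.
rewrite !exprS -[N.+2%:R]natr1.
move: (N`!%:R : R) (N.+1%:R : R) (s ^+ N) (E N.+1) f0 n0 => a b c d a0 b0.
by field; rewrite a0 b0.
Qed.

Lemma exp_second_moment_le (s : R) N : 0 <= s ->
  \sum_(j < N) (j%:R - s) ^+ 2 * exp_term s j <= s * expR s.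
Proof.
(* The sum is extended beyond s, where the boundary term of [exp_second_moment] is not positive. *)
move=> s0; pose M := (N + Num.Def.truncn s)%N.
have t0 j : 0 <= (j%:R - s) ^+ 2 * exp_term s j by rewrite mulr_ge0 ?sqr_ge0 ?exp_term_ge0.
have sM : s <= M.+1%:R.
  by rewrite ltW // (lt_le_trans (truncnS_gt s)) // ler_nat ltnS /M leq_addl.
apply: (@le_trans _ _ (\sum_(j < M.+1) (j%:R - s) ^+ 2 * exp_term s j)).
  rewrite -(subnKC (_ : (N <= M.+1)%N)); last by rewrite leqW // leq_addr.
  by rewrite big_split_ord /= lerDl sumr_ge0.
rewrite exp_second_moment.
apply: (@le_trans _ _ (s * \sum_(j < M.+1) exp_term s j)); last by rewrite ler_wpM2l // exp_sum_le.
by rewrite gerDl mulr_ge0_le0 ?subr_le0 // divr_ge0 ?exprn_ge0 // ler0n.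
Qed.

Definition far (s d : R) (k : nat) : bool := d * s < `|k.*2%:R - s|.

(** Chebyshev's inequality for the Poisson weights of mean s, restricted to even indices. *)
Lemma far_sum_le (s d : R) n : 0 < s -> 0 < d ->
  \sum_(k < n) (far s d k)%:R * exp_term s k.*2 <= expR s / (d ^+ 2 * s).
Proof.
move=> s0 d0; have ds0 : 0 < (d * s) ^+ 2 by rewrite exprn_gt0 // mulr_gt0.
have -> : expR s / (d ^+ 2 * s) = (s * expR s) / (d * s) ^+ 2 by field; rewrite !gt_eqF.
rewrite ler_pdivlMr //; apply: le_trans (exp_second_moment_le n.*2 (ltW s0)).
have t0 j : 0 <= (j%:R - s) ^+ 2 * exp_term s j by rewrite mulr_ge0 ?sqr_ge0 ?exp_term_ge0 // ltW.
elim: n => [|n IH]; first by rewrite !big_ord0 mul0r.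
rewrite doubleS !big_ord_recr /= mulrDl -addrA lerD // -[X in X <= _]addr0 lerD //.
rewrite mulrAC ler_wpM2r ?exp_term_ge0 ?(ltW s0) //.
rewrite /far; case: ltP => [lt|_]; last by rewrite mul0r sqr_ge0.
rewrite mul1r -[X in _ <= X]real_normK ?num_real // ler_sqr ?nnegrE ?mulr_ge0 ?(ltW d0) ?(ltW s0) //.
exact: ltW.
Qed.

End Concentration.

(** * Two-sided bounds for the weighted sum *)

Section Laplace.
Variable R : realType.
Local Notation phi := (@falling_ratio R).

Lemma falling_ratio0 n : phi n 0 = 1.
Proof. by rewrite /falling_ratio ffactn0 expr0 divr1. Qed.

Lemma falling_ratioS n k : (0 < n)%N -> (k <= n)%N -> phi n k.+1 = phi n k * (1 - k%:R / n%:R).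
Proof.
move=> n0 kn; rewrite /falling_ratio ffactnSr natrM natrB // exprSr.
have N0 : n%:R != 0 :> R by rewrite pnatr_eq0 -lt0n.
have P0 : n%:R ^+ k != 0 :> R by rewrite expf_neq0.
by field; rewrite N0 P0.
Qed.

Lemma falling_ratio_ge0 n k : 0 <= phi n k.
Proof. by rewrite divr_ge0 ?exprn_ge0 // ler0n. Qed.

Lemma falling_ratio_upper n k : (0 < n)%N -> (k <= n)%N ->
  phi n k <= expR (- (k%:R * (k%:R - 1) / (2 * n%:R))).
Proof.
move=> n0; have N0 : 0 < n%:R :> R by rewrite ltr0n.
elim: k => [|k IH] kn; first by rewrite falling_ratio0 !mul0r oppr0 expR0.
rewrite falling_ratioS //; last exact: ltnW.
have -> : - (k.+1%:R * (k.+1%:R - 1) / (2 * n%:R)) =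
   - (k%:R * (k%:R - 1) / (2 * n%:R)) + - (k%:R / n%:R) :> R.
  by rewrite -natr1; field; rewrite gt_eqF.
rewrite expRD; apply: ler_pM; [exact: falling_ratio_ge0| |exact/IH/ltnW|].
- by rewrite subr_ge0 ler_pdivrMr // mul1r ler_nat ltnW.
by have := @expR_ge1Dx R (- (k%:R / n%:R)).
Qed.

Lemma falling_ratio_le1 n k : (0 < n)%N -> (k <= n)%N -> phi n k <= 1.
Proof.
move=> n0 kn; apply: le_trans (falling_ratio_upper n0 kn) _.
have k0 : 0 <= k%:R * (k%:R - 1) :> R.
  by case: k {kn} => [|k]; rewrite ?mul0r // mulr_ge0 ?ler0n // subr_ge0 ler1n.
by rewrite expR_le1 oppr_le0 divr_ge0 // mulr_ge0 ?ler0n.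
Qed.

Lemma expR_le_1B (x m : R) : 0 <= x -> x <= m -> m < 1 -> expR (- (x / (1 - m))) <= 1 - x.
Proof.
move=> x0 xm m1; have p1 : 0 < 1 - m by lra.
have p2 : 0 < 1 - x by lra.
rewrite expRN -[leRHS]invrK lef_pV2 ?posrE ?expR_gt0 ?invr_gt0 //.
apply: le_trans (expR_ge1Dx _).
have -> : (1 - x)^-1 = 1 + x / (1 - x) by field; lra.
by rewrite lerD2l ler_wpM2l // lef_pV2 ?posrE //; lra.
Qed.

Lemma falling_ratio_lower n k (m : R) : (0 < n)%N -> (k <= n)%N -> k%:R / n%:R <= m -> m < 1 ->
  expR (- (k%:R * (k%:R - 1) / (2 * n%:R) / (1 - m))) <= phi n k.
Proof.
move=> n0; have N0 : 0 < n%:R :> R by rewrite ltr0n.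
elim: k => [|k IH] kn km m1; first by rewrite falling_ratio0 !mul0r oppr0 expR0.
have km' : k%:R / n%:R <= m.
  by apply: le_trans km; rewrite ler_pM2r ?invr_gt0 // ler_nat.
rewrite falling_ratioS //; last exact: ltnW.
have -> : - (k.+1%:R * (k.+1%:R - 1) / (2 * n%:R) / (1 - m)) =
   - (k%:R * (k%:R - 1) / (2 * n%:R) / (1 - m)) + - (k%:R / n%:R / (1 - m)) :> R.
  by rewrite -natr1; field; rewrite gt_eqF //; lra.
rewrite expRD; apply: ler_pM; rewrite ?expR_ge0 //.
  by apply: IH => //; exact: ltnW.
by apply: expR_le_1B => //; rewrite divr_ge0 ?ler0n.
Qed.

Definition weighted_sum n : R := \sum_(k < n.+1) (2 * n%:R) ^+ k / (k.*2)`!%:R * phi n k.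

Section Bounds.
Variables (n : nat) (s d : R).
Hypotheses (sn : s ^+ 2 = 2 * n%:R) (s4 : 4 <= s) (d0 : 0 < d) (d1 : d < 1).

Let N0 : 0 < n%:R :> R.
Proof. have : 4 * 4 <= s ^+ 2 by rewrite expr2 ler_pM. by rewrite sn => ?; lra. Qed.

Let n0 : (0 < n)%N. Proof. by move: N0; rewrite ltr0n. Qed.

Let termE k : (2 * n%:R) ^+ k / (k.*2)`!%:R = exp_term s k.*2.
Proof. by rewrite /exp_term -sn -exprM mul2n. Qed.

Let t0 k : 0 <= exp_term s k.
Proof. by apply: exp_term_ge0; apply: le_trans s4. Qed.

Let near_bounds k : ~~ far s d k -> (1 - d) * s / 2 <= k%:R /\ k%:R <= (1 + d) * s / 2.
Proof.
rewrite /far -leNgt -mul2n natrM ler_norml => /andP[]; lra.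
Qed.

Let B := expR s / (d ^+ 2 * s).

(** For k near s / 2, k (k - 1) / s^2 is at least (1 - d)^2 / 4 - (1 + d) / (2 s). For the far k the
    ratio is at most 1, and Chebyshev bounds their weight by [B]. *)
Lemma weighted_sum_upper :
  weighted_sum n <= expR (- ((1 - d) ^+ 2 / 4) + (1 + d) / (2 * s)) * cosh s + B.
Proof.
have [s4' [d0' d1']] := conj s4 (conj d0 d1).
set U := expR _; have U0 : 0 <= U by exact: expR_ge0.
have s0 : 0 < s by lra.
apply: (@le_trans _ _ (\sum_(k < n.+1) (U * exp_term s k.*2 + (far s d k)%:R * exp_term s k.*2))).
  apply: ler_sum => k _; rewrite termE -mulrDl mulrC ler_wpM2r //.
  have kn : (k <= n)%N by rewrite -ltnS.
  case: (boolP (far s d k)) => [_|nf].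
    by rewrite (le_trans (falling_ratio_le1 n0 kn)) // lerDr.
  rewrite addr0; apply: le_trans (falling_ratio_upper n0 kn) _.
  have [b1 b2] := near_bounds nf.
  rewrite ler_expR -sn -[X in X <= _]mulNr ler_pdivrMr ?exprn_gt0 //.
  have -> : (- ((1 - d) ^+ 2 / 4) + (1 + d) / (2 * s)) * s ^+ 2
     = - ((1 - d) * s / 2) ^+ 2 + (1 + d) * s / 2 by field; rewrite gt_eqF.
  have : ((1 - d) * s / 2) ^+ 2 <= k%:R ^+ 2.
    rewrite ler_sqr ?nnegrE ?ler0n //; rewrite divr_ge0 // mulr_ge0 //; lra.
  rewrite expr2 [k%:R ^+ 2]expr2; lra.
rewrite big_split /= -mulr_sumr lerD ?far_sum_le // ler_wpM2l //.
have nd : nondecreasing_seq (fun m => \sum_(k < m) exp_term s k.*2).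
  by apply/nondecreasing_seqP => m; rewrite big_ord_recr /= lerDl.
have := nondecreasing_cvgn_le nd (cvgP _ (@even_sum_cvg R s)) n.+1.
by rewrite (cvg_lim _ (@even_sum_cvg R s)).
Qed.

Lemma weighted_sum_lower :
  expR (- ((1 + d) ^+ 2 / 4 / (1 - 2 / s))) * (cosh s - B) <= weighted_sum n.
Proof.
have [s4' [d0' d1']] := conj s4 (conj d0 d1).
set L := expR _; have L0 : 0 <= L by exact: expR_ge0.
have s0 : 0 < s by lra.
have nE : n%:R = s ^+ 2 / 2 :> R by rewrite sn; field.
have ms : 2 / s <= 2^-1 by rewrite ler_pdivrMr //; lra.
have near_n k : ~~ far s d k -> (k <= n)%N.
  move=> /near_bounds[_ b2]; rewrite -(ler_nat R) nE.
  have : (1 + d) * s <= 2 * s by rewrite ler_wpM2r //; lra.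
  have : 4 * s <= s * s by rewrite ler_wpM2r //; lra.
  rewrite expr2; lra.
have near k : ~~ far s d k -> L <= phi n k.
  move=> nf; have kn := near_n k nf; have [b1 b2] := near_bounds nf.
  have ks : k%:R <= s.
    have : (1 + d) * s <= 2 * s by rewrite ler_wpM2r //; lra.
    lra.
  (* The value m = 2 / s is valid because k <= s and n = s^2 / 2. *)
  apply: le_trans (falling_ratio_lower (m := 2 / s) n0 kn _ _); last 2 first.
  - rewrite nE ler_pdivrMr ?divr_gt0 ?exprn_gt0 //.
    by rewrite (_ : 2 / s * (s ^+ 2 / 2) = s) //; field; rewrite gt_eqF.
  - lra.
  rewrite ler_expR lerN2 ler_pM2r ?invr_gt0; last lra.
  rewrite -sn ler_pdivrMr ?exprn_gt0 //.
  have -> : (1 + d) ^+ 2 / 4 * s ^+ 2 = ((1 + d) * s / 2) ^+ 2 by field.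
  have : k%:R ^+ 2 <= ((1 + d) * s / 2) ^+ 2.
    by rewrite ler_sqr ?nnegrE ?ler0n // divr_ge0 // mulr_ge0 //; lra.
  have : 0 <= k%:R :> R by rewrite ler0n.
  rewrite [k%:R ^+ 2]expr2; lra.
(* M is free so that the bound passes to the limit [cosh s]; the added indices beyond n are all far
   and their terms cancel. *)
have main M : (n.+1 <= M)%N -> L * (\sum_(k < M) exp_term s k.*2 - B) <= weighted_sum n.
  move=> nM; apply: (@le_trans _ _ (L * \sum_(k < M) (exp_term s k.*2 - (far s d k)%:R * exp_term s k.*2))).
    by rewrite ler_wpM2l // sumrB lerB // far_sum_le.
  rewrite -(subnKC nM) big_split_ord /= [X in _ + X]big1 => [|k _]; last first.
    have -> : far s d (n.+1 + k) = true.
      by apply: contraT => /near_n; rewrite leqNgt addSn ltnS leq_addr.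
    by rewrite mul1r subrr.
  rewrite addr0 mulr_sumr; apply: ler_sum => k _; rewrite termE.
  case: (boolP (far s d k)) => [_|nf]; first by rewrite mul1r subrr mulr0 mulr_ge0 ?falling_ratio_ge0.
  by rewrite mul0r subr0 mulrC ler_wpM2l // near.
have c : (fun M => L * (\sum_(k < M) exp_term s k.*2 - B)) @ \oo --> L * (cosh s - B).
  apply: cvgMl_tmp; apply: cvgB; [exact: even_sum_cvg|exact: cvg_cst].
by apply: (cvgr_to_le c); near=> M; apply: main; near: M; exact: nbhs_infty_ge.
Unshelve. all: by end_near.
Qed.

End Bounds.
End Laplace.

Section Limit.
Variable R : realType.

(** The bounds divided by e^s, with d tied to s by d^4 = 1/s: then d tends to 0 and so does the
    Chebyshev error 1 / (d^2 s) = d^2. *)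
Definition upper_limit (d : R) :=
  expR (- ((1 - d) ^+ 2 / 4) + (1 + d) * d ^+ 4 / 2) * ((1 + d ^+ 4) / 2) + d ^+ 2.

Definition lower_limit (d : R) :=
  expR (- ((1 + d) ^+ 2 / 4 / (1 - 2 * d ^+ 4))) * (2^-1 - d ^+ 2).

Lemma weighted_sum_squeeze n (d s : R) : s ^+ 2 = 2 * n%:R -> 4 <= s ->
  0 < d -> d < 1 -> d ^+ 4 = s^-1 ->
  lower_limit d <= weighted_sum R n / expR s <= upper_limit d.
Proof.
move=> sn s4 d0 d1 ds; have s0 : 0 < s by lra.
have e0 := expR_gt0 s.
have dB : expR s / (d ^+ 2 * s) = d ^+ 2 * expR s.
  have -> : s = (d ^+ 4)^-1 by rewrite ds invrK.
  by field; rewrite !gt_eqF ?exprn_gt0.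
have c1 : cosh s = (1 + expR (- s) / expR s) / 2 * expR s.
  by rewrite /cosh; field; rewrite gt_eqF.
have x0 : 0 <= expR (- s) / expR s by rewrite divr_ge0 ?expR_ge0.
have x1 : expR (- s) / expR s <= d ^+ 4.
  rewrite ds expRN -invfM lef_pV2 ?posrE ?mulr_gt0 //.
  rewrite -expRD; apply: le_trans (expR_ge1Dx _); lra.
apply/andP; split.
  rewrite ler_pdivlMr //; apply: le_trans (weighted_sum_lower sn s4 d0 d1).
  rewrite dB c1 /lower_limit ds  -mulrBl -[X in X <= _]mulrA ler_wpM2l ?expR_ge0 //  ler_pM2r //.
  lra.
rewrite ler_pdivrMr //; apply: le_trans (weighted_sum_upper sn s4 d0 d1) _.
rewrite dB c1 /upper_limit [leRHS]mulrDl.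
have -> : (1 + d) / (2 * s) = (1 + d) * d ^+ 4 / 2.
  by rewrite ds; field; rewrite gt_eqF.
rewrite mulrA lerD2r ler_pM2r //.
set E := expR (_ + _); move: (expR (- s) / expR s) x0 x1 => x x0 x1.
rewrite ler_wpM2l ?expR_ge0 //; lra.
Qed.

End Limit.

(** * Asymptotics of the roots *)

Section Roots.
Variable R : realType.

Lemma sqrtr_cvg_infty (u : nat -> R) : u @ \oo --> +oo -> Num.sqrt (u n) @[n --> \oo] --> +oo.
Proof.
move=> /cvgryPge uoo; apply/cvgryPge => A.
near=> m; apply: (le_trans (ler_norm A)).
rewrite -sqrtr_sqr ler_wsqrtr //; near: m; exact: uoo.
Unshelve. all: by end_near.
Qed.

Lemma invr_cvg_infty (u : nat -> R) : u @ \oo --> +oo -> (u n)^-1 @[n --> \oo] --> (0 : R).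
Proof.
move=> uoo; apply/(@gtr0_cvgV0 R) => //.
by move/cvgryPgt: uoo => /(_ 0).
Qed.

Lemma inv_sqrt_cvg : (Num.sqrt n%:R)^-1 @[n --> \oo] --> (0 : R).
Proof. by apply: invr_cvg_infty; apply: sqrtr_cvg_infty; exact: cvgr_idn. Qed.

Lemma inv_cvg : n%:R^-1 @[n --> \oo] --> (0 : R).
Proof. by apply: invr_cvg_infty; exact: cvgr_idn. Qed.

Lemma ln_sqrt (x : R) : ln (Num.sqrt x) = ln x / 2.
Proof.
have [x0|x0] := leP x 0; first by rewrite ler0_sqrtr // ln0 // ln0 // mul0r.
by rewrite -{2}[x]sqr_sqrtr ?ltW // lnXn ?sqrtr_gt0 // mulr2n; field.
Qed.

Lemma ln_div_cvg : ln n%:R / n%:R @[n --> \oo] --> (0 : R).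
Proof.
have h : 2 * (Num.sqrt n%:R)^-1 @[n --> \oo] --> (0 : R).
  by rewrite -(mulr0 2); apply: cvgM; [exact: cvg_cst|exact: inv_sqrt_cvg].
apply: (squeeze_cvgr _ (cvg_cst 0) h).
near=> n; have n0 : (0 < n)%N by near: n; exact: nbhs_infty_gt.
have N0 : 0 < n%:R :> R by rewrite ltr0n.
rewrite divr_ge0 ?ln_ge0 ?ler1n //= ler_pdivrMr //.
set s := Num.sqrt _; have s0 : 0 < s by rewrite sqrtr_gt0.
have -> : n%:R = s * s :> R by rewrite -expr2 sqr_sqrtr ?ltW.
have -> : 2 / s * (s * s) = 2 * s by field; rewrite gt_eqF.
rewrite lnM ?posrE //.
by have := @le_ln1Dx R (s - 1); rewrite addrCA subrr addr0 => /(_ ltac:(lra)); lra.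
Unshelve. all: by end_near.
Qed.

(** The logarithm of the n-th root of I n divided by sqrt (n / e). *)
Definition root_error n : R := ln (involution_number n)%:R / n%:R - (ln n%:R - 1) / 2.

Lemma root_error_cvg : root_error n @[n --> \oo] --> (0 : R).
Proof.
have [l sl] := @stirling_log_cvg R.
(* This is exactly what the lower bound sqrt (n!) gives; the factor exp (2 sqrt n) of the upper
   bound adds 2 / sqrt n. *)
have a : (ln n%:R / n%:R) / 4 + stirling_log R n * n%:R^-1 / 2 @[n --> \oo] --> (0 : R).
  rewrite [X in _ --> X](_ : 0 = 0 / 4 + l * 0 / 2); last by rewrite mulr0 !mul0r addr0.
  apply: cvgD; (apply: cvgM; last exact: cvg_cst); first exact: ln_div_cvg.
  by apply: cvgM => //; exact: inv_cvg.
have c : ((ln n%:R / n%:R) / 4 + stirling_log R n * n%:R^-1 / 2) + 2 * (Num.sqrt n%:R)^-1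
     @[n --> \oo] --> (0 : R).
  rewrite [X in _ --> X](_ : 0 = 0 + 2 * 0); last by rewrite mulr0 addr0.
  by apply: cvgD => //; apply: cvgM; [exact: cvg_cst|exact: inv_sqrt_cvg].
apply: (squeeze_cvgr _ a c).
near=> n; have n0 : (0 < n)%N by near: n; exact: nbhs_infty_gt.
have N0 : 0 < n%:R :> R by rewrite ltr0n.
have [b1 b2] := involution_number_bounds R n.
have f0 : 0 < n`!%:R :> R by rewrite ltr0n fact_gt0.
have i0 : 0 < (involution_number n)%:R :> R by apply: lt_le_trans b1; rewrite sqrtr_gt0.
have {}b1 : ln n`!%:R / 2 <= ln (involution_number n)%:R :> R.
  by rewrite -ln_sqrt ler_ln ?posrE ?sqrtr_gt0.
have {}b2 : ln (involution_number n)%:R <= ln n`!%:R / 2 + 2 * Num.sqrt n%:R :> R.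
  rewrite -ln_sqrt -[X in _ <= _ + X]expRK -lnM ?posrE ?sqrtr_gt0 ?expR_gt0 //.
  by rewrite ler_ln ?posrE ?mulr_gt0 ?sqrtr_gt0 ?expR_gt0.
have e : ln n%:R / n%:R / 4 + stirling_log R n / n%:R / 2 =
   (ln n`!%:R / 2) / n%:R - (ln n%:R - 1) / 2 :> R.
  by rewrite /stirling_log; field; rewrite gt_eqF.
rewrite e /root_error; apply/andP; split.
  by rewrite lerD2r ler_pM2r ?invr_gt0.
rewrite -addrAC lerD2r ler_pdivrMr // mulrDl mulfVK ?gt_eqF //.
rewrite (_ : 2 / Num.sqrt n%:R * n%:R = 2 * Num.sqrt n%:R :> R) //.
set s := Num.sqrt _; have s0 : 0 < s by rewrite sqrtr_gt0.
have -> : n%:R = s * s :> R by rewrite -expr2 sqr_sqrtr ?ltW.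
by field; rewrite gt_eqF.
Unshelve. all: by end_near.
Qed.

Lemma involution_number_gt0 n : (0 < involution_number n)%N.
Proof.
have [b _] := involution_number_bounds R n; rewrite -(ltr0n R).
by apply: lt_le_trans b; rewrite sqrtr_gt0 ltr0n fact_gt0.
Qed.

Lemma involution_number_root :
  (involution_number n)%:R `^ n%:R^-1 / (1 / Num.sqrt (expR 1) * Num.sqrt n%:R)
    @[n --> \oo] --> (1 : R).
Proof.
rewrite -[X in _ --> X]expR0; apply: (@cvg_trans _ (expR (root_error n) @[n --> \oo])); last first.
  by apply: continuous_cvg; [exact: continuous_expR|exact: root_error_cvg].
apply: near_eq_cvg; near=> n; have n0 : (0 < n)%N by near: n; exact: nbhs_infty_gt.
have N0 : 0 < n%:R :> R by rewrite ltr0n.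
have i0 : 0 < (involution_number n)%:R :> R by rewrite ltr0n involution_number_gt0.
have e0 := expR_gt0 (1 : R).
have d0 : 0 < 1 / Num.sqrt (expR 1) * Num.sqrt n%:R :> R.
  by rewrite mulr_gt0 ?sqrtr_gt0 // divr_gt0 ?sqrtr_gt0.
have p0 := powR_gt0 n%:R^-1 i0.
apply: ln_inj; [by rewrite posrE expR_gt0|by rewrite posrE divr_gt0|].
rewrite expRK ln_div ?posrE ?powR_gt0 // ln_powR mul1r lnM ?posrE ?invr_gt0 ?sqrtr_gt0 //.
rewrite lnV ?posrE ?sqrtr_gt0 // !ln_sqrt expRK /root_error; lra.
Unshelve. all: by end_near.
Qed.

Lemma double_cvg : (2 * n)%N @[n --> \oo] --> \oo.
Proof. exact: cvg_mulnl. Qed.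

(** The n-th root is the square of the 2n-th root, hence the factor 2 before [root_error] at 2n. *)
Lemma involution_number_double_root :
  (involution_number (2 * n))%:R `^ n%:R^-1 / (2 / expR 1 * n%:R) @[n --> \oo] --> (1 : R).
Proof.
rewrite -[X in _ --> X]expR0; apply: (@cvg_trans _ (expR (2 * root_error (2 * n)) @[n --> \oo])); last first.
  apply: continuous_cvg; first exact: continuous_expR.
  rewrite -(mulr0 2); apply: cvgM; first exact: cvg_cst.
  exact: (cvg_comp _ _ double_cvg root_error_cvg).
apply: near_eq_cvg; near=> n; have n0 : (0 < n)%N by near: n; exact: nbhs_infty_gt.
have N0 : 0 < n%:R :> R by rewrite ltr0n.
have i0 : 0 < (involution_number (2 * n))%:R :> R by rewrite ltr0n involution_number_gt0.
have e0 := expR_gt0 (1 : R).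
have d0 : 0 < 2 / expR 1 * n%:R :> R by rewrite mulr_gt0 // divr_gt0.
have p0 := powR_gt0 n%:R^-1 i0.
apply: ln_inj; [by rewrite posrE expR_gt0|by rewrite posrE divr_gt0|].
rewrite expRK ln_div ?posrE ?powR_gt0 // ln_powR lnM ?posrE ?divr_gt0 //.
rewrite ln_div ?posrE // expRK /root_error natrM lnM ?posrE //.
by field; rewrite gt_eqF.
Unshelve. all: by end_near.
Qed.

End Roots.

(** * The precise asymptotics at even arguments *)

Section Even.
Variable R : realType.
Local Notation scale n := (Num.sqrt (2 * n%:R) : R).

Lemma scale_infty : scale n @[n --> \oo] --> +oo.
Proof.
apply: sqrtr_cvg_infty.
rewrite (_ : (fun n => _) = (fun n => (2 * n)%:R)); last by apply/funext => n; rewrite natrM.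
exact: (cvg_comp _ _ double_cvg (@cvgr_idn R)).
Qed.

Lemma upper_limit_cvg (d : nat -> R) : d @ \oo --> (0 : R) ->
  upper_limit (d n) @[n --> \oo] --> expR (- (1 / 4)) / 2.
Proof.
move=> d0; rewrite /upper_limit.
have e k : d n ^+ k.+1 @[n --> \oo] --> (0 : R).
  elim: k => [|k IH]; first by under eq_fun do rewrite expr1.
  under eq_fun do rewrite exprS; rewrite -(mulr0 0); exact: cvgM.
have c1 s : 1 + s * d n @[n --> \oo] --> (1 : R).
  rewrite -[X in _ --> X]addr0 -[X in _ + X](mulr0 s).
  by apply: cvgD; [exact: cvg_cst|apply: cvgM => //; exact: cvg_cst].
rewrite (_ : _ / 2 = expR (- ((1 * 1) / 4) + 1 * 0 / 2) * ((1 + 0) / 2) + 0); last first.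
  by rewrite !mul1r mul0r !addr0 mul1r.
apply: cvgD; last exact: e.
apply: cvgM; last first.
  by apply: cvgM; [apply: cvgD; [exact: cvg_cst|exact: e]|exact: cvg_cst].
apply: continuous_cvg; first exact: continuous_expR.
apply: cvgD.
  apply: cvgN; apply: cvgM; last exact: cvg_cst.
  under eq_fun do rewrite -mulN1r expr2.
  by apply: cvgM; exact: c1.
apply: cvgM; last exact: cvg_cst.
apply: cvgM; last exact: e.
under eq_fun do rewrite -[d _]mul1r.
exact: c1.
Qed.

Lemma lower_limit_cvg (d : nat -> R) : d @ \oo --> (0 : R) ->
  lower_limit (d n) @[n --> \oo] --> expR (- (1 / 4)) / 2.
Proof.
move=> d0; rewrite /lower_limit.
have e k : d n ^+ k.+1 @[n --> \oo] --> (0 : R).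
  elim: k => [|k IH]; first by under eq_fun do rewrite expr1.
  under eq_fun do rewrite exprS; rewrite -(mulr0 0); exact: cvgM.
have c1 : 1 + d n @[n --> \oo] --> (1 : R).
  by rewrite -[X in _ --> X]addr0; apply: cvgD => //; exact: cvg_cst.
rewrite (_ : _ / 2 = expR (- ((1 * 1) / 4 / (1 - 2 * 0))) * (2^-1 - 0)); last first.
  by rewrite mulr0 !subr0 !mul1r divr1.
apply: cvgM; last by apply: cvgB; [exact: cvg_cst|exact: e].
apply: continuous_cvg; first exact: continuous_expR.
apply: cvgN; apply: cvgM.
  apply: cvgM; last exact: cvg_cst.
  by under eq_fun do rewrite expr2; exact: cvgM.
apply: cvgV; first by rewrite mulr0 subr0 oner_neq0.
apply: cvgB; first exact: cvg_cst.
by apply: cvgM; [exact: cvg_cst|exact: e].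
Qed.

Lemma weighted_sum_cvg : weighted_sum R n / expR (scale n) @[n --> \oo] --> expR (- (1 / 4)) / 2.
Proof.
pose d n : R := (Num.sqrt (Num.sqrt (scale n)))^-1.
have d0 : d @ \oo --> (0 : R).
  by apply: invr_cvg_infty; do 2 apply: sqrtr_cvg_infty; exact: scale_infty.
apply: (squeeze_cvgr _ (lower_limit_cvg d0) (upper_limit_cvg d0)).
near=> n.
have s4 : 4 <= scale n by near: n; move/cvgryPge: scale_infty; apply.
have s0 : 0 < scale n by lra.
have r1 : 1 < Num.sqrt (scale n) by rewrite -[ltLHS]sqrtr1 ltr_sqrt //; lra.
have r0 : 0 < Num.sqrt (scale n) by lra.
apply: weighted_sum_squeeze => //.
- by rewrite sqr_sqrtr // mulr_ge0.
- by rewrite invr_gt0 sqrtr_gt0.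
- rewrite invf_lt1; last by rewrite sqrtr_gt0.
  by rewrite -[ltLHS]sqrtr1 ltr_sqrt.
- by rewrite /d exprVn (exprM _ 2 2) sqr_sqrtr ?(ltW r0) // sqr_sqrtr // ltW.
Unshelve. all: by end_near.
Qed.

(** The logarithm is [stirling_log] at 2n minus that at n, two sequences with the same limit; sqrt 2
    is what remains of (2n)^(1/2) / n^(1/2). *)
Lemma stirling_ratio_cvg :
  ((2 * n)`!%:R / (2 ^+ n * n`!%:R)) / (Num.sqrt 2 * (2 * n%:R / expR 1) ^+ n)
    @[n --> \oo] --> (1 : R).
Proof.
rewrite -[X in _ --> X]expR0.
apply: (@cvg_trans _ (expR (stirling_log R (2 * n) - stirling_log R n) @[n --> \oo])); last first.
  apply: continuous_cvg; first exact: continuous_expR.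
  have [l sl] := @stirling_log_cvg R.
  rewrite -(subrr l); apply: cvgB => //.
  exact: (cvg_comp _ _ double_cvg sl).
apply: near_eq_cvg; near=> n; have n0 : (0 < n)%N by near: n; exact: nbhs_infty_gt.
have N0 : 0 < n%:R :> R by rewrite ltr0n.
have f0 m : 0 < m`!%:R :> R by rewrite ltr0n fact_gt0.
have e0 := expR_gt0 (1 : R).
have q0 : 0 < 2 * n%:R / expR 1 :> R by rewrite divr_gt0 ?mulr_gt0.
have p0 : 0 < 2 ^+ n * n`!%:R :> R by rewrite mulr_gt0 ?exprn_gt0.
have d0 : 0 < Num.sqrt 2 * (2 * n%:R / expR 1) ^+ n :> R.
  by rewrite mulr_gt0 ?sqrtr_gt0 ?exprn_gt0.
have u0 : 0 < (2 * n)`!%:R / (2 ^+ n * n`!%:R) :> R by rewrite divr_gt0.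
apply: ln_inj; [by rewrite posrE expR_gt0|by rewrite posrE divr_gt0|].
rewrite expRK ln_div ?posrE // ln_div ?posrE // !lnM ?posrE ?exprn_gt0 ?sqrtr_gt0 //.
rewrite !lnXn // ln_sqrt ln_div ?posrE ?mulr_gt0 // expRK lnM ?posrE //.
rewrite /stirling_log !natrM lnM ?posrE // -![ln _ *+ n]mulr_natr -mulr_natr.
by field.
Unshelve. all: by end_near.
Qed.

Lemma involution_number_double_asymp :
  (involution_number (2 * n))%:R / (n%:R ^+ n * 2 `^ (n%:R - 1 / 2)
               * expR (- n%:R + Num.sqrt (2 * n%:R) - 1 / 4)
               * (1 + 7 / (24 * Num.sqrt (2 * n%:R)))) @[n --> \oo] --> (1 : R).
Proof.
have E0 := expR_gt0 (- (1 / 4) : R).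
have c7 : (1 + 7 / 24 * (scale n)^-1)^-1 @[n --> \oo] --> (1 : R).
  rewrite -[X in _ --> X]invr1; apply: cvgV; first by rewrite oner_neq0.
  rewrite -[X in _ --> X]addr0 -[X in _ + X](mulr0 (7 / 24)).
  apply: cvgD; first exact: cvg_cst.
  apply: cvgM; first exact: cvg_cst.
  by apply: invr_cvg_infty; exact: scale_infty.
have cS : weighted_sum R n / expR (scale n) * (expR (- (1 / 4)) / 2)^-1 @[n --> \oo] --> (1 : R).
  rewrite -[X in _ --> X](@divff _ (expR (- (1 / 4)) / 2)); last by rewrite gt_eqF ?divr_gt0.
  by apply: cvgM; [exact: weighted_sum_cvg|exact: cvg_cst].
(* The quotient factors into the Stirling ratio, the normalized weighted sum and the bracket. The
   power of 2 is 2^n sqrt 2 / 2 = 2^(n - 1/2), its 1/2 coming from cosh s. *)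
rewrite [X in _ --> X](_ : 1 = 1 * 1 * 1 :> R); last by rewrite !mulr1.
apply: cvg_trans (cvgM (cvgM stirling_ratio_cvg cS) c7); apply: near_eq_cvg.
near=> n; have n0 : (0 < n)%N by near: n; exact: nbhs_infty_gt.
have N0 : 0 < n%:R :> R by rewrite ltr0n.
have e0 := expR_gt0 (1 : R).
have s0 : 0 < scale n by rewrite sqrtr_gt0 mulr_gt0.
have r0 : 0 < Num.sqrt 2 :> R by rewrite sqrtr_gt0.
rewrite involution_number_even // /=.
have -> : 2 `^ (n%:R - 1 / 2) = 2 ^+ n * Num.sqrt 2 / 2 :> R.
  rewrite powRB; last by rewrite pnatr_eq0 implybT.
  rewrite powR_mulrn // mul1r powR12_sqrt //.
  have r2 : Num.sqrt 2 ^+ 2 = 2 :> R by rewrite sqr_sqrtr.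
  rewrite -[X in _ = _ / X]r2.
  by field; rewrite gt_eqF.
rewrite !expRD (expRN n%:R).
have -> : expR n%:R = expR 1 ^+ n :> R by rewrite -expRM_natl mulr1.
rewrite -[\sum_(_ < _) _]/(weighted_sum R n) !expr_div_n exprMn.
have w0 : 1 + 7 / 24 / scale n != 0 by rewrite gt_eqF // ltr_pwDl // divr_ge0 // ltW.
have -> : 7 / (24 * scale n) = 7 / 24 / scale n by field; rewrite gt_eqF.
move: (1 + 7 / 24 / scale n) w0 => w w0.
have F0 : (2 * n)`!%:R != 0 :> R by rewrite pnatr_eq0 -lt0n fact_gt0.
have f0 : n`!%:R != 0 :> R by rewrite pnatr_eq0 -lt0n fact_gt0.
move: (expR_gt0 (scale n)) (weighted_sum R n) (lt0r_neq0 E0).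
move: ((2 * n)`!%:R) F0 => D D0.
have T0 : 2 ^+ n != 0 :> R by rewrite expf_neq0.
have Nn0 : n%:R ^+ n != 0 :> R by rewrite expf_neq0 // gt_eqF.
have en0 : expR 1 ^+ n != 0 :> R by rewrite expf_neq0 // gt_eqF.
move: (n`!%:R) f0 (expR (scale n)) (expR (- (1 / 4))) (2 ^+ n) T0 (n%:R ^+ n) Nn0 (expR 1 ^+ n) en0.
move=> f f0 es E T T0 Nn Nn0 en en0 es0 S Ee0.
have s2 := lt0r_neq0 r0.
move: (Num.sqrt 2) s2 => q q0; have es1 := lt0r_neq0 es0.
by field; rewrite en0 w0 Ee0 es1 q0 T0 Nn0 f0.
Unshelve. all: by end_near.
Qed.

End Even.

Lemma size_tens_pow X n : size (tens_pow X n) = (n * size X)%N.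
Proof. by elim: n => [|n IH]; rewrite /tens_pow //= size_cat IH mulSn. Qed.

Lemma cd_involution_number (K : numClosedFieldType) n : cd K n = involution_number n.
Proof. by rewrite -card_involutions -(cd_involutions K). Qed.

Lemma b_involution_number (K : numClosedFieldType) (t : K) X n : generic t ->
  b t X n = involution_number (n * size X).
Proof. by move=> gt; rewrite b_involutions // card_involutions size_tens_pow. Qed.

Theorem mainTheorem7 (R : realType) (t : R[i]) (t_generic : generic t) :
  asymp (fun n : nat => (b t wup n)%:R `^ (n%:R)^-1)
        (fun n : nat => 1 / Num.sqrt (expR 1) * Num.sqrt n%:R : R)
  /\
  [/\ forall n : nat,
        b t (wup ++ wdown) n =
          (\sum_(0 <= k < n.+1) cd R[i] k ^ 2 * 'C(n, k) ^ 2 * (n - k)`!)%N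
        /\ b t (wup ++ wdown) n = cd R[i] (2 * n)%N,
      asymp (fun n : nat => (b t (wup ++ wdown) n)%:R)
            (fun n : nat =>
               n%:R ^+ n * 2 `^ (n%:R - 1 / 2)
               * expR (- n%:R + Num.sqrt (2 * n%:R) - 1 / 4)
               * (1 + 7 / (24 * Num.sqrt (2 * n%:R))) : R)
    & asymp (fun n : nat => (b t (wup ++ wdown) n)%:R `^ (n%:R)^-1)
            (fun n : nat => 2 / expR 1 * n%:R : R)].
Proof.
have bup n : b t wup n = involution_number n.
  by rewrite b_involution_number // muln1.
have bdouble n : b t (wup ++ wdown) n = involution_number (2 * n).
  by rewrite b_involution_number // mulnC.
split; first by rewrite /asymp; under eq_fun do rewrite bup; exact: involution_number_root.
split.
- move=> n; split; last by rewrite bdouble cd_involution_number.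
  rewrite bdouble involution_number_double.
  by under [RHS]eq_bigr do rewrite cd_involution_number.
- rewrite /asymp; under eq_fun do rewrite bdouble.
  exact: involution_number_double_asymp.
- rewrite /asymp; under eq_fun do rewrite bdouble.
  exact: involution_number_double_root.
Qed.
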